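(* Let $G$ be an undirected connected multigraph with vertex set $[n]$, and let $I_G^t\subset R[t]$ denote the homogenization of the toppling ideal $I_G$ with respect to the weight function $w$. The sequence $$\mathcal F_t(G):\quad 0\to F_{t,n-1}\xrightarrow{\delta_{t,n-1}}\cdots\xrightarrow{\delta_{t,2}}F_{t,1}\xrightarrow{\delta_{t,1}}F_{t,0}$$ is a minimal free resolution of $R[t]/I_G^t$ (over $R[t]$; minimality meaning that the image of each $\delta_{t,k}$ lies in $\langle x_1,\dots,x_n\rangle F_{t,k-1}$).
   Context: $\mathbb K$ is a field, $R=\mathbb K[x_1,\dots,x_n]$. $G$ is given by a symmetric adjacency matrix $A_G=(a_{ij})$ of nonnegative integers. Its Laplacian is $\Lambda_G=\Delta-A_G$, $\Delta$ diagonal with $\Delta_{ii}=\sum_ja_{ij}$; the toppling ideal is $I_G=\langle\mathbf x^u-\mathbf x^v:u,v\in\mathbb N^n,\ u-v\in\mathbb Z^n\Lambda_G\rangle$. Acyclic partitions. A connected $k$-partition is a set partition $\Pi$ of $[n]$ into $k$ nonempty parts, each inducing a connected subgraph of $G$. $G_\Pi$ is the multigraph on the set $\Pi$ in which the weight between $U,W$ is $\sum_{u\in U,w\in W}a_{uw}$; distinct $U,W$ are joined by one edge iff this is positive. An acyclic $k$-partition $\mathcal C$ is a connected $k$-partition $\Pi(\mathcal C)$ together with an acyclic orientation of $G_{\Pi(\mathcal C)}$, regarded as a directed graph on $\Pi(\mathcal C)$; it is $n$-acyclic if its unique sink is the part containing $n$. For $u\in U\in\Pi(\mathcal C)$ put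 $out_{\mathcal C}(u)=\sum_{W:(U,W)\in\mathcal C}\sum_{w\in W}a_{uw}$ and $D(\mathcal C)=(out_{\mathcal C}(u))_{u\in[n]}\in\mathbb Z^n$. Chip firing equivalence. Two elements of $\mathbb Z^V$ are linearly equivalent on a multigraph with vertex set $V$ if they differ by an element of the row lattice of its Laplacian. For acyclic $k$-partitions with the same $\Pi$, $\mathcal C_1\sim\mathcal C_2$ iff $p(D(\mathcal C_1))$, $p(D(\mathcal C_2))$ are linearly equivalent on $G_\Pi$, where $p(D)_U=\sum_{j\in U}D_j$. $[\mathcal C]$ is the class of $\mathcal C$. Each class contains a unique $n$-acyclic element. Contraction. An edge $e=(e^-,e^+)$ of $\mathcal C$ is contractible in $\mathcal C$ if the directed graph $\mathcal C/e$ obtained by merging $e^-,e^+$ into $e^-\cup e^+$ (and deleting $e$) has no directed cycle (including 2-cycles). A directed edge $e$ is a contractible edge of a class $\mathfrak c$ if it appears and is contractible in some $\mathcal C\in\mathfrak c$; then $\mathfrak c/e:=[\mathcal C/e]$ and $m_{\mathfrak c}(e):=\mathbf x^{D(\mathcal C)-D(\mathcal C/e)}$ are independent of $\mathcal C$. $f/e$ denotes the edge induced by $f$ after contracting $e$. Signs. Fix functions $\operatorname{sign}_{\mathfrak c}$ from contractible edges of $\mathfrak c$ to $\{\pm1\}$, one for each class $\mathfrak c$, such that (i) $\operatorname{sign}_{\mathfrak c}(e)\operatorname{sign}_{\mathfrak c/e}(f/e)=-\operatorname{sign}_{\mathfrak c}(f)\operatorname{sign}_{\mathfrak c/f}(e/f)$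 for distinct contractible edges $e,f$ of $\mathfrak c$ with $f/e$ contractible in $\mathfrak c/e$ and $e/f$ contractible in $\mathfrak c/f$; (ii) $\operatorname{sign}_{\mathfrak c}((A,B))=-\operatorname{sign}_{\mathfrak c}((B,A))$ whenever both are contractible edges of $\mathfrak c$. Weights. Fix $y$ in the image of $\Lambda_G:\mathbb Z^n\to\mathbb Z^n$ with $y_i>0$ for all $i\neq n$, and $\lambda\in\mathbb Z^n$ with $\Lambda_G\lambda=y$ and $\lambda_i>0$ for all $i$. For a class $\mathfrak c$ put $\varepsilon_{\mathfrak c}=\lambda\cdot D(\mathcal C)$, where $\mathcal C\in\mathfrak c$ is the $n$-acyclic element. For a monomial $\mathbf x^u$ and a class $\mathfrak c$ put $w(\mathbf x^ue_{\mathfrak c})=\lambda\cdot u+\varepsilon_{\mathfrak c}$; on monomials of $R$, $w(\mathbf x^u)=\lambda\cdot u$. The homogenization of $f=\sum_uc_u\mathbf x^u\in R$ is $\tilde f=\sum_uc_u t^{W-\lambda\cdot u}\mathbf x^u\in R[t]$ with $W=\max\{\lambda\cdot u:c_u\ne0\}$, and $I_G^t$ is the ideal of $R[t]$ generated by all $\tilde f$, $f\in I_G$. The complex. For $0\le k\le n-1$, $F_{t,k}=\bigoplus_{\mathfrak c}R[t]\tilde e_{\mathfrak c}$, over all chip firing equivalence classes $\mathfrak c$ of acyclic $(k+1)$-partitions, and $\delta_{t,k}:F_{t,k}\to F_{t,k-1}$ is $$\delta_{t,k}(\tilde e_{\mathfrak c})=\sum_f\operatorname{sign}_{\mathfrak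 c}(f)\,t^{\varepsilon_{\mathfrak c}-w(m_{\mathfrak c}(f)e_{\mathfrak c/f})}\,m_{\mathfrak c}(f)\,\tilde e_{\mathfrak c/f},$$ summed over the contractible edges $f$ of $\mathfrak c$ (the exponents of $t$ are nonnegative). It is graded by $(\mathbb Z^n/\mathbb Z^n\Lambda_G)\times\mathbb Z$, with $\tilde e_{\mathfrak c}$ in degree $([D(\mathcal C)],\varepsilon_{\mathfrak c})$ for $\mathcal C\in\mathfrak c$, $x_i$ in degree $([e_i],\lambda_i)$ and $t$ in degree $(0,1)$. *)

(* Defs.v *)
From HB Require Import structures.
From mathcomp Require Import all_boot all_order all_algebra.
From mathcomp Require Import mpoly.
From mathcomp Require Import boolp.

Set Implicit Arguments.
Unset Strict Implicit.
Unset Printing Implicit Defensive.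

Import Order.TTheory GRing.Theory Num.Theory.
Local Open Scope ring_scope.

(* ---------- Modules ---------- *)

Definition span (S : pzRingType) (M : lmodType S) (X : M -> Prop) (v : M) :
    Prop :=
  exists (N : nat) (a : 'I_N -> S) (g : 'I_N -> M),
    (forall i, X (g i)) /\ v = \sum_i a i *: g i.

Definition ideal_gen (S : pzRingType) (X : S -> Prop) : S -> Prop :=
  @span S S^o X.

Definition ideal_scale (S : pzRingType) (X : S -> Prop) (M : lmodType S) :
    M -> Prop :=
  span (fun v => exists x w, ideal_gen X x /\ v = x *: w).

Definition freemod (S : pzRingType) (B : finType) := {ffun B -> S^o}.

(* [d k] is the differential from homological degree k + 1 to degree k.
   The modules are indexed by all of nat and vanish above degree l, so that
   exactness in degree l says that the leftmost differential is injective.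
   The last two exactness fields say that F_1 -> F_0 -> S/I -> 0 is exact,
   the map onto S/I being induced by [aug]. *)
Record minimal_free_resolution (S : comNzRingType) (X : S -> Prop)
    (I : S -> Prop) (l : nat) (B : nat -> finType)
    (d : forall k, freemod S (B k.+1) -> freemod S (B k))
    (aug : freemod S (B 0%N) -> S^o) : Prop := MinimalFreeResolution {
  mfr_length : forall k, (l < k)%N -> #|B k| = 0%N;
  mfr_linear : forall k, linear (d k);
  mfr_aug_linear : linear aug;
  mfr_exact : forall k (v : freemod S (B k.+1)),
    d k v = 0 <-> exists w, d k.+1 w = v;
  mfr_exact0 : forall v : freemod S (B 0%N),
    I (aug v) <-> exists w, d 0%N w = v;
  mfr_surj : forall p : S, exists v, I (p - aug v);
  mfr_minimal : forall k w, ideal_scale X (d k w)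
}.

(* ---------- Multigraphs and directed graphs on a finite vertex set -------- *)

(* The diagonal of [a] plays no role: it cancels in the Laplacian. *)
Definition laplacian (T : finType) (a : T -> T -> nat) (i j : T) : int :=
  (if i == j then \sum_k a i k else 0)%N%:Z - (a i j)%:Z.

Definition lin_equiv (T : finType) (a : T -> T -> nat) (D1 D2 : T -> int) :
    Prop :=
  exists z : T -> int, forall j, D1 j - D2 j = \sum_i z i * laplacian a i j.

Definition induces_connected (T : finType) (a : T -> T -> nat) (U : {set T}) :
    bool :=
  [forall x in U, forall y in U,
     connect [rel u v | [&& u \in U, v \in U & (0 < a u v)%N]] x y].

Definition acyclic_digraph (T : finType) (E : {set T * T}) : bool :=
  [forall e in E, ~~ connect [rel x y | (x, y) \in E] e.2 e.1].

(* ---------- Acyclic partitions of the vertex set 'I_m.+1 ---------- *)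

(* The number of vertices is n = m + 1, and the vertex n is ord_max. *)
Section AcyclicPartitions.
Variables (m : nat) (A : 'M[nat]_m.+1).

Definition part := {set 'I_m.+1}.
Definition edge := (part * part)%type.

(* a set of parts together with a set of directed edges between them *)
Definition opart := ({set part} * {set edge})%type.

Definition parts (C : opart) : {set part} := C.1.
Definition arcs (C : opart) : {set edge} := C.2.

Definition weight (U W : part) : nat :=
  (\sum_(u in U) \sum_(w in W) A u w)%N.

Definition quotient_graph (P : {set part}) (U W : {U : part | U \in P}) : nat :=
  weight (val U) (val W).

Definition connected_partition (k : nat) (P : {set part}) : bool :=
  [&& partition P [set: 'I_m.+1], #|P| == k
    & [forall U in P, induces_connected (fun i j => A i j) U]].

Definition joined (P : {set part}) (U W : part) : bool :=
  [&& U \in P, W \in P, U != W & (0 < weight U W)%N].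

Definition orientation (P : {set part}) (E : {set edge}) : bool :=
  [forall U, forall W,
     (((U, W) \in E) ==> joined P U W)
     && (joined P U W ==> (((U, W) \in E) (+) ((W, U) \in E)))].

Definition acyclic_partition (k : nat) (C : opart) : bool :=
  [&& connected_partition k (parts C), orientation (parts C) (arcs C)
    & acyclic_digraph (arcs C)].

Definition sinks (C : opart) : {set part} :=
  [set U in parts C | [forall W, (U, W) \notin arcs C]].

Definition n_acyclic (C : opart) : bool :=
  sinks C == [set pblock (parts C) ord_max].

(* D(C), as an exponent vector *)
Definition outdiv (C : opart) : 'X_{1..m.+1} :=
  [multinom (\sum_(W | (pblock (parts C) u, W) \in arcs C)
               \sum_(w in W) A u w)%N | u < m.+1].

Definition push (P : {set part}) (D : 'X_{1..m.+1}) (U : {U : part | U \in P}) :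
    int :=
  \sum_(j in val U) (D j)%:Z.

Definition chip_equiv (C1 C2 : opart) : Prop :=
  parts C1 = parts C2
  /\ lin_equiv (@quotient_graph (parts C1))
       (@push (parts C1) (outdiv C1)) (@push (parts C1) (outdiv C2)).

Definition chip_class (C : opart) : {set opart} :=
  [set C' | acyclic_partition #|parts C| C' & `[< chip_equiv C C' >]].

Definition chip_classes (k : nat) : {set {set opart}} :=
  [set chip_class C | C in acyclic_partition k].

Definition merge (e : edge) (U : part) : part :=
  if (U == e.1) || (U == e.2) then e.1 :|: e.2 else U.

(* f/e *)
Definition edge_contract (f e : edge) : edge := (merge e f.1, merge e f.2).

(* C/e *)
Definition contract (C : opart) (e : edge) : opart :=
  (merge e @: parts C, [set edge_contract f e | f in arcs C :\ e]).

Definition contractible (C : opart) (e : edge) : bool :=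
  (e \in arcs C) && acyclic_digraph (arcs (contract C e)).

Definition class_contractible (c : {set opart}) (e : edge) : bool :=
  [exists C in c, contractible C e].

(* an element of c in which e is contractible; c/e and m_c(e) do not depend on
   which one is picked *)
Definition realizer (c : {set opart}) (e : edge) : opart :=
  odflt (set0, set0) [pick C in c | contractible C e].

Definition class_contract (c : {set opart}) (e : edge) : {set opart} :=
  chip_class (contract (realizer c e) e).

(* D(C) - D(C/e) has nonnegative coordinates, hence the truncated subtraction
   of exponent vectors is exact here *)
Definition class_monom (c : {set opart}) (e : edge) : 'X_{1..m.+1} :=
  (outdiv (realizer c e) - outdiv (contract (realizer c e) e))%MM.

Definition is_sign_system (sign : {set opart} -> edge -> int) : Prop :=
  forall k c, c \in chip_classes k ->
  [/\ forall e, class_contractible c e -> sign c e = 1 \/ sign c e = -1,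
      forall e f, e != f ->
        class_contractible c e -> class_contractible c f ->
        class_contractible (class_contract c e) (edge_contract f e) ->
        class_contractible (class_contract c f) (edge_contract e f) ->
        sign c e * sign (class_contract c e) (edge_contract f e)
        = - (sign c f * sign (class_contract c f) (edge_contract e f))
    & forall U W, class_contractible c (U, W) -> class_contractible c (W, U) ->
        sign c (U, W) = - sign c (W, U)].

(* ---------- Weights ---------- *)

Definition laplacian_mx : 'M[int]_m.+1 :=
  \matrix_(i, j) laplacian (fun i j => A i j) i j.

Definition wdeg (lambda : 'cV[int]_m.+1) (u : 'X_{1..m.+1}) : int :=
  \sum_i lambda i 0 * (u i)%:Z.

Definition class_weight (lambda : 'cV[int]_m.+1) (c : {set opart}) : int :=
  wdeg lambda (outdiv (odflt (set0, set0) [pick C in c | n_acyclic C])).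

Definition wterm (lambda : 'cV[int]_m.+1) (u : 'X_{1..m.+1})
    (c : {set opart}) : int :=
  wdeg lambda u + class_weight lambda c.

(* ---------- The toppling ideal and its homogenization ---------- *)

(* R = K[x_1, ..., x_n] is {mpoly K[m.+1]} and R[t] is {poly {mpoly K[m.+1]}},
   with t = 'X. *)
Variable K : fieldType.

Definition toppling_ideal : {mpoly K[m.+1]} -> Prop :=
  ideal_gen (fun g => exists u v : 'X_{1..m.+1},
    lin_equiv (fun i j => A i j) (fun i => (u i)%:Z) (fun i => (v i)%:Z)
    /\ g = 'X_[u] - 'X_[v]).

(* For positive lambda all the weights are nonnegative, so that 0 may serve as
   the base value of the maximum. The exponents of t, here and in
   [delta_basis], are nonnegative integers; the absolute value only turns them
   into elements of nat. *)
Definition homogenize (lambda : 'cV[int]_m.+1) (f : {mpoly K[m.+1]}) :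
    {poly {mpoly K[m.+1]}} :=
  let W := \big[Num.max/0]_(u <- msupp f) wdeg lambda u in
  \sum_(u <- msupp f) (f@_u *: 'X_[u])%:P * 'X^(`|W - wdeg lambda u|%N).

Definition homog_toppling_ideal (lambda : 'cV[int]_m.+1) :
    {poly {mpoly K[m.+1]}} -> Prop :=
  ideal_gen (fun g => exists f, toppling_ideal f /\ g = homogenize lambda f).

Definition is_variable (p : {poly {mpoly K[m.+1]}}) : Prop :=
  exists i : 'I_m.+1, p = ('X_i)%:P.

(* ---------- The complex ---------- *)

Definition Ft_index (k : nat) : finType :=
  {c : {set opart} | c \in chip_classes k.+1}.

Definition Ft (k : nat) := freemod {poly {mpoly K[m.+1]}} (Ft_index k).

Definition Ft_basis (k : nat) (c : {set opart}) : Ft k :=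
  [ffun c' => (val c' == c)%:R].

Definition delta_basis (lambda : 'cV[int]_m.+1)
    (sign : {set opart} -> edge -> int) (k : nat) (c : {set opart}) : Ft k :=
  \sum_(f | class_contractible c f)
     ((sign c f)%:~R
      * 'X^(`|class_weight lambda c
              - wterm lambda (class_monom c f) (class_contract c f)|%N)
      * ('X_[class_monom c f])%:P) *: Ft_basis k (class_contract c f).

(* delta lambda sign k is the map from F_{t,k+1} to F_{t,k} *)
Definition delta (lambda : 'cV[int]_m.+1)
    (sign : {set opart} -> edge -> int) (k : nat) (v : Ft k.+1) : Ft k :=
  \sum_(c : Ft_index k.+1) v c *: delta_basis lambda sign k (val c).

(* F_{t,0} has a single basis element, the class of the one-part partition; it
   is sent to 1. *)
Definition augmentation (v : Ft 0) : {poly {mpoly K[m.+1]}}^o := \sum_c v c.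

End AcyclicPartitions.

(* Main.v *)
(** Acyclic partitions are the cells cut out by height functions h on the
    vertices: the parts are the connected pieces of the level sets, and the edges
    descend. Two cells are equivalent iff their 0/1 descent functions on the
    edges of G differ by the gradient of an integer function on the vertices,
    and the representative with sink n is the one of largest weight in its
    class, since lambda . D increases when one fires the vertices from which
    no descending path leads to n.

    The square of the differential vanishes because the codimension two faces
    of a class come in pairs of iterated contractions with opposite signs.

    For exactness in positive degree, the terms of the differential without t
    are those in which an edge of the n-acyclic representative is contracted.
    Fix the total degree D = u + D(C) of a monomial x^u e_C. Dhar's burning
    algorithm applied to D leaves an unburnt set, and the first of the lowest
    connected pieces of this set is either contained in the sink part of C or a
    part of C. Toggling between the two cases matches the monomials, and
    the matching is triangular for the order by power of t and size of the sink
    part, so every cycle is reduced to 0 by boundaries.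

    In degree 0 the matching stops at superstable exponents. Firing the unburnt
    set moves every monomial to the superstable one of its class modulo the
    image of the differential, which therefore contains the homogenized
    binomials; an element of the toppling ideal is a combination of these since
    the sum of its coefficients over each class vanishes. *)

From mathcomp Require Import all_boot all_order all_algebra.
From mathcomp Require Import mpoly.
From mathcomp Require Import boolp.
From mathcomp Require Import zify ring.
Require Import Defs.

Set Implicit Arguments.
Unset Strict Implicit.
Unset Printing Implicit Defensive.

Import Order.TTheory GRing.Theory Num.Theory.
Local Open Scope ring_scope.

(** * Cells of height functions *)

(** Every function on the vertices defines an acyclic partition, so with heights acyclicity never
    has to be checked: splitting, merging, contracting and lifting become formulas on heights, of
    which only the comparisons along edges of G matter. Equivalence is defined on G_Pi, which a
    priori controls only sums over parts; the passage to gradients on G itself makes equivalence and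
    contraction compatible edge by edge. The class c/e is defined through an arbitrary
    representative, and it is decisive that each of its elements is C/e for some C in c: the power
    of t attached to e is then the weight of c minus lambda . D(C), for C lifting the n-acyclic
    element of c/e, and it vanishes exactly when C is itself n-acyclic. In the matching, the set
    that is split off or merged must be found again unchanged on the other side. It is therefore
    chosen by looking only at comparisons between unburnt vertices, and by a ranking that respects
    inclusion, so that the choice also survives in the faces where the sink part absorbs another
    part. *)

Lemma connect_preserved (T : finType) (e : rel T) (P : T -> Prop) x y :
  (forall u v, P u -> e u v -> P v) -> connect e x y -> P x -> P y.
Proof.
move=> step /connectP[p ep ->] {y}.
elim: p x ep => [|z p IH] x //= /andP[exz ep] Px.
by apply: IH ep _; apply: step exz.
Qed.

Lemma connect_transfer (T : finType) (e e' : rel T) (P : pred T) x y :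
  (forall u v, P u -> e u v -> P v && e' u v) -> P x -> connect e x y ->
  connect e' x y.
Proof.
move=> step Px /connectP[p ep ->] {y}.
elim: p x ep Px => [|z p IH] x /=; first by rewrite connect0.
move=> /andP[exz ep] Px; have /andP[Pz e'xz] := step _ _ Px exz.
by apply: connect_trans (connect1 e'xz) (IH _ ep Pz).
Qed.

Lemma card_reachable_lt (T : finType) (E : {set T * T}) x y :
  acyclic_digraph E -> (x, y) \in E ->
  (#|connect [rel x y | (x, y) \in E] y|
     < #|connect [rel x y | (x, y) \in E] x|)%N.
Proof.
move=> /'forall_implyP acE exy; apply/proper_card/properP; split.
  apply/subsetP=> z yz; apply: connect_trans yz.
  exact: (@connect1 _ [rel x y | (x, y) \in E]).
exists x; first exact: connect0.
exact: (acE _ exy).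
Qed.

Section Cells.
Variables (m : nat) (A : 'M[nat]_m.+1).
Hypothesis A_sym : forall i j, A i j = A j i.
Local Notation V := 'I_m.+1.
Implicit Types (h : V -> nat) (C : opart m) (e f g : edge m).

Definition adj (i j : V) : bool := (0 < A i j)%N.
Arguments adj : simpl never.

Lemma adjC i j : adj i j = adj j i.
Proof. by rewrite /adj A_sym. Qed.

Definition level h : rel V := [rel i j | adj i j && (h i == h j)].

Lemma levelE h i j : level h i j = adj i j && (h i == h j).
Proof. by []. Qed.

Lemma level_sym h : ssrbool.symmetric (level h).
Proof. by move=> i j; rewrite !levelE adjC eq_sym. Qed.

Definition cluster h (i : V) : {set V} := [set j | connect (level h) i j].

Lemma mem_cluster h i : i \in cluster h i.
Proof. by rewrite inE connect0. Qed.

Lemma cluster_height h i j : j \in cluster h i -> h j = h i.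
Proof.
rewrite inE => ij.
apply: (@connect_preserved _ _ (fun v => h v = h i) _ _ _ ij) => // u v hu.
by case/andP=> _ /eqP <-.
Qed.

Lemma cluster_eq h i j : j \in cluster h i -> cluster h j = cluster h i.
Proof.
rewrite inE => ij; apply/setP=> k; rewrite !inE.
by rewrite (same_connect (sym_connect_sym (@level_sym h)) ij).
Qed.

Lemma cluster_eqP h i j : reflect (cluster h i = cluster h j) (j \in cluster h i).
Proof.
apply: (iffP idP) => [/cluster_eq // | ->]; exact: mem_cluster.
Qed.

Lemma adj_cluster h i j : adj i j -> h i = h j -> j \in cluster h i.
Proof. by move=> aij hij; rewrite inE connect1 // levelE aij hij eqxx. Qed.

Definition cell h : opart m :=
  ([set cluster h i | i : V],
   [set (cluster h p.1, cluster h p.2) | p : V * V & adj p.1 p.2 && (h p.2 < h p.1)%N]).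

Lemma cell_partition h : partition (parts (cell h)) [set: V].
Proof.
apply/and3P; split.
- apply/eqP/setP=> i; rewrite inE; apply/bigcupP.
  by exists (cluster h i); rewrite ?mem_cluster //; apply: imset_f.
- apply/trivIsetP=> _ _ /imsetP[i _ ->] /imsetP[j _ ->] nij.
  rewrite -setI_eq0; apply: contra_neqT nij => /set0Pn[k].
  by rewrite inE => /andP[/cluster_eq <- /cluster_eq].
- apply/negP=> /imsetP[i _ ci0].
  by have := mem_cluster h i; rewrite -ci0 inE.
Qed.

Lemma cluster_in_parts h i : cluster h i \in parts (cell h).
Proof. exact: imset_f. Qed.

Lemma pblock_cell h i : pblock (parts (cell h)) i = cluster h i.
Proof.
have /and3P[_ tI _] := cell_partition h.
by apply: def_pblock tI _ (mem_cluster h i); apply: cluster_in_parts.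
Qed.

Lemma arcs_cellP h U W :
  reflect (exists i j, [/\ adj i j, (h j < h i)%N, U = cluster h i & W = cluster h j])
    ((U, W) \in arcs (cell h)).
Proof.
apply: (iffP imsetP) => [[[i j]]|[i [j [aij hij -> ->]]]].
  by rewrite inE => /andP[/= aij hij] [-> ->]; exists i, j.
by exists (i, j); rewrite // inE aij.
Qed.

Lemma arc_cell h i j :
  adj i j -> ((cluster h i, cluster h j) \in arcs (cell h)) = (h j < h i)%N.
Proof.
move=> aij; apply/arcs_cellP/idP => [[i' [j' [_ hij ci cj]]]|hij].
  have hi : h i = h i' by apply: cluster_height; rewrite -ci mem_cluster.
  have hj : h j = h j' by apply: cluster_height; rewrite -cj mem_cluster.
  by rewrite hi hj.
by exists i, j.
Qed.

Lemma cell_acyclic_digraph h : acyclic_digraph (arcs (cell h)).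
Proof.
apply/'forall_implyP=> -[U W] /= /arcs_cellP[i [j [_ hij -> ->]]].
apply/negP=> /connect_preserved.
move=> /(_ (fun X => exists2 k, X = cluster h k & (h k <= h j)%N)) [].
- move=> _ X [k -> hk] /= /arcs_cellP[a [b [_ hab ck ->]]]; exists b => //.
  have ha : h k = h a by apply: cluster_height; rewrite -ck mem_cluster.
  by rewrite (leq_trans (ltnW hab)) // -ha.
- by exists j.
move=> k cik hk.
have hik : h i = h k by apply: cluster_height; rewrite -cik mem_cluster.
by rewrite leqNgt -hik hij in hk.
Qed.

Lemma weight_gt0P (U W : part m) :
  reflect (exists u w, [/\ u \in U, w \in W & adj u w]) (0 < weight A U W)%N.
Proof.
rewrite lt0n sum_nat_eq0 negb_forall; apply: (iffP existsP).
  move=> [u]; rewrite negb_imply sum_nat_eq0 negb_forall.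
  move=> /andP[uU /existsP[w]]; rewrite negb_imply -lt0n => /andP[wW a].
  by exists u, w.
move=> [u [w [uU wW a]]]; exists u; rewrite uU /= sum_nat_eq0 negb_forall.
by apply/existsP; exists w; rewrite wW -lt0n.
Qed.

Lemma cell_orientation h : orientation A (parts (cell h)) (arcs (cell h)).
Proof.
apply/forallP=> U; apply/forallP=> W; apply/andP; split; apply/implyP.
  move=> /arcs_cellP[i [j [aij hij -> ->]]]; rewrite /joined !cluster_in_parts /=.
  apply/andP; split; last by apply/weight_gt0P; exists i, j; rewrite !mem_cluster.
  apply: contraTneq hij => cij; rewrite -leqNgt.
  by rewrite (@cluster_height h j i) // -cij mem_cluster.
case/and4P=> /imsetP[i _ ->] /imsetP[j _ ->] nij /weight_gt0P[u [w [ui wj a]]].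
rewrite -(cluster_eq ui) -(cluster_eq wj) arc_cell // arc_cell 1?adjC //.
case: ltngtP => // huw; case/negP: nij; apply/eqP.
by rewrite -(cluster_eq ui) -(cluster_eq wj); apply/cluster_eqP/adj_cluster.
Qed.

Lemma cell_acyclic h : acyclic_partition A #|parts (cell h)| (cell h).
Proof.
apply/and3P; split; last by apply: cell_acyclic_digraph.
  apply/and3P; split=> //; first exact: cell_partition.
  apply/'forall_implyP=> _ /imsetP[i _ ->].
  apply/'forall_implyP=> j ij; apply/'forall_implyP=> k.
  rewrite -(cluster_eq ij); move=> jk; have {jk} : k \in cluster h j by []; rewrite inE => jk.
  apply: (@connect_transfer _ (level h) _ (mem (cluster h i)) _ _ _ ij jk).
  move=> u v /= iu; rewrite levelE => /andP[auv /eqP huv].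
  have iv : v \in cluster h i by rewrite -(cluster_eq iu); apply: adj_cluster.
  by rewrite iv (cluster_eq ij) iv iu.
exact: cell_orientation.
Qed.

(** The number of parts reachable from the part of a vertex drops strictly along every arc; this is
    a canonical height function for a given acyclic partition. *)
Definition height C (i : V) : nat :=
  #|connect [rel U W | (U, W) \in arcs C] (pblock (parts C) i)|.

(** Adjacent vertices in different parts are joined by an arc, along which the number of reachable
    parts drops. So ties along edges occur exactly inside the parts, and these are connected by
    hypothesis. *)
Lemma cell_height k C : acyclic_partition A k C -> cell (height C) = C.
Proof.
case: C => P E /and3P[/and3P[/= partP _ connP] oriP acE].
set C := (P, E); set h := height C.
have /and3P[/eqP covP tIP P0] := partP.
have arcP U W : (U, W) \in E -> joined A P U W.
  by move/forallP: oriP => /(_ U)/forallP/(_ W)/andP[/implyP].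
have joinP U W : joined A P U W -> ((U, W) \in E) || ((W, U) \in E).
  move/forallP: oriP => /(_ U)/forallP/(_ W)/andP[_ /implyP] jn /jn.
  by case: (_ \in E).
have inP i : i \in pblock P i by rewrite mem_pblock covP inE.
have blP i : pblock P i \in P by rewrite pblock_mem // covP inE.
have blE U i : U \in P -> i \in U -> pblock P i = U by move=> ? ?; exact: def_pblock.
have arc_lt i j : (pblock P i, pblock P j) \in E -> (h j < h i)%N.
  exact: card_reachable_lt.
have sameP i j : adj i j -> h i = h j -> pblock P i = pblock P j.
  move=> aij hij; apply/eqP/negPn/negP=> nij.
  have jn : joined A P (pblock P i) (pblock P j).
    rewrite /joined !blP nij; apply/weight_gt0P; exists i, j; split=> //.
  by case/orP: (joinP _ _ jn) => /arc_lt; rewrite hij ltnn.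
have compE i : cluster h i = pblock P i.
  apply/setP=> j; apply/idP/idP.
    rewrite inE => ij; suff -> : pblock P i = pblock P j by [].
    apply: (@connect_preserved _ _ (fun v => pblock P i = pblock P v) _ _ _ ij).
      by move=> u v -> /andP[a /eqP/(sameP _ _ a)].
    by [].
  move=> ij; rewrite inE.
  have := connP => /'forall_implyP/(_ _ (blP i))/'forall_implyP/(_ _ (inP i)).
  move=> /'forall_implyP/(_ _ ij); apply: connect_sub => u v /= /and3P[iu iv a].
  apply: connect1; rewrite levelE /adj a.
  by rewrite /h /height /= (blE _ _ (blP i) iu) (blE _ _ (blP i) iv) eqxx.
congr (_, _).
  apply/setP=> U; apply/imsetP/idP => [[i _ ->]|UP]; first by rewrite compE.
  have /set0Pn[i iU] : U != set0 by apply: contraNneq P0 => <-.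
  by exists i; rewrite // compE (blE U).
apply/setP=> -[U W]; apply/arcs_cellP/idP.
  move=> [i [j [aij hij -> ->]]]; rewrite !compE.
  have nij : pblock P i != pblock P j.
    by apply: contraTneq hij => cij; rewrite /h /height /= cij ltnn.
  have jn : joined A P (pblock P i) (pblock P j).
    by rewrite /joined !blP nij; apply/weight_gt0P; exists i, j; split.
  by case/orP: (joinP _ _ jn) => // /arc_lt; rewrite ltnNge ltnW.
move=> UW; have /and4P[UP WP _ /weight_gt0P[u [w [uU wW a]]]] := arcP _ _ UW.
exists u, w; rewrite !compE (blE U) ?(blE W) //; split=> //.
by apply: arc_lt; rewrite (blE U) ?(blE W).
Qed.

Lemma acyclic_partition_cell k C :
  acyclic_partition A k C -> exists2 h, C = cell h & #|parts C| = k.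
Proof.
move=> aC; exists (height C); first by rewrite (cell_height aC).
by case/and3P: aC => /and3P[_ /eqP].
Qed.

(** The orientation read on the edges of G instead of G_Pi. By [dir_inj] it determines the partition
    as well, and D(C) is a weighted sum of it, so equivalence and contraction can be handled through
    [dir] alone. *)
Definition dir C (i j : V) : bool :=
  adj i j && ((pblock (parts C) i, pblock (parts C) j) \in arcs C).

Lemma dir_adj C i j : dir C i j -> adj i j.
Proof. by case/andP. Qed.

Lemma dir_cell h i j : dir (cell h) i j = adj i j && (h j < h i)%N.
Proof. by rewrite /dir; case a: (adj i j) => //=; rewrite !pblock_cell arc_cell. Qed.

Definition same_dir h h' : Prop :=
  forall i j, adj i j -> (h j < h i)%N = (h' j < h' i)%N.

Lemma same_dir_eq h h' :
  same_dir h h' -> forall i j, adj i j -> (h i == h j) = (h' i == h' j).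
Proof.
move=> hh i j a; have a' : adj j i by rewrite adjC.
by have := hh i j a; have := hh j i a'; lia.
Qed.

Lemma same_dir_cluster h h' : same_dir h h' -> cluster h =1 cluster h'.
Proof.
move=> hh i; apply/setP=> j; rewrite !inE; apply: eq_connect => u v.
by rewrite !levelE; case a: (adj u v) => //=; rewrite (same_dir_eq hh).
Qed.

Lemma same_dir_cell h h' : same_dir h h' -> cell h = cell h'.
Proof.
move=> hh; congr (_, _); first by apply: eq_imset => i; apply: same_dir_cluster.
apply/setP=> -[U W].
apply/arcs_cellP/arcs_cellP=> -[i [j [aij hij -> ->]]]; exists i, j;
  by rewrite !(same_dir_cluster hh) ?hh // -hh.
Qed.

Lemma cell_same_dir h h' : cell h = cell h' -> same_dir h h'.
Proof. by move=> hh i j a; have := dir_cell h i j; rewrite hh dir_cell a. Qed.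

Lemma dir_inj k k' C C' :
  acyclic_partition A k C -> acyclic_partition A k' C' -> dir C =2 dir C' ->
  C = C'.
Proof.
move=> /acyclic_partition_cell[h -> _] /acyclic_partition_cell[h' -> _] dd.
by apply: same_dir_cell => i j a; have := dd i j; rewrite !dir_cell a.
Qed.

Lemma outdiv_cell h i : outdiv A (cell h) i = (\sum_(j | h j < h i) A i j)%N.
Proof.
rewrite /outdiv mnmE; under eq_bigr => W _ do rewrite big_mkcond /=.
rewrite exchange_big [RHS]big_mkcond /=; apply: eq_bigr => w _.
rewrite -big_mkcondr /= pblock_cell.
have [a|/negbTE a] := boolP (adj i w); last first.
  have A0 : A i w = 0%N by move: a; rewrite /adj; lia.
  by rewrite A0 if_same big1.
rewrite -(arc_cell h a).
rewrite (eq_bigl (fun W => ((cluster h i, cluster h w) \in arcs (cell h)) && (W == cluster h w))).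
  by case: ifP => _ /=; rewrite ?big_pred1_eq ?big_pred0_eq.
move=> W /=; apply/andP/andP => [[/arcs_cellP[x [y [? ? -> ->]]] wW]|[? /eqP ->]].
  split; last by rewrite (cluster_eq wW).
  by apply/arcs_cellP; exists x, y; split=> //; apply: cluster_eq.
by rewrite mem_cluster.
Qed.

Lemma outdiv_dir k C i :
  acyclic_partition A k C -> outdiv A C i = (\sum_j A i j * dir C i j)%N.
Proof.
move=> /acyclic_partition_cell[h -> _]; rewrite outdiv_cell big_mkcond.
apply: eq_bigr => j _; rewrite dir_cell /adj; case: (posnP (A i j)) => [->|a].
  by rewrite if_same.
by case: ifP => _; rewrite ?muln1 ?muln0.
Qed.

End Cells.

(** * Chip firing equivalence and gradients *)

Lemma Posz_sum (I : Type) (r : seq I) (P : pred I) (F : I -> nat) :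
  (\sum_(i <- r | P i) F i)%N%:Z = \sum_(i <- r | P i) (F i)%:Z.
Proof. exact: (big_morph Posz PoszD). Qed.

Lemma sqr_ge_int (d : int) : d <= d * d /\ - d <= d * d.
Proof. by case: (leP d 0) => ?; split; nia. Qed.

Section ChipEquivalence.
Variables (m : nat) (A : 'M[nat]_m.+1).
Hypothesis A_sym : forall i j, A i j = A j i.
Local Notation V := 'I_m.+1.
Implicit Types (h : V -> nat) (C : opart m) (e f g : edge m).

Definition block (P : {set part m}) (hP : partition P [set: V]) (i : V) :
    {U : part m | U \in P}.
exists (pblock P i).
by case/and3P: hP => /eqP covP _ _; rewrite pblock_mem // covP inE.
Defined.

Lemma block_eq (P : {set part m}) (hP : partition P [set: V]) i U :
  (block hP i == U) = (i \in val U).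
Proof.
case: U => U UP; rewrite -val_eqE /=; case/and3P: hP => /eqP covP tI _.
apply/eqP/idP => [<-|iU]; last exact: def_pblock.
by rewrite mem_pblock covP inE.
Qed.

Section Partition.
Variables (P : {set part m}) (hP : partition P [set: V]).
Local Notation bl := (block hP).

Lemma sum_blocks (F : V -> int) : \sum_i F i = \sum_(U : {U | U \in P}) \sum_(i in val U) F i.
Proof.
rewrite (partition_big bl predT) //=; apply: eq_bigr => U _.
by apply: eq_bigl => i; rewrite block_eq.
Qed.

Lemma sum_push (p : {U | U \in P} -> int) (D : 'X_{1..m.+1}) :
  \sum_U p U * push D U = \sum_i p (bl i) * (D i)%:Z.
Proof.
rewrite sum_blocks; apply: eq_bigr => U _; rewrite /push mulr_sumr.
by apply: eq_bigr => i; rewrite -(block_eq hP) => /eqP ->.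
Qed.

Lemma sum_quotient_graph (G : {U | U \in P} -> {U | U \in P} -> int) :
  \sum_U \sum_W G U W * (quotient_graph A U W)%:Z
  = \sum_i \sum_j G (bl i) (bl j) * (A i j)%:Z.
Proof.
rewrite sum_blocks; apply: eq_bigr => U _.
rewrite exchange_big sum_blocks /=; apply: eq_bigr => W _.
rewrite exchange_big /= /quotient_graph /weight Posz_sum mulr_sumr.
apply: eq_bigr => i iU; rewrite Posz_sum mulr_sumr.
apply: eq_bigr => j jW.
by congr (G _ _ * _); apply/esym/eqP; rewrite block_eq.
Qed.

(** Testing a Laplacian identity on G_Pi against a function [p] of the parts turns it into a sum
    over pairs of vertices of G, to be compared with [dir] term by term. An indicator function for
    [p] gives back the value at one part. *)
Lemma sum_quotient_laplacian (p z : {U | U \in P} -> int) :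
  \sum_U p U * \sum_W z W * laplacian (@quotient_graph _ A P) W U
  = \sum_i \sum_j p (bl i) * (z (bl i) - z (bl j)) * (A i j)%:Z.
Proof.
have qgC U W : quotient_graph A U W = quotient_graph A W U :> nat.
  rewrite /quotient_graph /weight exchange_big /=.
  by apply: eq_bigr => i _; apply: eq_bigr => j _; rewrite A_sym.
rewrite -(sum_quotient_graph (fun U W => p U * (z U - z W))).
apply: eq_bigr => U _; rewrite mulr_sumr.
transitivity (p U * z U * (\sum_k quotient_graph A U k)%N%:Z
               - \sum_W p U * z W * (quotient_graph A U W)%:Z).
  under [LHS]eq_bigr => W _ do rewrite mulrA /laplacian mulrBr.
  rewrite sumrB; congr (_ - _); last by apply: eq_bigr => W _; rewrite qgC.
  by rewrite (bigD1 U) //= eqxx [X in _ + X]big1 ?addr0 // => W /negbTE ->; rewrite mulr0.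
rewrite Posz_sum mulr_sumr -sumrB; apply: eq_bigr => W _; ring.
Qed.

End Partition.

(** By [gradient_outdiv], D(C1) - D(C2) is then the Laplacian of [z] on G, so that the divisors
    themselves, and not only their images on G_Pi, are linearly equivalent. *)
Definition gradient C1 C2 (z : V -> int) : Prop :=
  forall i j, adj A i j -> z i - z j = (dir A C1 i j)%:Z - (dir A C2 i j)%:Z.

Lemma gradient_sym C1 C2 z : gradient C1 C2 z -> gradient C2 C1 (fun i => - z i).
Proof. by move=> zC i j a; have := zC i j a; lia. Qed.

Lemma gradient_trans C1 C2 C3 z z' :
  gradient C1 C2 z -> gradient C2 C3 z' -> gradient C1 C3 (fun i => z i + z' i).
Proof. by move=> zC zC' i j a; have := zC i j a; have := zC' i j a; lia. Qed.

Lemma gradient_outdiv k1 k2 C1 C2 z i :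
  acyclic_partition A k1 C1 -> acyclic_partition A k2 C2 -> gradient C1 C2 z ->
  (outdiv A C1 i)%:Z - (outdiv A C2 i)%:Z = \sum_j (z i - z j) * (A i j)%:Z.
Proof.
move=> aC1 aC2 zC; rewrite (outdiv_dir A_sym _ aC1) (outdiv_dir A_sym _ aC2).
rewrite !Posz_sum -sumrB; apply: eq_bigr => j _; rewrite !PoszM -mulrBr.
case: (posnP (A i j)) => [-> | a]; first by rewrite mul0r mulr0.
by rewrite (zC i j a) mulrC.
Qed.

(** Adding the identities for (i, j) and (j, i) eliminates [z] and shows that an edge of G is
    directed by [C1] iff it is directed by [C2]. Hence both have the same ties, and the ties
    determine the parts. *)
Lemma gradient_parts k1 k2 C1 C2 z :
  acyclic_partition A k1 C1 -> acyclic_partition A k2 C2 -> gradient C1 C2 z ->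
  parts C1 = parts C2.
Proof.
move=> /(@acyclic_partition_cell _ A)[h1 -> _].
move=> /(@acyclic_partition_cell _ A)[h2 -> _] zC.
apply: eq_imset => i; apply/setP=> j; rewrite !inE; apply: eq_connect => u v.
rewrite !levelE; case a: (adj A u v) => //=.
have := zC _ _ a; rewrite adjC // in a; have := zC _ _ a.
by rewrite !dir_cell // a adjC // a /=; lia.
Qed.

Lemma gradient_pblock h1 C2 z i j :
  gradient (cell A h1) C2 z -> parts (cell A h1) = parts C2 ->
  j \in cluster A h1 i -> z i = z j.
Proof.
move=> zC pp; rewrite inE => ij.
apply: (connect_preserved (P := fun v => z i = z v) _ ij) => // u v ->.
rewrite levelE => /andP[a /eqP huv]; have := zC _ _ a.
rewrite adjC // in a; have := zC _ _ a.
by rewrite !dir_cell // huv ltnn !andbF; lia.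
Qed.

Lemma gradient_chip_equiv k1 k2 C1 C2 z :
  acyclic_partition A k1 C1 -> acyclic_partition A k2 C2 -> gradient C1 C2 z ->
  chip_equiv A C1 C2.
Proof.
move=> aC1 aC2 zC; have pp := gradient_parts aC1 aC2 zC; split=> //.
have hP : partition (parts C1) [set: V] by case/and3P: aC1 => /and3P[].
(* Since [z] is constant on parts, any vertex may represent its part. The default [ord_max] is never
   reached, as parts are nonempty. *)
pose rp (U : {U | U \in parts C1}) : V := odflt ord_max [pick i in val U].
have zE i : z (rp (block hP i)) = z i.
  have [h1 C1E _] := acyclic_partition_cell aC1.
  rewrite /rp; case: pickP => [j|/(_ i)] /=; last first.
    by have := eqxx (block hP i); rewrite block_eq => /= ->.
  rewrite /= C1E pblock_cell // => ij; apply/esym.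
  by rewrite C1E in zC pp; apply: gradient_pblock zC pp ij.
exists (fun U => z (rp U)) => U.
pose p W : int := (W == U)%:R.
have pE (F : _ -> int) : F U = \sum_W p W * F W.
  rewrite (bigD1 U) //= /p eqxx mul1r big1 ?addr0 // => W /negbTE ->.
  by rewrite mul0r.
rewrite [RHS](pE (fun U => \sum_W z (rp W) * laplacian _ W U)).
rewrite (sum_quotient_laplacian hP) (pE (push _)) [X in _ - X](pE (push _)).
rewrite !(sum_push hP) -sumrB; apply: eq_bigr => i _.
rewrite -mulrBr (gradient_outdiv _ aC1 aC2 zC) mulr_sumr; apply: eq_bigr => j _.
by rewrite !zE mulrA.
Qed.

Lemma sum_antisymmetric (p : V -> int) (q : V -> V -> int) :
  (forall i j, q j i = - q i j) ->
  (\sum_i \sum_j p i * q i j) *+ 2 = \sum_i \sum_j (p i - p j) * q i j.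
Proof.
move=> qC; rewrite mulr2n {2}exchange_big /= -big_split /=.
apply: eq_bigr => i _; rewrite -big_split /=; apply: eq_bigr => j _.
by rewrite (qC i j); ring.
Qed.

Lemma psumr2_eq0 (q : V -> V -> int) :
  (forall i j, 0 <= q i j) -> \sum_i \sum_j q i j = 0 -> forall i j, q i j = 0.
Proof.
move=> q0 s0 i j.
have /psumr_eq0P/(_ s0 i isT) : forall i, true -> 0 <= \sum_j q i j.
  by move=> u _; apply: sumr_ge0.
by move/psumr_eq0P; apply.
Qed.

(* Both sums below have terms of constant sign: the first is the energy
   inequality |d| <= d ^ 2 for d = z i - z j, and the second one compares the
   orientations by means of a height function of the first of them. *)
Lemma chip_equiv_gradient k1 k2 C1 C2 :
  acyclic_partition A k1 C1 -> acyclic_partition A k2 C2 ->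
  chip_equiv A C1 C2 -> exists z, gradient C1 C2 z.
Proof.
move=> aC1 aC2 [pp [zq zqE]].
have hP : partition (parts C1) [set: V] by case/and3P: aC1 => /and3P[].
pose z i := zq (block hP i); exists z.
(* The defect of the gradient relation, weighted by the multiplicity of the edge. By [q_sum] it is
   orthogonal to all functions constant on the parts, in particular to [z] and to the height [h1].
   Its antisymmetry uses that both orientations have the same ties. *)
pose q i j := (A i j)%:Z * ((dir A C1 i j)%:Z - (dir A C2 i j)%:Z - (z i - z j)).
have q_sum (p : {U | U \in parts C1} -> int) :
    \sum_i \sum_j p (block hP i) * q i j = 0.
  transitivity (\sum_U p U * (push (outdiv A C1) U - push (outdiv A C2) U
      - \sum_W zq W * laplacian (@quotient_graph _ A (parts C1)) W U)).
    under [in RHS]eq_bigr => U _ do rewrite 2!mulrBr.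
    rewrite !sumrB (sum_quotient_laplacian hP) !(sum_push hP) -!sumrB.
    apply: eq_bigr => i _.
    rewrite (outdiv_dir A_sym _ aC1) (outdiv_dir A_sym _ aC2) !Posz_sum.
    rewrite !mulr_sumr -!sumrB; apply: eq_bigr => j _.
    by rewrite /q !PoszM -/(z _) -/(z _); ring.
  by rewrite big1 // => U _; rewrite -zqE subrr mulr0.
have [h1 C1E _] := acyclic_partition_cell aC1.
have [h2 C2E _] := acyclic_partition_cell aC2.
have compE : cluster A h1 =1 cluster A h2.
  by move=> i; rewrite -!(pblock_cell A_sym) -C1E pp C2E.
have h12 i j : adj A i j -> (h1 i == h1 j) = (h2 i == h2 j).
  move=> a; apply/eqP/eqP => hij.
    by apply/esym/(@cluster_height _ A); rewrite -compE; apply: adj_cluster.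
  by apply/esym/(@cluster_height _ A); rewrite compE; apply: adj_cluster.
have qC i j : q j i = - q i j.
  rewrite /q A_sym; case: (posnP (A i j)) => [-> | a]; first by rewrite !mul0r oppr0.
  have := h12 i j a; rewrite C1E C2E !dir_cell // -/(adj A i j) in a *.
  rewrite adjC // a /= => h; rewrite -mulrN; congr (_ * _); move: h; lia.
have z1 i j : adj A i j -> z i = z j \/
    z i - z j = (dir A C1 i j)%:Z - (dir A C2 i j)%:Z.
  move=> a; have s0 := sum_antisymmetric z qC; rewrite q_sum mul0rn in s0.
  have : \sum_u \sum_v - ((z u - z v) * q u v) = 0.
    by under [LHS]eq_bigr => u _ do rewrite sumrN; rewrite sumrN -s0 oppr0.
  move/psumr2_eq0 => -/(_ _ i j) h0.
  have /h0 : forall u v, 0 <= - ((z u - z v) * q u v).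
    move=> u v; rewrite /q mulrCA -mulrN; apply: mulr_ge0 => //.
    have [d1 d2] := sqr_ge_int (z u - z v).
    by case: (dir A C1 u v); case: (dir A C2 u v); lia.
  rewrite /q => /eqP; rewrite oppr_eq0 !mulf_eq0 => /or3P[/eqP ?|/eqP A0|/eqP ?].
  - by left; lia.
  - by move: a; rewrite /adj; lia.
  - by right; lia.
pose p (U : {U | U \in parts C1}) : int := (h1 (odflt ord_max [pick i in val U]))%:Z.
have pE i : p (block hP i) = (h1 i)%:Z.
  rewrite /p; case: pickP => [j|/(_ i)] /=; last first.
    by have := eqxx (block hP i); rewrite block_eq => /= ->.
  by rewrite /= C1E pblock_cell // => /cluster_height ->.
move=> i j a.
have /esym s0 := sum_antisymmetric (fun i => p (block hP i)) qC.
rewrite q_sum mul0rn in s0.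
have key u v : adj A u v -> z u = z v ->
    0 <= ((h1 u)%:Z - (h1 v)%:Z) * ((dir A C1 u v)%:Z - (dir A C2 u v)%:Z)
    /\ (((h1 u)%:Z - (h1 v)%:Z) * ((dir A C1 u v)%:Z - (dir A C2 u v)%:Z) = 0 ->
        (dir A C1 u v)%:Z - (dir A C2 u v)%:Z = 0).
  by move=> a' _; have := h12 u v a'; rewrite C1E C2E !dir_cell // a' /=; nia.
have : ((h1 i)%:Z - (h1 j)%:Z) * q i j = 0.
  rewrite -!pE; apply: (psumr2_eq0 _ s0 i j) => u v.
  case: (posnP (A u v)) => [A0 | a']; first by rewrite /q A0 mul0r mulr0.
  rewrite !pE /q mulrCA; apply: mulr_ge0 => //.
  have [zz|->] := z1 u v a'; last by rewrite subrr mulr0.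
  by rewrite zz subrr subr0; case: (key u v a' zz).
rewrite /q mulrCA => /eqP; rewrite mulf_eq0 => /orP[/eqP A0|/eqP].
  by move: a; rewrite /adj; lia.
have [zz|-> _ //] := z1 i j a.
by rewrite zz subrr subr0 => /(proj2 (key i j a zz)) ->.
Qed.

End ChipEquivalence.

(** * Contractions *)

Section Contraction.
Variables (m : nat) (A : 'M[nat]_m.+1).
Hypothesis A_sym : forall i j, A i j = A j i.
Local Notation V := 'I_m.+1.
Local Notation adj := (adj A).
Local Notation cell := (cell A).
Local Notation cluster := (cluster A).
Local Notation dir := (dir A).
Local Notation gradient := (gradient A).
Local Notation acyclic := (acyclic_partition A).
Implicit Types (h : V -> nat) (C : opart m) (e f g : edge m).

Lemma acyclic_cell h k : #|parts (cell h)| = k -> acyclic k (cell h).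
Proof. by move=> <-; apply: cell_acyclic. Qed.

Definition in_edge f (i j : V) : bool := (i \in f.1) && (j \in f.2).

(** Contraction at the level of heights: [h'] forgets exactly the descents along [f]. For an arc
    [f], such an [h'] exists iff [f] is contractible, and [cell h'] is then the contraction. *)
Definition contracts h f h' : Prop :=
  forall i j, adj i j -> (h' j < h' i)%N = (h j < h i)%N && ~~ in_edge f i j.

Lemma arc_in_edge h f i j : f \in arcs (cell h) -> in_edge f i j -> (h j < h i)%N.
Proof.
case: f => U W /arcs_cellP[u [w [_ huw -> ->]]] /andP[/= /cluster_height hi].
by move=> /cluster_height hj; rewrite hi hj.
Qed.

Lemma contracts_tie h f h' i j : f \in arcs (cell h) -> contracts h f h' ->
  adj i j -> (h' i == h' j) = [|| h i == h j, in_edge f i j | in_edge f j i].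
Proof.
move=> fC hh' a; have a' : adj j i by rewrite adjC.
have := hh' i j a; have := hh' j i a'.
have := @arc_in_edge h f i j fC; have := @arc_in_edge h f j i fC.
case: (in_edge f i j); case: (in_edge f j i) => //=;
  try (move=> /(_ isT) ?); try (move=> /(_ isT) ?); lia.
Qed.

(** Along edges of G the only ties gained are those across [f], so the two ends of [f] fuse and
    every other cluster stays as it is. *)
Lemma contracts_cluster h f h' i : f \in arcs (cell h) -> contracts h f h' ->
  cluster h' i = merge f (cluster h i).
Proof.
move=> fC hh'; have tie := contracts_tie fC hh'.
case: f fC tie {hh'} => U W fC tie; have /arcs_cellP[u [w [a huw UE WE]]] := fC.
have inU x : x \in U -> cluster h x = U by rewrite UE => /(cluster_eq A_sym).
have inW x : x \in W -> cluster h x = W by rewrite WE => /(cluster_eq A_sym).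
have nextP x y : adj x y -> h x = h y -> y \in cluster h x.
  by move=> ? ?; apply: adj_cluster.
apply/setP=> j; apply/idP/idP.
  rewrite inE => ij;
  apply: (connect_preserved (P := fun v => v \in merge (U, W) (cluster h i)) _ ij);
    last first.
    by rewrite /merge; case: ifP => [/orP[]/eqP /= <-|_]; rewrite ?in_setU mem_cluster ?orbT.
  move=> x y xM; rewrite levelE => /andP[axy]; rewrite tie //= /in_edge /=.
  move: xM; rewrite /merge; case: ifP => /= [_|].
    rewrite !in_setU => /orP[] xX /or3P[/eqP /(nextP _ _ axy)|/andP[_ ->]|/andP[->]] //.
    - by rewrite inU // => ->.
    - by rewrite orbT.
    - by rewrite inW // => ->; rewrite orbT.
    - by rewrite orbT.
  move=> /norP[iU iW] xi.
  have xU : x \in U -> false.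
    by move=> /inU xU; case/eqP: iU; rewrite -(cluster_eq A_sym xi).
  have xW : x \in W -> false.
    by move=> /inW xW; case/eqP: iW; rewrite -(cluster_eq A_sym xi).
  case/or3P=> [/eqP /(nextP _ _ axy)|/andP[/xU] //|/andP[_ /xW] //].
  by rewrite (cluster_eq A_sym xi).
have sub x y : connect (level A h) x y -> connect (level A h') x y.
  apply: connect_sub => x' y'; rewrite levelE => /andP[a' e].
  by apply: connect1; rewrite levelE a' tie // e.
have symc : connect_sym (level A h') by apply: sym_connect_sym; apply: level_sym.
have uM x : x \in U :|: W -> connect (level A h') u x.
  rewrite in_setU UE WE !inE => /orP[/sub //|/sub]; apply: connect_trans.
  by apply: connect1; rewrite levelE a tie // /in_edge UE WE !mem_cluster /= orbT.
rewrite /merge; case: ifP => [iUW|_]; last by rewrite !inE => /sub.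
move=> jUW; rewrite inE; apply: connect_trans (uM _ jUW); rewrite symc; apply: uM.
by case/orP: iUW => /= /eqP <-; rewrite in_setU mem_cluster ?orbT.
Qed.

Lemma contracts_contract h f h' : f \in arcs (cell h) -> contracts h f h' ->
  contract (cell h) f = cell h'.
Proof.
move=> fC hh'; have clE i := contracts_cluster i fC hh'.
congr (_, _).
  by rewrite /parts /= -imset_comp; apply: eq_imset => i /=; rewrite clE.
apply/setP=> -[X Y]; apply/imsetP/arcs_cellP.
  move=> [[X' Y']]; rewrite inE => /andP[nf /arcs_cellP[i [j [a hij XE YE]]]].
  rewrite /edge_contract /= XE YE => -[-> ->]; exists i, j; rewrite !clE.
  split=> //; rewrite hh' // hij; apply: contra nf; case: f {hh' clE} fC => U W.
  move=> /arcs_cellP[u [w [_ _ -> ->]]] /andP[/= iu jw].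
  by rewrite inE XE YE (cluster_eq A_sym iu) (cluster_eq A_sym jw).
move=> [i [j [a hij -> ->]]]; exists (cluster h i, cluster h j).
  move: hij; rewrite hh' // => /andP[hij nf]; rewrite !inE arc_cell //.
  rewrite hij andbT; apply: contra nf => /eqP <-.
  by rewrite /in_edge !mem_cluster.
by rewrite !clE.
Qed.

Lemma contracts_contractible h f h' : f \in arcs (cell h) -> contracts h f h' ->
  contractible (cell h) f.
Proof.
move=> fC hh'; rewrite /contractible fC (contracts_contract fC hh').
exact: cell_acyclic_digraph.
Qed.

Lemma contractible_cell h f : contractible (cell h) f ->
  f \in arcs (cell h) /\ exists h', contracts h f h'.
Proof.
move=> /andP[fC acE]; split=> //.
(* The reachability height of the contracted digraph, acyclic by hypothesis: it drops along the
   surviving arcs and agrees on the two ends of [f]. *)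
pose h' i := #|connect [rel X Y | (X, Y) \in arcs (contract (cell h) f)]
                (merge f (cluster h i))|; exists h'.
have lt i j : adj i j -> (h j < h i)%N -> ~~ in_edge f i j -> (h' j < h' i)%N.
  move=> a hij nf; apply: card_reachable_lt acE _; apply/imsetP.
  exists (cluster h i, cluster h j) => //; rewrite !inE arc_cell // hij.
  by rewrite andbT; apply: contra nf => /eqP <-; rewrite /in_edge !mem_cluster.
have eq i j : in_edge f i j -> h' i = h' j.
  case: f @h' {acE lt} fC => U W h' /arcs_cellP[u [w [_ _ UE WE]]].
  rewrite /in_edge /= {1}UE {1}WE => /andP[/(cluster_eq A_sym) iu].
  move=> /(cluster_eq A_sym) jw.
  by rewrite /h' iu jw -UE -WE /merge /= !eqxx orbT.
move=> i j a; have a' : adj j i by rewrite adjC.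
have [nf|nf] := boolP (in_edge f i j); first by rewrite (eq _ _ nf) ltnn andbF.
rewrite andbT; case: (ltngtP (h j) (h i)) => [hij|hij|hij]; last 1 first.
- have /(cluster_eq A_sym) E := adj_cluster a (esym hij).
  by rewrite /h' E ltnn.
- exact: lt.
- by have [/eq ->|/(lt _ _ a' hij)] := boolP (in_edge f j i); rewrite ?ltnn //; lia.
Qed.

Lemma card_merge h f : f \in arcs (cell h) ->
  #|parts (cell h)| = #|merge f @: parts (cell h)|.+1.
Proof.
case: f => U W /arcs_cellP[u [w [_ huw UE WE]]].
have UW : U != W.
  by apply: contraTneq huw => UW; rewrite -leqNgt (@cluster_height _ A h w u) //
    -WE -UW UE mem_cluster.
have UP : U \in parts (cell h) by rewrite UE cluster_in_parts.
have WP : W \in parts (cell h) by rewrite WE cluster_in_parts.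
have Pu X : X \in parts (cell h) -> u \in X -> X = U.
  by move=> /imsetP[i _ ->] /(cluster_eq A_sym) <-.
have Pw X : X \in parts (cell h) -> w \in X -> X = W.
  by move=> /imsetP[i _ ->] /(cluster_eq A_sym) <-.
have uUW : u \in U :|: W by rewrite inE UE mem_cluster.
have wUW : w \in U :|: W by rewrite inE WE mem_cluster orbT.
rewrite (cardsD1 U (parts _)) UP add1n; congr _.+1.
have -> : merge (U, W) @: parts (cell h) = merge (U, W) @: (parts (cell h) :\ U).
  apply/setP=> X; apply/imsetP/imsetP=> -[Y YP ->]; last first.
    by exists Y => //; move: YP; rewrite in_setD1 => /andP[].
  have [->|YU] := eqVneq Y U; last by exists Y; rewrite // in_setD1 YU.
  exists W; first by rewrite in_setD1 eq_sym UW.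
  by rewrite /merge /= !eqxx orbT.
rewrite card_in_imset // => X Y; rewrite !in_setD1 => /andP[XU XP] /andP[YU YP].
rewrite /merge /= (negbTE XU) (negbTE YU) /=.
have [->|XW] := eqVneq X W; have [->|YW] := eqVneq Y W => //= XY.
  by case/eqP: YU; apply: Pu => //; rewrite -XY.
by case/eqP: XU; apply: Pu => //; rewrite XY.
Qed.

Lemma contract_acyclic k C f : acyclic k.+1 C -> contractible C f ->
  acyclic k (contract C f).
Proof.
move=> /acyclic_partition_cell[h -> k1] /contractible_cell[fC [h' hh']].
have CE := contracts_contract fC hh'; rewrite CE; apply: acyclic_cell.
by have := card_merge fC; rewrite k1 -CE /= => -[].
Qed.

Lemma dir_contract k C f i j : acyclic k C -> contractible C f -> adj i j ->
  dir (contract C f) i j = dir C i j && ~~ in_edge f i j.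
Proof.
move=> /acyclic_partition_cell[h -> _] /contractible_cell[fC [h' hh']] a.
by rewrite (contracts_contract fC hh') !(dir_cell A_sym) a hh'.
Qed.

Lemma contractible_dir k C f i j : acyclic k C -> contractible C f -> adj i j ->
  in_edge f i j -> dir C i j.
Proof.
move=> /acyclic_partition_cell[h -> _] /andP[fC _] a /(arc_in_edge fC).
by rewrite (dir_cell A_sym) a.
Qed.

(** Both descent functions equal 1 on the adjacent pairs running along [f]. Deleting these pairs
    does not change the difference, so the same potential serves. *)
Lemma gradient_contract k C1 C2 f z : acyclic k C1 -> acyclic k C2 ->
  contractible C1 f -> contractible C2 f -> gradient C1 C2 z ->
  gradient (contract C1 f) (contract C2 f) z.
Proof.
move=> aC1 aC2 fC1 fC2 zC i j a; rewrite !(dir_contract (k := k)) // zC //.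
have := contractible_dir aC1 fC1 a; have := contractible_dir aC2 fC2 a.
by case: (in_edge f i j) => [/(_ isT) -> /(_ isT) ->|]; rewrite ?andbT.
Qed.

(* The lexicographic product of the heights refines the contracted partition
   in the way prescribed by the contraction of the first one. *)
Lemma gradient_lift k C f C2 z : acyclic k.+1 C -> contractible C f ->
  acyclic k C2 -> gradient (contract C f) C2 z ->
  exists C', [/\ acyclic k.+1 C', gradient C C' z, contractible C' f
                & contract C' f = C2].
Proof.
move=> /acyclic_partition_cell[h -> kE] fC aC2 zC.
have aCf : acyclic k (contract (cell h) f) by apply: contract_acyclic fC; apply: acyclic_cell.
have [fA [h' hh']] := contractible_cell fC.
have /acyclic_partition_cell[h2 C2E _] := aC2; subst C2.
have CE := contracts_contract fA hh'; rewrite CE in zC aCf.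
have pp := gradient_parts A_sym aCf aC2 zC.
pose N := (\max_i h i).+1.
have hN i : (h i < N)%N by rewrite ltnS /N leq_bigmax.
pose h'' i := (h2 i * N + h i)%N.
have tie i j : adj i j -> (h2 i == h2 j) = (h' i == h' j).
  move=> a; have cE : cluster h2 =1 cluster h'.
    by move=> v; rewrite -!(pblock_cell A_sym) pp.
  apply/eqP/eqP => hij; apply/esym/(@cluster_height _ A).
    by rewrite -cE; apply: adj_cluster.
  by rewrite cE; apply: adj_cluster.
have h''E i j : adj i j -> (h'' j < h'' i)%N = (h2 j < h2 i)%N || in_edge f i j.
  move=> a; have := tie i j a; have := contracts_tie fA hh' a.
  have := @arc_in_edge h f i j fA; have := @arc_in_edge h f j i fA.
  have := hh' i j a; have := hN i; have := hN j; rewrite /h''.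
  case: (in_edge f i j); case: (in_edge f j i) => /=; case: (ltngtP (h2 i) (h2 j)) => ?;
    try (move=> ? ? ? /(_ isT) ? /(_ isT) ?);
    try (move=> ? ? ? _ /(_ isT) ?);
    try (move=> ? ? ? /(_ isT) ? _); nia.
have zC' : gradient (cell h) (cell h'') z.
  move=> i j a; have := zC i j a; rewrite !(dir_cell A_sym) a /= h''E // hh' //.
  have := @arc_in_edge h f i j fA; have := tie i j a; have := contracts_tie fA hh' a.
  by case: (in_edge f i j) => /=; rewrite ?orbT ?andbT //; lia.
have aC : acyclic k.+1 (cell h) by apply: acyclic_cell.
have pp'' := gradient_parts A_sym aC (cell_acyclic A_sym h'') zC'.
have aC'' : acyclic k.+1 (cell h'') by apply: acyclic_cell; rewrite -pp''.
have clE i : cluster h'' i = cluster h i by rewrite -!(pblock_cell A_sym) pp''.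
have fA'' : f \in arcs (cell h'').
  case: f {fC hh' CE} fA h''E => U W /arcs_cellP[u [w [a huw -> ->]]] h''E.
  by apply/arcs_cellP; exists u, w; rewrite !clE h''E // /in_edge !mem_cluster orbT.
have hh2 : contracts h'' f h2.
  move=> i j a; rewrite h''E //; have := tie i j a; have := contracts_tie fA hh' a.
  by case: (in_edge f i j) => /=; rewrite ?orbT ?andbT ?orbF //; lia.
exists (cell h''); split=> //; first exact: contracts_contractible hh2.
exact: contracts_contract.
Qed.

End Contraction.

(** * Equivalence classes and their contractions *)

Section Classes.
Variables (m : nat) (A : 'M[nat]_m.+1).
Hypothesis A_sym : forall i j, A i j = A j i.
Local Notation V := 'I_m.+1.
Local Notation adj := (adj A).
Local Notation cell := (cell A).
Local Notation cluster := (cluster A).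
Local Notation dir := (dir A).
Local Notation gradient := (gradient A).
Local Notation acyclic := (acyclic_partition A).
Local Notation classes := (chip_classes A).
Implicit Types (h : V -> nat) (C : opart m) (e f g : edge m) (c : {set opart m}).

Lemma chip_classP k C C' : acyclic k C ->
  reflect (acyclic k C' /\ exists z, gradient C C' z) (C' \in chip_class A C).
Proof.
move=> aC; have kE : #|parts C| = k by case/and3P: aC => /and3P[_ /eqP].
rewrite inE kE; apply: (iffP andP) => [[aC' /asboolP eC]|[aC' [z zC]]].
  by split=> //; apply: (chip_equiv_gradient A_sym aC aC').
by split=> //; apply/asboolP/(gradient_chip_equiv A_sym aC aC' zC).
Qed.

Lemma gradient_refl C : gradient C C (fun=> 0).
Proof. by move=> i j _; rewrite !subrr. Qed.

Lemma mem_chip_class k C : acyclic k C -> C \in chip_class A C.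
Proof.
by move=> aC; apply/(chip_classP _ aC); split=> //; exists (fun=> 0); apply: gradient_refl.
Qed.

Lemma chip_class_eq k C C' : acyclic k C -> C' \in chip_class A C ->
  chip_class A C' = chip_class A C.
Proof.
move=> aC /(chip_classP _ aC)[aC' [z zC]].
apply/setP=> C2; apply/(chip_classP _ aC')/(chip_classP _ aC) => -[aC2 [z' zC2]].
  by split=> //; exists (fun i => z i + z' i); apply: gradient_trans zC zC2.
split=> //; exists (fun i => - z i + z' i).
exact: gradient_trans (gradient_sym zC) zC2.
Qed.

Lemma classes_acyclic k c C : c \in classes k -> C \in c -> acyclic k C.
Proof. by move=> /imsetP[C0 aC0 ->] /(chip_classP _ aC0)[]. Qed.

Lemma classes_eq k c C : c \in classes k -> C \in c -> c = chip_class A C.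
Proof. by move=> /imsetP[C0 aC0 ->] /(chip_class_eq aC0). Qed.

Lemma classes_gradient k c C C' : c \in classes k -> C \in c -> C' \in c ->
  exists z, gradient C C' z.
Proof.
move=> cl Cc; rewrite (classes_eq cl Cc).
by move=> /(chip_classP _ (classes_acyclic cl Cc))[].
Qed.

Lemma chip_class_in k C : acyclic k C -> chip_class A C \in classes k.
Proof. by move=> aC; apply: imset_f. Qed.

Lemma classes_neq0 k c : c \in classes k -> exists C, C \in c.
Proof. by move=> /imsetP[C aC ->]; exists C; apply: mem_chip_class aC. Qed.

Lemma realizerP c f : class_contractible c f ->
  realizer c f \in c /\ contractible (realizer c f) f.
Proof.
move=> /existsP[C CcC]; rewrite /realizer; case: pickP => [C' /andP[]//|].
by move=> /(_ C); rewrite CcC.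
Qed.

Lemma class_contractibleI c C f : C \in c -> contractible C f -> class_contractible c f.
Proof. by move=> Cc fC; apply/existsP; exists C; rewrite Cc. Qed.

Lemma class_contract_in k c f : c \in classes k.+1 -> class_contractible c f ->
  class_contract A c f \in classes k.
Proof.
move=> cl /realizerP[rc fr]; apply: chip_class_in.
exact: contract_acyclic (classes_acyclic cl rc) fr.
Qed.

Lemma contract_in_class k c C f : c \in classes k.+1 -> C \in c ->
  contractible C f -> contract C f \in class_contract A c f.
Proof.
move=> cl Cc fC; have /realizerP[rc fr] := class_contractibleI Cc fC.
have aC := classes_acyclic cl Cc; have ar := classes_acyclic cl rc.
apply/(chip_classP _ (contract_acyclic A_sym ar fr)); split.
  exact: contract_acyclic fC.
have [z zC] := classes_gradient cl rc Cc; exists z.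
exact: (gradient_contract A_sym ar aC fr fC zC).
Qed.

Lemma class_contract_eq k c C f : c \in classes k.+1 -> C \in c ->
  contractible C f -> class_contract A c f = chip_class A (contract C f).
Proof.
move=> cl Cc fC; have fc := class_contractibleI Cc fC.
exact: classes_eq (class_contract_in cl fc) (contract_in_class cl Cc fC).
Qed.

(** This frees the computations from the representative picked in the definition of c/f. Applied to
    the n-acyclic element of c/f, it determines the power of t in the differential. *)
Lemma class_lift k c f C2 : c \in classes k.+1 -> class_contractible c f ->
  C2 \in class_contract A c f ->
  exists C, [/\ C \in c, contractible C f & contract C f = C2].
Proof.
move=> cl fc; have [rc fr] := realizerP fc; have ar := classes_acyclic cl rc.
have aCf := contract_acyclic A_sym ar fr.
move=> /(chip_classP _ aCf)[aC2 [z zC2]].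
have [C [aC zC fC CE]] := gradient_lift A_sym ar fr aC2 zC2.
exists C; split=> //; rewrite (classes_eq cl rc).
by apply/(chip_classP _ ar); split=> //; exists z.
Qed.

(** The exponent of m_c(f), for every class c in which [f] is contractible: contracting [f] removes
    from D(C) just the edges that run from the tail of [f] to its head. *)
Definition edge_monom f : 'X_{1..m.+1} :=
  [multinom ((i \in f.1) * \sum_(j in f.2) A i j)%N | i < m.+1].

Lemma outdiv_contract k C f : acyclic k.+1 C -> contractible C f ->
  outdiv A C = (outdiv A (contract C f) + edge_monom f)%MM.
Proof.
move=> aC fC; apply/mnmP=> i; rewrite mnmDE (outdiv_dir A_sym _ aC).
rewrite (outdiv_dir A_sym _ (contract_acyclic A_sym aC fC)).
rewrite /edge_monom mnmE (big_mkcond (mem f.2)) big_distrr -big_split /=.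
apply: eq_bigr => j _; case: (posnP (A i j)) => [->|a]; first by rewrite if_same !mul0n muln0.
rewrite (dir_contract A_sym aC fC a); have := contractible_dir A_sym aC fC a.
rewrite /in_edge; case: (i \in f.1); case: (j \in f.2) => //=;
  try (move=> /(_ isT) ->); rewrite ?andbT ?muln0 ?muln1 ?mul1n ?addn0 //.
Qed.

Lemma class_monomE k c f : c \in classes k.+1 -> class_contractible c f ->
  class_monom A c f = edge_monom f.
Proof.
move=> cl fc; have [rc fr] := realizerP fc; have ar := classes_acyclic cl rc.
by rewrite /class_monom (outdiv_contract ar fr) addmC addmK.
Qed.

(** * Sinks, descending paths and weights *)

Definition descent h : rel V := [rel i j | adj i j && (h j <= h i)%N].

Lemma descentE h i j : descent h i j = adj i j && (h j <= h i)%N.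
Proof. by []. Qed.

Lemma descent_height h i j : connect (descent h) i j -> (h j <= h i)%N.
Proof.
move=> ij; apply: (connect_preserved (P := fun v => (h v <= h i)%N) _ ij) => //.
by move=> u v hu /andP[_ huv]; apply: leq_trans huv hu.
Qed.

Lemma level_descent h i j : connect (level A h) i j -> connect (descent h) i j.
Proof.
apply: connect_sub => u v; rewrite levelE => /andP[a /eqP huv].
by apply: connect1; rewrite descentE a huv leqnn.
Qed.

(** A lowest vertex among those without weakly descending path to the last vertex lies in a sink
    that misses it. Conversely, a weakly descending path starting in a sink never leaves that sink,
    so every sink contains the last vertex. *)
Lemma n_acyclicP h :
  reflect (forall i, connect (descent h) i ord_max) (n_acyclic (cell h)).
Proof.
rewrite /n_acyclic pblock_cell //.
have sinkP U : reflect (exists2 i, U = cluster h i &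
    forall u v, u \in U -> adj u v -> (h u <= h v)%N) (U \in sinks (cell h)).
  rewrite inE; apply: (iffP andP) => [[/imsetP[i _ UE] /forallP sU]|[i UE sU]].
    exists i => // u v; rewrite UE => iu a; rewrite leqNgt.
    by have := sU (cluster h v); rewrite UE -(cluster_eq A_sym iu) arc_cell.
  split; first by rewrite UE; apply: cluster_in_parts.
  apply/forallP=> W; apply/negP => /arcs_cellP[u [v [a huv UE' _]]].
  by have := sU u v; rewrite UE' mem_cluster a => /(_ isT isT); lia.
apply: (iffP eqP) => [sE i | con].
  apply/negPn/negP=> ni.
  have [j /= nj jmin] := @arg_minnP _ i (fun v => ~~ connect (descent h) v ord_max) h ni.
  have : cluster h j \in sinks (cell h).
    apply/sinkP; exists j => // u v ju a; rewrite leqNgt; apply/negP=> huv.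
    have hu := cluster_height ju.
    suff /jmin : ~~ connect (descent h) v ord_max by rewrite -hu; lia.
    apply: contra nj; apply: connect_trans.
    apply: (@connect_trans _ _ u); first by move: ju; rewrite inE => /level_descent.
    by apply: connect1; rewrite descentE a ltnW.
  rewrite sE in_set1 => /eqP/(cluster_eqP A_sym); rewrite inE => /level_descent.
  by move=> jn; rewrite jn in nj.
apply/setP=> U; rewrite in_set1; apply/sinkP/eqP => [[i UE sU]|->]; last first.
  exists ord_max => // u v /cluster_height -> _; apply: descent_height; apply: con.
have nU : ord_max \in U.
  apply: (connect_preserved (P := fun v => v \in U) _ (con i)); last first.
    by rewrite UE mem_cluster.
  move=> u v uU; rewrite descentE => /andP[a huv].
  have hE : h u = h v by apply/eqP; rewrite eqn_leq sU.
  by move: uU; rewrite UE => /(cluster_eq A_sym) <-; apply: adj_cluster.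
by rewrite UE; apply/esym/(cluster_eq A_sym); rewrite -UE.
Qed.

Variables (y lambda : 'cV[int]_m.+1).
Hypothesis y_pos : forall i, i != ord_max -> 0 < y i 0.
Hypothesis lambda_y : laplacian_mx A *m lambda = y.
Hypothesis lambda_pos : forall i, 0 < lambda i 0.

(** Self-adjointness of the Laplacian: pairing lambda with the Laplacian of [z] is pairing [z] with
    y. This is how y governs the change of weight within a class. *)
Lemma laplacian_form (z : V -> int) :
  \sum_i lambda i 0 * \sum_j (z i - z j) * (A i j)%:Z = \sum_i z i * y i 0.
Proof.
have yE i : y i 0 = \sum_j (lambda i 0 - lambda j 0) * (A i j)%:Z.
  rewrite -lambda_y mxE; under eq_bigr => j _ do rewrite mxE /laplacian mulrBl.
  under [RHS]eq_bigr => j _ do rewrite mulrBl mulrC [X in _ - X]mulrC.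
  rewrite !sumrB -mulr_suml -Posz_sum; congr (_ - _).
  by rewrite (bigD1 i) //= eqxx [X in _ + X]big1 ?addr0 // => j /negbTE; rewrite eq_sym => ->; rewrite mul0r.
under [RHS]eq_bigr => i _ do rewrite yE mulr_sumr.
under [LHS]eq_bigr => i _ do rewrite mulr_sumr.
transitivity (\sum_i \sum_j lambda i 0 * z i * (A i j)%:Z
   - \sum_i \sum_j lambda i 0 * z j * (A i j)%:Z).
  rewrite -sumrB; apply: eq_bigr => i _; rewrite -sumrB; apply: eq_bigr => j _; ring.
rewrite [X in _ - X]exchange_big -sumrB; apply: eq_bigr => i _.
by rewrite -sumrB; apply: eq_bigr => j _; rewrite (A_sym j i); ring.
Qed.

Lemma sum_y : \sum_i y i 0 = 0.
Proof.
have := laplacian_form (fun=> 1); under [RHS]eq_bigr => i _ do rewrite mul1r.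
move=> <-; by rewrite big1 // => i _; rewrite big1 ?mulr0.
Qed.

Lemma wdegD u v : wdeg lambda (u + v)%MM = wdeg lambda u + wdeg lambda v.
Proof.
by rewrite /wdeg -big_split; apply: eq_bigr => i _; rewrite mnmDE PoszD mulrDr.
Qed.

Lemma wdeg_ge0 u : 0 <= wdeg lambda u.
Proof. by apply: sumr_ge0 => i _; rewrite mulr_ge0 // ltW. Qed.

Lemma gradient_wdeg k1 k2 C1 C2 z : acyclic k1 C1 -> acyclic k2 C2 ->
  gradient C1 C2 z ->
  wdeg lambda (outdiv A C1) - wdeg lambda (outdiv A C2) = \sum_i z i * y i 0.
Proof.
move=> aC1 aC2 zC; rewrite -laplacian_form /wdeg -sumrB; apply: eq_bigr => i _.
by rewrite -mulrBr (gradient_outdiv A_sym _ aC1 aC2 zC).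
Qed.

(** The coordinates of y add up to 0, so [z] may be normalized to vanish at the last vertex, which
    removes the only coordinate of y not assumed to be positive. *)
Lemma shifted_form (z : V -> int) :
  \sum_i z i * y i 0 = \sum_(i | i != ord_max) (z i - z ord_max) * y i 0.
Proof.
rewrite [LHS](_ : _ = \sum_i (z i - z ord_max) * y i 0).
  by rewrite (bigD1 ord_max) //= subrr mul0r add0r.
under [RHS]eq_bigr => i _ do rewrite mulrBl.
by rewrite sumrB -mulr_sumr sum_y mulr0 subr0.
Qed.

(** Along a weakly descending step of [C1] the potential [z] cannot increase, so [z] is smallest at
    the last vertex, and the difference of weights is a sum of nonnegative terms. If it vanishes,
    [z] is constant and the orientations agree. *)
Lemma n_acyclic_max k C1 C2 z : acyclic k C1 -> acyclic k C2 -> n_acyclic C1 ->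
  gradient C1 C2 z ->
  wdeg lambda (outdiv A C2) <= wdeg lambda (outdiv A C1)
  /\ (wdeg lambda (outdiv A C2) = wdeg lambda (outdiv A C1) -> C2 = C1).
Proof.
move=> aC1 aC2; have [h1 C1E _] := acyclic_partition_cell aC1.
have [h2 C2E _] := acyclic_partition_cell aC2; subst C1 C2.
move=> /n_acyclicP con zC; have := gradient_wdeg aC1 aC2 zC; rewrite shifted_form.
have z_ge i : 0 <= z i - z ord_max.
  rewrite subr_ge0; apply: (connect_preserved (P := fun v => z v <= z i) _ (con i)) => //.
  move=> u v zu; rewrite descentE => /andP[a huv]; apply: le_trans zu.
  have a' : adj v u by rewrite adjC.
  by have := zC _ _ a; have := zC _ _ a'; rewrite !(dir_cell A_sym) a a' /=; lia.
have t_ge i : i != ord_max -> 0 <= (z i - z ord_max) * y i 0.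
  by move=> ni; rewrite mulr_ge0 // ltW // y_pos.
move=> dE; split; first by rewrite -subr_ge0 dE sumr_ge0.
move=> eqw; move: dE; rewrite eqw subrr => /esym /psumr_eq0P z0.
have zE i : z i = z ord_max.
  have [->//|ni] := eqVneq i ord_max.
  have /eqP := z0 t_ge i ni; rewrite mulf_eq0 subr_eq0 => /orP[/eqP //|/eqP y0].
  by have := y_pos ni; rewrite y0.
apply/esym/(dir_inj A_sym aC1 aC2) => i j; have [a|a] := boolP (adj i j).
  have := zC _ _ a; rewrite (zE i) (zE j) subrr.
  by case: (dir (cell h1) i j); case: (dir (cell h2) i j).
have dF C : dir C i j = false by apply: contraNF a => /dir_adj.
by rewrite !dF.
Qed.

(* Firing the vertices from which no descending path leads to the last one
   increases the weight. *)
Lemma max_n_acyclic k C : acyclic k C ->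
  (forall C' z, acyclic k C' -> gradient C C' z ->
     wdeg lambda (outdiv A C') <= wdeg lambda (outdiv A C)) -> n_acyclic C.
Proof.
move=> aC; have [h CE kE] := acyclic_partition_cell aC; subst C.
move=> Cmax; apply/n_acyclicP => i0; apply/negPn/negP=> ni0.
pose S i := ~~ connect (descent h) i ord_max.
(* [M] exceeds all heights. Raising [S] by [M] reverses exactly the arcs between [S] and its
   complement, all of which pointed into [S]. *)
pose M := (\max_i h i).+1.
have hM i : (h i < M)%N by rewrite ltnS leq_bigmax.
pose h' i := (h i + S i * M)%N.
have Sstep i j : adj i j -> S i -> (h j <= h i)%N -> S j.
  move=> a Si hij; apply: contra Si; apply: connect_trans.
  by apply: connect1; rewrite descentE a.
have zC : gradient (cell h) (cell h') (fun i => - (S i)%:Z).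
  move=> i j a; rewrite !(dir_cell A_sym) a /= /h'.
  have a' : adj j i by rewrite adjC.
  have := Sstep _ _ a; have := Sstep _ _ a'; have := hM i; have := hM j.
  case: (S i); case: (S j) => /= ? ?; rewrite ?mul1n ?mul0n ?addn0;
  by case: (ltngtP (h i) (h j)) => ? s1 s2; rewrite ?s1 ?s2 in s1 s2 *; lia.
have pp := gradient_parts A_sym aC (cell_acyclic A_sym h') zC.
have aC' : acyclic k (cell h') by apply: acyclic_cell; rewrite // -pp.
have /gradient_wdeg := zC; move/(_ _ _ aC aC') => dE.
have := Cmax _ _ aC' zC; rewrite -subr_ge0 dE => /le_gtF/negP; apply.
under eq_bigr => i _ do rewrite mulNr.
rewrite sumrN oppr_lt0.
have S0 : S ord_max = false by rewrite /S connect0.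
have nm : i0 != ord_max by apply: contraNneq ni0 => ->; rewrite connect0.
rewrite (bigD1 i0) //= ltr_pwDl //.
  by rewrite /S ni0 mul1r y_pos.
apply: sumr_ge0 => i _; have [->|ni] := eqVneq i ord_max; first by rewrite S0 mul0r.
by rewrite mulr_ge0 // ltW // y_pos.
Qed.

Definition sink_rep c : opart m := odflt (set0, set0) [pick C in c | n_acyclic C].

(** A class is finite, and [max_n_acyclic] applies to an element of largest weight. *)
Lemma sink_repP k c : c \in classes k -> sink_rep c \in c /\ n_acyclic (sink_rep c).
Proof.
move=> cl; rewrite /sink_rep; case: pickP => [C /andP[]//|] none.
have [C0 C0c] := classes_neq0 cl.
pose F C := wdeg lambda (outdiv A C).
have [C Cc' Cmax] := @arg_maxP _ _ _ C0 (mem c) F C0c.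
have Cc : C \in c by [].
have := none C; rewrite Cc /= => /negP[]; have aC := classes_acyclic cl Cc.
apply: (max_n_acyclic aC) => C' z aC' zC; apply: Cmax.
by rewrite /= (classes_eq cl Cc); apply/(chip_classP _ aC); split=> //; exists z.
Qed.

Lemma class_weight_max k c C : c \in classes k -> C \in c ->
  wdeg lambda (outdiv A C) <= class_weight A lambda c
  /\ (wdeg lambda (outdiv A C) = class_weight A lambda c -> C = sink_rep c).
Proof.
move=> cl Cc; have [rc nr] := sink_repP cl.
have [z zC] := classes_gradient cl rc Cc.
exact: n_acyclic_max (classes_acyclic cl rc) (classes_acyclic cl Cc) nr zC.
Qed.

Lemma sink_rep_eq k c C : c \in classes k -> C \in c -> n_acyclic C -> sink_rep c = C.
Proof.
move=> cl Cc nC; have [rc nr] := sink_repP cl.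
have [le1 eq1] := class_weight_max cl Cc.
have [z zC] := classes_gradient cl Cc rc.
have [le2 eq2] := n_acyclic_max (classes_acyclic cl Cc) (classes_acyclic cl rc) nC zC.
by apply/esym/eq1/eqP; rewrite eq_le le1 le2.
Qed.

Lemma n_acyclic_contract k C f : acyclic k C -> contractible C f ->
  n_acyclic C -> n_acyclic (contract C f).
Proof.
move=> /acyclic_partition_cell[h -> _] /(contractible_cell A_sym)[fA [h' hh']].
rewrite (contracts_contract A_sym fA hh') => /n_acyclicP con; apply/n_acyclicP => i.
apply: connect_sub (con i) => u v; rewrite descentE => /andP[a huv].
apply: connect1; rewrite descentE a leqNgt hh' 1?adjC //.
by rewrite ltnNge huv.
Qed.

Definition t_exponent c f : int :=
  class_weight A lambda c
    - wterm A lambda (class_monom A c f) (class_contract A c f).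

(** Lift the n-acyclic element of c/f to some C in c. The exponent is the weight of c minus lambda .
    D(C), and the weight of c is the maximum over c, attained only at the n-acyclic element. So the
    terms free of t are the contractions of that element. *)
Lemma t_exponent_ge0 k c f : c \in classes k.+1 -> class_contractible c f ->
  0 <= t_exponent c f
  /\ (t_exponent c f = 0 <-> contractible (sink_rep c) f).
Proof.
move=> cl fc; have clf := class_contract_in cl fc.
have [rf nrf] := sink_repP clf.
have [C [Cc fC CE]] := class_lift cl fc rf.
have aC := classes_acyclic cl Cc.
have [leC eqC] := class_weight_max cl Cc.
have wE : wterm A lambda (class_monom A c f) (class_contract A c f)
    = wdeg lambda (outdiv A C).
  rewrite (outdiv_contract aC fC) wdegD /wterm (class_monomE cl fc) addrC.
  by rewrite CE.
rewrite /t_exponent wE subr_ge0; split=> //; split=> [/eqP|fr].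
  by rewrite subr_eq0 => /eqP/esym/eqC <-.
have [rc nr] := sink_repP cl; have ar := classes_acyclic cl rc.
have cr : sink_rep (class_contract A c f) = contract (sink_rep c) f.
  apply: (sink_rep_eq clf); first exact: contract_in_class cl rc fr.
  exact: n_acyclic_contract ar fr nr.
apply/eqP; rewrite subr_eq0 -wE /wterm (class_monomE cl fc) {2}/class_weight.
by rewrite -/(sink_rep _) cr addrC -wdegD -(outdiv_contract ar fr).
Qed.

Lemma sink_rep_contract k c f : c \in classes k.+1 ->
  contractible (sink_rep c) f ->
  sink_rep (class_contract A c f) = contract (sink_rep c) f.
Proof.
move=> cl fr; have [rc nr] := sink_repP cl; have ar := classes_acyclic cl rc.
have fc := class_contractibleI rc fr.
apply: (sink_rep_eq (class_contract_in cl fc)); first exact: contract_in_class cl rc fr.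
exact: n_acyclic_contract ar fr nr.
Qed.

End Classes.

(** * Codimension two faces *)

Section Diamond.
Variables (m : nat) (A : 'M[nat]_m.+1).
Hypothesis A_sym : forall i j, A i j = A j i.
Local Notation V := 'I_m.+1.
Local Notation adj := (adj A).
Local Notation cell := (cell A).
Local Notation cluster := (cluster A).
Local Notation dir := (dir A).
Local Notation gradient := (gradient A).
Local Notation acyclic := (acyclic_partition A).
Local Notation classes := (chip_classes A).
Local Notation contracts := (contracts A).
Implicit Types (h : V -> nat) (C : opart m) (e f g : edge m) (c : {set opart m}).

Lemma mem_partE h U i : U \in parts (cell h) -> (i \in U) = (cluster h i == U).
Proof.
move=> /imsetP[u _ ->]; apply/idP/eqP => [/(cluster_eq A_sym) // | <-].
exact: mem_cluster.
Qed.

Lemma merge_out (U W Z : part m) : Z != U -> Z != W -> merge (U, W) Z = Z.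
Proof. by rewrite /merge => /negbTE -> /negbTE ->. Qed.

Lemma merge_l (U W : part m) : merge (U, W) U = U :|: W.
Proof. by rewrite /merge eqxx. Qed.

Lemma merge_r (U W : part m) : merge (U, W) W = U :|: W.
Proof. by rewrite /merge eqxx orbT. Qed.

(* [s] breaks the ties of the height function of C/f/g, so that 2 h'' + s is a
   height function of C/e. *)
Lemma diamond_step h h' h'' f g e (s : V -> bool) :
  f \in arcs (cell h) -> contracts h f h' ->
  g \in arcs (cell h') -> contracts h' g h'' ->
  e \in arcs (cell h) -> e != f ->
  (forall i j, adj i j -> h i = h j -> s i = s j) ->
  (forall i j, adj i j -> in_edge f i j -> s i && ~~ s j && ~~ in_edge e i j) ->
  (forall i j, adj i j -> in_edge g i j ->
     if in_edge e i j then s i = s j else s i && ~~ s j) ->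
  (forall i j, adj i j -> in_edge e i j -> in_edge g i j) ->
  (forall i j, adj i j ->
     in_edge (edge_contract f e) i j
       = in_edge f i j || in_edge g i j && ~~ in_edge e i j) ->
  [/\ contractible (cell h) e,
      contractible (contract (cell h) e) (edge_contract f e)
    & contract (contract (cell h) e) (edge_contract f e) = cell h''].
Proof.
move=> fC hh' gC hh'' eC nef Hs Hf Hg He Hf'.
pose he i := (2 * h'' i + s i)%N.
have key i j : adj i j ->
    ((he j < he i)%N = (h j < h i)%N && ~~ in_edge e i j)
    /\ ((h'' j < h'' i)%N = (he j < he i)%N && ~~ in_edge (edge_contract f e) i j).
  move=> a; have a' : adj j i by rewrite adjC.
  have f1 := arc_in_edge fC (i := i) (j := j).
  have f2 := arc_in_edge fC (i := j) (j := i).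
  have g1 := arc_in_edge gC (i := i) (j := j).
  have g2 := arc_in_edge gC (i := j) (j := i).
  have := Hs i j a; have := Hf _ _ a; have := Hf _ _ a'; have := Hg _ _ a; have := Hg _ _ a'.
  have := He _ _ a; have := He _ _ a'; rewrite (Hf' _ _ a).
  have := hh' _ _ a; have := hh' _ _ a'; have := hh'' _ _ a; have := hh'' _ _ a'.
  rewrite /he; move: f1 f2 g1 g2.
  case: (in_edge f i j); case: (in_edge f j i); case: (in_edge g i j); case: (in_edge g j i);
  case: (in_edge e i j); case: (in_edge e j i); case: (s i); case: (s j);
  rewrite /= => f1 f2 g1 g2 d1 d2 d3 d4 e1 e2 G1 G2 F1 F2 S1;
  try (by have := e1 isT); try (by have := e2 isT);
  try (by have := F1 isT); try (by have := F2 isT);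
  try (by have := G1 isT); try (by have := G2 isT); lia.
have hhe : contracts h e he by move=> i j a; case: (key i j a).
have hhf : contracts he (edge_contract f e) h'' by move=> i j a; case: (key i j a).
have f'C : edge_contract f e \in arcs (cell he).
  case: f {Hf Hf' hh' nef hhf key} fC nef => U W /arcs_cellP[u [w [a huw UE WE]]] nef.
  rewrite /edge_contract /= UE WE -!(contracts_cluster A_sym _ eC hhe) arc_cell // hhe //.
  rewrite huw; apply: contra nef; case: e {He Hg hhe} eC => U' W'.
  move=> /arcs_cellP[u' [w' [_ _ -> ->]]] /andP[/= /(cluster_eq A_sym) uu'].
  by move=> /(cluster_eq A_sym) ww'; rewrite UE WE uu' ww'.
rewrite (contracts_contract A_sym eC hhe) (contracts_contract A_sym f'C hhf).
split=> //; first exact: contracts_contractible A_sym _ _ _ eC hhe.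
exact: contracts_contractible A_sym _ _ _ f'C hhf.
Qed.

(** With f = (U, W), the edge [e] is an arc of C that induces [g]. If [g] avoids the merged part,
    [e] is [g] itself. If [g] enters it from X, both X -> U and X -> W may be arcs, and then the
    second is not contractible because of the path X -> U -> W; so X -> U is preferred whenever X is
    adjacent to U. If [g] leaves the merged part towards Y, then W -> Y is preferred to U -> Y for
    the same reason. *)
Lemma diamond_cell k C f g : acyclic k C ->
  contractible C f -> contractible (contract C f) g ->
  exists e, [/\ e != f, edge_contract e f = g &
    [/\ contractible C e, contractible (contract C e) (edge_contract f e)
      & contract (contract C e) (edge_contract f e) = contract (contract C f) g]].
Proof.
move=> /acyclic_partition_cell[h -> _] /(contractible_cell A_sym)[fC [h' hh']].
rewrite (contracts_contract A_sym fC hh') => /(contractible_cell A_sym)[gC [h'' hh'']].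
rewrite (contracts_contract A_sym gC hh'').
suff [e [s [nef efg eC Hs [Hf Hg He Hf']]]] : exists e (s : V -> bool),
  [/\ e != f, edge_contract e f = g, e \in arcs (cell h),
   (forall i j, adj i j -> h i = h j -> s i = s j) &
  [/\ (forall i j, adj i j -> in_edge f i j -> s i && ~~ s j && ~~ in_edge e i j),
   (forall i j, adj i j -> in_edge g i j ->
     if in_edge e i j then s i = s j else s i && ~~ s j),
   (forall i j, adj i j -> in_edge e i j -> in_edge g i j) &
   (forall i j, adj i j ->
     in_edge (edge_contract f e) i j
       = in_edge f i j || in_edge g i j && ~~ in_edge e i j)]].
  by exists e; split=> //; apply: diamond_step gC hh'' eC nef Hs Hf Hg He Hf'.
have parts_s (U : part m) : U \in parts (cell h) ->
    forall i j, adj i j -> h i = h j -> (i \in U) = (j \in U).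
  move=> UP i j a hij; rewrite !(mem_partE _ UP).
  by rewrite (cluster_eq A_sym (adj_cluster a hij)).
case: f fC hh' => U W fC hh'; case: g gC hh'' => X Y gC hh''.
have /arcs_cellP[u [w [auw huw UE WE]]] := fC.
have /arcs_cellP[x [y [axy hxy XE YE]]] := gC.
have UP : U \in parts (cell h) by rewrite UE cluster_in_parts.
have WP : W \in parts (cell h) by rewrite WE cluster_in_parts.
have UW : U != W.
  apply: contraTneq huw => UW; rewrite -leqNgt.
  by rewrite (@cluster_height _ A h w u) // -WE -UW UE mem_cluster.
rewrite (contracts_cluster A_sym _ fC hh') in XE.
rewrite (contracts_cluster A_sym _ fC hh') in YE.
have hyx : (h y < h x)%N by move: hxy; rewrite hh' // => /andP[].
have XYn : X != Y.
  apply: contraTneq hxy => XY; rewrite -leqNgt (@cluster_height _ A h' y x) //.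
  rewrite !(contracts_cluster A_sym _ fC hh') -YE -XY XE.
  by rewrite -!(contracts_cluster A_sym _ fC hh') mem_cluster.
have xP := cluster_in_parts A h x; have yP := cluster_in_parts A h y.
have dis P Q : P \in parts (cell h) -> Q \in parts (cell h) -> P != Q ->
    forall i, ~~ ((i \in P) && (i \in Q)).
  move=> PP QP nPQ i; apply: contra nPQ; rewrite (mem_partE i PP) (mem_partE i QP).
  by move=> /andP[/eqP <- /eqP <-].
have garc i j : adj i j -> in_edge (X, Y) i j -> (h j < h i)%N.
  by move=> a /(arc_in_edge gC); rewrite hh' // => /andP[].
have arcI P Q i j : P \in parts (cell h) -> Q \in parts (cell h) -> adj i j ->
    i \in P -> j \in Q -> (h j < h i)%N -> (P, Q) \in arcs (cell h).
  move=> PP QP a iP jQ hij; apply/arcs_cellP; exists i, j; split=> //.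
    by move: iP; rewrite (mem_partE _ PP) => /eqP.
  by move: jQ; rewrite (mem_partE _ QP) => /eqP.
have xX : x \in cluster h x := mem_cluster _ _ _.
have yY : y \in cluster h y := mem_cluster _ _ _.
move: (cluster h x) (cluster h y) xP yP xX yY XE YE => X0 Y0 xP yP xX yY XE YE.
have memM Z : [/\ Z != U, Z != W & merge (U, W) Z = Z]
    \/ (Z = U \/ Z = W) /\ merge (U, W) Z = U :|: W.
  rewrite /merge /=; have [->|ZU] := eqVneq Z U; first by right; split=> //; left.
  have [->|ZW] := eqVneq Z W; first by right; split=> //; right.
  by left.
have dUW := dis _ _ UP WP UW.
case: (memM X0) (memM Y0) => [[XU XW XX]|[X01 XX]] [[YU YW YY]|[Y01 YY]];
  rewrite XX YY {XX YY memM} in XE YE; subst X Y.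
- exists (X0, Y0), (fun i => i \in U).
  have dXU := dis _ _ xP UP XU; have dYU := dis _ _ yP UP YU.
  split.
  + by apply: contra XU => /eqP [-> _].
  + by rewrite /edge_contract /= !merge_out.
  + exact: arcI axy xX yY hyx.
  + exact: parts_s.
  have -> : edge_contract (U, W) (X0, Y0) = (U, W).
    by rewrite /edge_contract /= !merge_out // eq_sym.
  split=> i j a; move: (dXU i) (dXU j) (dYU i) (dYU j) (dUW i) (dUW j);
    rewrite /in_edge /=;
    case: (i \in U); case: (j \in U); case: (i \in X0); case: (j \in X0);
    case: (i \in Y0); case: (j \in Y0); case: (i \in W); case: (j \in W) => //=.
- have dXU := dis _ _ xP UP XU; have dXW := dis _ _ xP WP XW.
  have XU' : U != X0 by rewrite eq_sym.
  have XW' : W != X0 by rewrite eq_sym.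
  have WU : W != U by rewrite eq_sym.
  have [/existsP[p /existsP[q /and3P[a pX qU]]]|none] :=
      boolP [exists p, exists q, [&& adj p q, p \in X0 & q \in U]].
    exists (X0, U), (fun i => i \notin W); split.
    + by apply: contra XU => /eqP [-> _].
    + by rewrite /edge_contract /= merge_out // merge_l.
    + by apply: (arcI _ _ _ _ _ _ a pX qU) => //; apply: (garc _ _ a); rewrite /in_edge /= in_setU pX qU.
    + by move=> i j a' hij; rewrite (parts_s _ WP _ _ a' hij).
    have -> : edge_contract (U, W) (X0, U) = (X0 :|: U, W).
      by rewrite /edge_contract /= merge_r merge_out.
    split=> i j a'; move: (dXU i) (dXU j) (dXW i) (dXW j) (dUW i) (dUW j);
      rewrite /in_edge /= ?in_setU;
      case: (i \in U); case: (j \in U); case: (i \in X0); case: (j \in X0);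
      case: (i \in W); case: (j \in W) => //=.
  have noadj i j : adj i j -> ~~ ((i \in X0) && (j \in U)).
    by move=> a; apply: contra none => ij; apply/existsP; exists i; apply/existsP; exists j; rewrite a.
  have xyW : y \in W by case: Y01 (noadj _ _ axy) yY => -> //; rewrite xX /= => /negbTE ->.
  exists (X0, W), (fun i => i \in U); split.
  + by apply: contra XU => /eqP [->].
  + by rewrite /edge_contract /= merge_out // merge_r.
  + exact: arcI axy xX xyW hyx.
  + exact: parts_s.
  have -> : edge_contract (U, W) (X0, W) = (U, X0 :|: W).
    by rewrite /edge_contract /= merge_r merge_out.
  split=> i j a';
    have := a'; rewrite adjC // => a'';
    move: (dXU i) (dXU j) (dXW i) (dXW j) (dUW i) (dUW j) (noadj _ _ a') (noadj _ _ a'');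
    rewrite /in_edge /= ?in_setU;
    case: (i \in U); case: (j \in U); case: (i \in X0); case: (j \in X0);
    case: (i \in W); case: (j \in W) => //=.
- have dYU := dis _ _ yP UP YU; have dYW := dis _ _ yP WP YW.
  have YU' : U != Y0 by rewrite eq_sym.
  have YW' : W != Y0 by rewrite eq_sym.
  have WU : W != U by rewrite eq_sym.
  have [/existsP[p /existsP[q /and3P[a pW qY]]]|none] :=
      boolP [exists p, exists q, [&& adj p q, p \in W & q \in Y0]].
    exists (W, Y0), (fun i => i \in U); split.
    + by apply: contra UW => /eqP [-> _].
    + by rewrite /edge_contract /= merge_r merge_out.
    + by apply: (arcI _ _ _ _ _ _ a pW qY) => //; apply: (garc _ _ a); rewrite /in_edge /= in_setU pW qY orbT.
    + exact: parts_s.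
    have -> : edge_contract (U, W) (W, Y0) = (U, W :|: Y0).
      by rewrite /edge_contract /= merge_l merge_out.
    split=> i j a'; move: (dYU i) (dYU j) (dYW i) (dYW j) (dUW i) (dUW j);
      rewrite /in_edge /= ?in_setU;
      case: (i \in U); case: (j \in U); case: (i \in Y0); case: (j \in Y0);
      case: (i \in W); case: (j \in W) => //=.
  have noadj i j : adj i j -> ~~ ((i \in W) && (j \in Y0)).
    by move=> a; apply: contra none => ij; apply/existsP; exists i; apply/existsP; exists j; rewrite a.
  have xU : x \in U by case: X01 (noadj _ _ axy) xX => -> //; rewrite yY andbT => /negbTE ->.
  exists (U, Y0), (fun i => i \notin W); split.
  + by apply: contra YW => /eqP [->].
  + by rewrite /edge_contract /= merge_l merge_out.
  + exact: arcI axy xU yY hyx.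
  + by move=> i j a' hij; rewrite (parts_s _ WP _ _ a' hij).
  have -> : edge_contract (U, W) (U, Y0) = (U :|: Y0, W).
    by rewrite /edge_contract /= merge_l merge_out.
  split=> i j a';
    have := a'; rewrite adjC // => a'';
    move: (dYU i) (dYU j) (dYW i) (dYW j) (dUW i) (dUW j) (noadj _ _ a') (noadj _ _ a'');
    rewrite /in_edge /= ?in_setU;
    case: (i \in U); case: (j \in U); case: (i \in Y0); case: (j \in Y0);
    case: (i \in W); case: (j \in W) => //=.
by rewrite eqxx in XYn.
Qed.

Lemma merge_inj h f X Y : f \in arcs (cell h) ->
  X \in parts (cell h) -> Y \in parts (cell h) -> merge f X = merge f Y ->
  X = Y \/ (X = f.1 \/ X = f.2) /\ (Y = f.1 \/ Y = f.2).
Proof.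
case: f => U W fC XP YP.
have UP : U \in parts (cell h).
  by case/arcs_cellP: fC => u [w [_ _ -> _]]; apply: cluster_in_parts.
have neP Z Z' : Z \in parts (cell h) -> Z' \in parts (cell h) -> Z = Z' :|: W -> Z = Z'.
  move=> ZP Z'P ZE; have /imsetP[i _ Z'E] := Z'P.
  have : i \in Z by rewrite ZE Z'E in_setU mem_cluster.
  by rewrite (mem_partE _ ZP) Z'E => /eqP.
rewrite /merge /=; case: ifP => [/orP XUW|nX]; case: ifP => [/orP YUW|nY].
- by move=> _; right; case: XUW YUW => /eqP -> [] /eqP ->; split; auto.
- by move/esym/(neP _ _ YP UP) => YU; rewrite YU eqxx in nY.
- by move/(neP _ _ XP UP) => XU; rewrite XU eqxx in nX.
- by left.
Qed.

(* In a cell with edges P -> R -> Q and P -> Q, the edge (P, Q) is not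
   contractible, and this is inherited by all equivalent cells. *)
Lemma no_shortcut k C C' z (P R Q : part m) p r r' q p1 q1 :
  acyclic k C -> acyclic k C' -> gradient C C' z ->
  P \in parts C -> R \in parts C -> Q \in parts C -> P != R -> R != Q ->
  p \in P -> r \in R -> dir C p r -> r' \in R -> q \in Q -> dir C r' q ->
  p1 \in P -> q1 \in Q -> dir C p1 q1 -> ~~ contractible C' (P, Q).
Proof.
move=> aC aC' zC; have pp := gradient_parts A_sym aC aC' zC.
have /acyclic_partition_cell[h CE _] := aC.
have /acyclic_partition_cell[h1 C1E _] := aC'; subst C C'.
move=> PP RP QP nPR nRQ pP rR pr r'R qQ r'q p1P q1Q p1q1; apply/negP.
move=> fC'; have := contractible_dir A_sym aC' fC' (dir_adj p1q1).
rewrite /in_edge p1P q1Q => /(_ isT) d1; have [fA [h' hh']] := contractible_cell A_sym fC'.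
have zE S i j : S \in parts (cell h) -> i \in S -> j \in S -> z i = z j /\ h1 i = h1 j.
  move=> SP; rewrite (mem_partE _ SP) => /eqP <- ij; split.
    exact: (gradient_pblock A_sym zC pp ij).
  have : j \in cluster h1 i by rewrite -(pblock_cell A_sym) -pp pblock_cell.
  by move/cluster_height.
have h'E S i j : S \in parts (cell h) -> i \in S -> j \in S -> h' i = h' j.
  rewrite pp => /imsetP[v _ ->] /(cluster_eq A_sym) <-; rewrite inE => ij.
  apply: (connect_preserved (P := fun w => h' i = h' w) _ ij) => // x y ->.
  rewrite levelE => /andP[a /eqP hxy]; apply/eqP.
  by rewrite (contracts_tie A_sym fA hh') // hxy eqxx.
have nmem S T i : S \in parts (cell h) -> T \in parts (cell h) -> S != T ->
    i \in S -> (i \in T) = false.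
  move=> SP TP nST; rewrite (mem_partE _ SP) (mem_partE _ TP) => /eqP ->.
  exact: negbTE.
have [zp hp] := zE _ _ _ PP pP p1P; have [zq hq] := zE _ _ _ QP qQ q1Q.
have [zr hr] := zE _ _ _ RP rR r'R.
have := zC _ _ (dir_adj pr); have := zC _ _ (dir_adj r'q); have := zC _ _ (dir_adj p1q1).
rewrite pr r'q p1q1 d1 !(dir_cell A_sym) (dir_adj pr) (dir_adj r'q) /=.
have := d1; rewrite (dir_cell A_sym) => /andP[_ lt1].
have a1 := dir_adj p1q1; have a1' := a1; rewrite adjC // in a1'.
have := hh' _ _ a1; have := hh' _ _ a1'; rewrite /in_edge /= p1P q1Q andbF.
have := hh' _ _ (dir_adj pr); have := hh' _ _ (dir_adj r'q); rewrite /in_edge /=.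
rewrite (nmem _ _ _ RP QP nRQ rR) (nmem _ _ _ RP PP _ r'R) 1?eq_sym // andbF !andbT.
rewrite (h'E _ _ _ PP pP p1P) (h'E _ _ _ QP qQ q1Q) (h'E _ _ _ RP rR r'R) hp hq hr zp zq zr.
move=> e1 e2 e3 e4 z1 z2 z3.
(* The arc P -> Q lies in both cells, so [z] agrees on P and Q. The differences of [z] along P -> R
   and R -> Q are nonnegative with sum 0, hence both vanish and these arcs lie in [C'] as well. *)
have [l1 l2] : (h1 q1 < h1 r')%N /\ (h1 r' < h1 p1)%N.
  move: z1 z2 z3; clear; case: (h1 q1 < h1 r')%N; case: (h1 r' < h1 p1)%N => //=; lia.
move: lt1 e1 e2 e3 e4; rewrite l1 l2; clear => lt1.
rewrite (ltnNge (h1 p1)) (ltnW lt1) /=; lia.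
Qed.

Lemma arcs_partsP k C U W : acyclic k C -> (U, W) \in arcs C ->
  [/\ U \in parts C, W \in parts C, U != W
    & exists i j, [/\ i \in U, j \in W & dir C i j]].
Proof.
move=> /acyclic_partition_cell[h -> _] /arcs_cellP[i [j [a hij UE WE]]].
split; rewrite ?UE ?WE ?cluster_in_parts //.
  apply: contraTneq hij => c_ij; rewrite -leqNgt.
  by rewrite (@cluster_height _ A h j i) // -c_ij mem_cluster.
by exists i, j; rewrite !mem_cluster (dir_cell A_sym) a.
Qed.

Local Opaque class_contract class_contractible.

(** * Pairs of iterated contractions of a class *)

Definition diamond c e f :=
  [&& e != f, class_contractible c e, class_contractible c f,
      class_contractible (class_contract A c e) (edge_contract f e)
    & class_contractible (class_contract A c f) (edge_contract e f)].

Lemma diamond_facts c e f : diamond c e f ->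
  [/\ e != f, class_contractible c e, class_contractible c f,
      class_contractible (class_contract A c e) (edge_contract f e)
    & class_contractible (class_contract A c f) (edge_contract e f)].
Proof. by move/and5P. Qed.

Lemma diamondC c e f : diamond c e f -> diamond c f e.
Proof.
by case/and5P=> nef ec fc fec efc; apply/and5P; split; rewrite // eq_sym.
Qed.

(** An element of c/f in which [g] is contractible lifts to c, which reduces the claim to
    [diamond_cell]. The monomials agree because both chains of contractions lead from the same D(C)
    to the same divisor. *)
Lemma diamond_exists k c f g : c \in classes k.+2 ->
  class_contractible c f -> class_contractible (class_contract A c f) g ->
  exists e, [/\ diamond c e f, edge_contract e f = g,
    class_contract A (class_contract A c e) (edge_contract f e)
      = class_contract A (class_contract A c f) g
    & (edge_monom A e + edge_monom A (edge_contract f e)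
       = edge_monom A f + edge_monom A g)%MM].
Proof.
move=> cl fc gc; have clf := class_contract_in A_sym cl fc.
have [C2c gC2] := realizerP gc.
have [C [Cc fC CE]] := class_lift A_sym cl fc C2c; rewrite -CE in C2c gC2.
have aC := classes_acyclic A_sym cl Cc.
have [e [nef efg [eC f'C CC]]] := diamond_cell aC fC gC2.
have ec := class_contractibleI Cc eC.
have cle := class_contract_in A_sym cl ec.
have Cec := contract_in_class A_sym cl Cc eC.
exists e; split.
- apply/and5P; split; [exact: nef | exact: ec | exact: fc | |].
    exact: class_contractibleI Cec f'C.
  by rewrite efg; exact: gc.
- exact: efg.
- apply: etrans (class_contract_eq A_sym cle Cec f'C) _; rewrite CC.
  exact: esym (class_contract_eq A_sym clf C2c gC2).
have := outdiv_contract A_sym aC fC.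
rewrite (outdiv_contract A_sym (contract_acyclic A_sym aC fC) gC2).
rewrite (outdiv_contract A_sym aC eC).
rewrite (outdiv_contract A_sym (contract_acyclic A_sym aC eC) f'C) CC -!addmA.
by move=> /addmI; rewrite addmC => ->; rewrite addmC.
Qed.

(** Two different edges inducing the same edge of C/f differ at one end only, which is U for one and
    W for the other, where f = (U, W). Then one of them is the shortcut of the path formed by the
    other and [f], and [no_shortcut] excludes it. If they differed at both ends, the induced edge
    would be a loop. *)
Lemma diamond_unique k c f e e' : c \in classes k.+2 ->
  diamond c e f -> diamond c e' f -> edge_contract e f = edge_contract e' f ->
  e = e'.
Proof.
move=> cl /and5P[nef ec fc _ gc] /and5P[nef' ec' _ _ _] ee'.
have [C2c gC2] := realizerP gc.
have [C [Cc fC CE]] := class_lift A_sym cl fc C2c; rewrite -CE in gC2.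
have aC := classes_acyclic A_sym cl Cc.
have aCf := contract_acyclic A_sym aC fC.
have inC e0 u v : edge_contract e0 f = edge_contract e f ->
    u \in e0.1 -> v \in e0.2 -> adj u v -> dir C u v.
  move=> e0E u0 v0 auv; have := contractible_dir A_sym aCf gC2 auv.
  rewrite /in_edge -e0E /edge_contract /= (dir_contract A_sym aC fC auv).
  have sub (X : part m) w : w \in X -> w \in merge f X.
    by rewrite /merge; case: ifP => // /orP[]/eqP <-; rewrite in_setU => ->; rewrite ?orbT.
  by rewrite !sub // => /(_ isT) /andP[].
have arcP e0 : class_contractible c e0 -> edge_contract e0 f = edge_contract e f ->
  [/\ e0.1 \in parts C, e0.2 \in parts C, e0.1 != e0.2,
    exists i j, [/\ i \in e0.1, j \in e0.2 & dir C i j] &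
    exists C' z, [/\ acyclic k.+2 C', gradient C C' z & contractible C' (e0.1, e0.2)]].
  move=> /realizerP[rc r0] e0E.
  have [z zC] := classes_gradient A_sym cl Cc rc.
  have ar := classes_acyclic A_sym cl rc.
  move: r0; rewrite [X in contractible _ X]surjective_pairing => r0.
  have [] := arcs_partsP ar (proj1 (andP r0)).
  rewrite -(gradient_parts A_sym aC ar zC) => ? ? ? [i [j [i0 j0 /dir_adj a]]].
  split; [assumption | assumption | assumption | | ].
    by exists i, j; split; [assumption | assumption | exact: inC e0E i0 j0 a].
  by exists (realizer c e0), z; split; assumption.
have [U [W fE]] : exists U W, f = (U, W).
  by exists f.1, f.2; apply: surjective_pairing.
have fA := proj1 (andP fC); rewrite fE in fA.
have [UP WP UW [u [w [uU wW uw]]]] := arcs_partsP aC fA.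
have [e1P e2P e12 [i [j [ie je ij]]] [C1 [z1 [aC1 zC1 eC1]]]] := arcP _ ec erefl.
have [e1P' e2P' e12' [i' [j' [ie' je' ij']]] [C1' [z1' [aC1' zC1' eC1']]]] :=
  arcP _ ec' (esym ee').
have [h CE' _] := acyclic_partition_cell aC.
have inj X Y : X \in parts C -> Y \in parts C -> merge (U, W) X = merge (U, W) Y ->
    X = Y \/ (X = U \/ X = W) /\ (Y = U \/ Y = W).
  by rewrite CE' in fA *; apply: merge_inj.
have [me1 me2] : merge (U, W) e.1 = merge (U, W) e'.1
    /\ merge (U, W) e.2 = merge (U, W) e'.2.
  by move: ee'; rewrite fE => -[].
have [_ _ gn _] : [/\ (edge_contract e f).1 \in parts (contract C f),
    (edge_contract e f).2 \in parts (contract C f),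
    (edge_contract e f).1 != (edge_contract e f).2 &
    exists i j, [/\ i \in (edge_contract e f).1, j \in (edge_contract e f).2
                   & dir (contract C f) i j]].
  by apply: arcs_partsP aCf _; rewrite -surjective_pairing; case/andP: gC2.
rewrite (surjective_pairing e) (surjective_pairing e').
have [E1|[E1 E1']] := inj _ _ e1P e1P' me1; have [E2|[E2 E2']] := inj _ _ e2P e2P' me2.
- by rewrite E1 E2.
- move: E2 E2' eC1 eC1' je je' e12 e12' => [] -> [] -> // eC1 eC1' je je' e12 e12'.
  + by rewrite E1.
  + rewrite E1 in ie e12; have := no_shortcut aC aC1' zC1' e1P' UP WP e12 UW
      ie je ij uU wW uw ie' je' ij'.
    by rewrite eC1'.
  + rewrite -E1 in ie' e12'; have := no_shortcut aC aC1 zC1 e1P UP WP e12' UW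
      ie' je' ij' uU wW uw ie je ij.
    by rewrite eC1.
  + by rewrite E1.
- move: E1 E1' eC1 eC1' ie ie' e12 e12' => [] -> [] -> // eC1 eC1' ie ie' e12 e12'.
  + by rewrite E2.
  + rewrite -E2 in je' e12'; have := no_shortcut aC aC1 zC1 UP WP e2P UW e12'
      uU wW uw ie' je' ij' ie je ij.
    by rewrite eC1.
  + rewrite E2 in je e12; have := no_shortcut aC aC1' zC1' UP WP e2P' UW e12
      uU wW uw ie je ij ie' je' ij'.
    by rewrite eC1'.
  + by rewrite E2.
case/negP: gn; apply/eqP.
have M X : X = U \/ X = W -> merge f X = U :|: W.
  by rewrite fE; case=> ->; rewrite ?merge_l ?merge_r.
by rewrite /edge_contract /= (M _ E1) (M _ E2).
Qed.

End Diamond.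

(** * Dhar's algorithm and the matching *)

Section Matching.
Variables (m : nat) (A : 'M[nat]_m.+1).
Hypothesis A_sym : forall i j, A i j = A j i.
Local Notation V := 'I_m.+1.
Local Notation adj := (adj A).
Local Notation cell := (cell A).
Local Notation cluster := (cluster A).
Local Notation dir := (dir A).
Local Notation level := (level A).
Local Notation descent := (descent A).
Local Notation acyclic := (acyclic_partition A).
Local Notation contracts := (contracts A).
Implicit Types (h : V -> nat) (C : opart m) (e f g : edge m) (S K L : {set V}).

(** A total order on vertex sets that extends inclusion: the cardinality decides, and the
    enumeration breaks ties. Monotonicity is what keeps the first atom first when atoms grow under
    contraction. *)
Definition set_rank K : nat := (#|K| * #|{set V}| + enum_rank K)%N.

Lemma set_rank_inj : injective set_rank.
Proof.
move=> K L /(congr1 (fun n => n %% #|{set V}|)%N).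
by rewrite !modnMDl !modn_small // => /ord_inj /enum_rank_inj.
Qed.

Lemma set_rank_mono K L : K \subset L -> (set_rank K <= set_rank L)%N.
Proof.
move=> sKL; have [->//|nKL] := eqVneq K L.
have ltKL : (#|K| < #|L|)%N by apply: proper_card; rewrite properEneq nKL.
rewrite /set_rank; have : (enum_rank K < #|{set V}|)%N by []; nia.
Qed.

(** * Legal firing sets and atoms for a fixed total degree *)

Variable D : V -> nat.

Definition fireable S : bool :=
  (ord_max \notin S) && [forall i in S, \sum_(j | j \notin S) A i j <= D i]%N.

(* The largest legal firing set not containing the last vertex: the complement
   of the set burnt by Dhar's algorithm. *)
Definition unburnt : {set V} := \bigcup_(S | fireable S) S.

Lemma leq_sum_adj (P Q : pred V) i :
  (forall j, adj i j -> P j -> Q j) ->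
  (\sum_(j | P j) A i j <= \sum_(j | Q j) A i j)%N.
Proof.
move=> PQ; rewrite big_mkcond [X in (_ <= X)%N]big_mkcond /=.
apply: leq_sum => j _; case: (posnP (A i j)) => [->|a]; first by rewrite !if_same.
by case: ifP => // Pj; rewrite PQ.
Qed.

Lemma fireable_sub S : fireable S -> S \subset unburnt.
Proof. by move=> fS; apply: bigcup_sup fS. Qed.

Lemma fireableP : fireable unburnt.
Proof.
apply/andP; split.
  by apply/bigcupP => -[S /andP[/negP nS _] /nS].
apply/'forall_implyP=> i /bigcupP[S fS iS].
have /andP[_ /'forall_implyP/(_ i iS)] := fS; apply: leq_trans.
apply: leq_sum_adj => j _; apply: contra; exact: (subsetP (fireable_sub fS)).
Qed.

Lemma unburnt_max : ord_max \notin unburnt.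
Proof. by case/andP: fireableP. Qed.

Lemma unburnt_sum i : i \in unburnt -> (\sum_(j | j \notin unburnt) A i j <= D i)%N.
Proof. by case/andP: fireableP => _ /'forall_implyP; apply. Qed.

(** Burnt vertices cut off from the last vertex inside the burnt set have no neighbour among the
    other burnt vertices. Adding them to the unburnt set would give a larger fireable set. *)
Lemma burnt_connected i : i \notin unburnt ->
  connect [rel u v | [&& u \notin unburnt, v \notin unburnt & adj u v]] i ord_max.
Proof.
set e := [rel u v | _] => iB; apply/negPn/negP=> ni.
pose S := unburnt :|: [set v | ~~ connect e v ord_max].
have fS : fireable S.
  apply/andP; split; first by rewrite !inE connect0 orbF unburnt_max.
  apply/'forall_implyP=> v vS; have [vU|vB] := boolP (v \in unburnt).
    apply: leq_trans (unburnt_sum vU); apply: leq_sum_adj => w _.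
    by apply: contra; rewrite inE => ->.
  rewrite big1 // => w; rewrite !inE negb_or negbK => /andP[wB wn].
  move: vS; rewrite !inE (negbTE vB) /= => vn.
  apply/eqP; apply: contraNT vn; rewrite -lt0n => a.
  by apply: connect_trans wn; apply: connect1; rewrite /= vB wB.
have := subsetP (fireable_sub fS) i; rewrite !inE ni orbT => /(_ isT).
by rewrite (negbTE iB).
Qed.

(** Burnt vertices are put strictly below all unburnt ones, so that clusters do not cross the
    boundary of the unburnt set. Up to [same_dir], only the comparisons of [h] between unburnt
    vertices matter. *)
Definition refine h (i : V) : nat := if i \in unburnt then (h i).+1 else 0%N.

(* The sets that can be split off the sink part, if they lie in it, and merged
   with it, if they are parts, without leaving the admissible heights. *)
Definition atoms h : {set {set V}} :=
  [set K in cluster (refine h) @: unburnt |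
     [forall i in K, forall j,
        adj i j && (refine h j < refine h i)%N ==> (j \notin unburnt)]].

Lemma atomsP h K :
  reflect ((exists2 i, i \in unburnt & K = cluster (refine h) i) /\
           forall i j, i \in K -> adj i j -> (refine h j < refine h i)%N -> j \notin unburnt)
    (K \in atoms h).
Proof.
rewrite inE; apply: (iffP andP) => [[/imsetP Ki /'forall_implyP KP]|[Ki KP]].
  split=> // i j iK a ij.
  by move/'forall_implyP: (KP i iK) => /(_ j); rewrite a ij; apply.
split; first by apply/imsetP.
by apply/'forall_implyP=> i iK; apply/'forall_implyP=> j /andP[]; apply: KP.
Qed.

Lemma refine_ext h h' :
  (forall i j, i \in unburnt -> j \in unburnt -> adj i j ->
     (h j < h i)%N = (h' j < h' i)%N) ->
  same_dir A (refine h) (refine h').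
Proof.
move=> hh i j a; rewrite /refine.
by case: ifP => jU; case: ifP => iU //; rewrite !ltnS hh.
Qed.

Lemma atoms_ext h h' :
  (forall i j, i \in unburnt -> j \in unburnt -> adj i j ->
     (h j < h i)%N = (h' j < h' i)%N) ->
  atoms h = atoms h'.
Proof.
move=> /refine_ext hh; have hc := same_dir_cluster A_sym hh.
apply/setP=> K; apply/atomsP/atomsP => -[[i iU ->] Ki]; split.
- by exists i.
- by move=> u v uK a; rewrite -hh //; apply: Ki; rewrite // hc.
- by exists i.
by move=> u v uK a; rewrite hh //; apply: Ki; rewrite // -hc.
Qed.

Definition first_atom h : {set V} :=
  odflt set0 [pick K in atoms h | [forall L in atoms h, set_rank K <= set_rank L]]%N.

Lemma first_atomP h : atoms h != set0 ->
  first_atom h \in atoms h /\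
  forall L, L \in atoms h -> (set_rank (first_atom h) <= set_rank L)%N.
Proof.
move=> /set0Pn[K0 K0a]; rewrite /first_atom.
case: pickP => [K /andP[Ka /'forall_implyP Kmin] //|none].
have [K Ka Kmin] := @arg_minnP _ K0 (mem (atoms h)) set_rank K0a.
have /andP[] := none K; split; first exact: Ka.
by apply/'forall_implyP.
Qed.

Lemma first_atom_eq h K : K \in atoms h ->
  (forall L, L \in atoms h -> set_rank K <= set_rank L)%N -> first_atom h = K.
Proof.
move=> Ka Kmin; have /first_atomP[Fa Fmin] : atoms h != set0 by apply/set0Pn; exists K.
by apply/set_rank_inj/eqP; rewrite eqn_leq Fmin // Kmin.
Qed.

Lemma first_atom_ext h h' : atoms h = atoms h' -> first_atom h = first_atom h'.
Proof. by rewrite /first_atom => ->. Qed.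

Lemma atoms_neq0 h : unburnt != set0 -> atoms h != set0.
Proof.
move=> /set0Pn[i0 i0U].
have [i iU imin] := @arg_minnP _ i0 (mem unburnt) (refine h) i0U.
apply/set0Pn; exists (cluster (refine h) i); apply/atomsP; split; first by exists i.
move=> u j /cluster_height -> a ij; apply: contraL ij => jU.
by rewrite -leqNgt; apply: imin.
Qed.

(** The heights of the n-acyclic C with D(C) <= D, that is, those for which some monomial x^u e_C
    has total degree D. *)
Definition admissible h : Prop :=
  (forall i, connect (descent h) i ord_max) /\
  (forall i, \sum_(j | h j < h i) A i j <= D i)%N.

Section Admissible.
Variables (h : V -> nat) (hA : admissible h).

Lemma sink_min i : (h ord_max <= h i)%N.
Proof. exact: descent_height (hA.1 i). Qed.

Lemma sink_clusterE i : (i \in cluster h ord_max) = (h i == h ord_max).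
Proof.
apply/idP/eqP => [/cluster_height //|hi].
have : connect (level h) i ord_max.
  apply: (connect_transfer (P := fun v => h v == h ord_max)) _ (hA.1 i); last exact/eqP.
  move=> u v /eqP hu; rewrite descentE hu => /andP[a hv].
  have hvE : h v = h ord_max by apply/eqP; rewrite eqn_leq hv sink_min.
  by rewrite levelE a hu hvE eqxx.
by rewrite inE (sym_connect_sym (level_sym A_sym h)).
Qed.

(** The vertices above the sink level form a fireable set: what such a vertex sends down to the sink
    level is part of D(C), hence bounded by D. So every vertex above the sink level is unburnt. *)
Lemma burnt_height i : i \notin unburnt -> h i = h ord_max.
Proof.
apply: contraNeq => hi; apply: (subsetP (fireable_sub (S := [set v | h v != h ord_max]) _)).
  rewrite /fireable inE eqxx /=; apply/'forall_implyP=> v; rewrite inE => hv.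
  apply: leq_trans (hA.2 v); apply: leq_sum_adj => j _; rewrite inE negbK => /eqP ->.
  by rewrite ltn_neqAle eq_sym hv sink_min.
by rewrite inE.
Qed.

Lemma atom_facts K : K \in atoms h ->
  [/\ K != set0, K \subset unburnt,
      (forall i j, i \in K -> j \in K -> h i = h j /\ connect (level (refine h)) i j),
      (forall i j, i \in K -> adj i j -> h j = h i -> j \in unburnt -> j \in K)
    & (forall i j, i \in K -> adj i j -> (h j < h i)%N -> j \notin unburnt)].
Proof.
move=> /atomsP[[i0 i0U KE] Kout].
have KU : K \subset unburnt.
  apply/subsetP=> i; rewrite KE => /cluster_height; rewrite /refine i0U.
  by case: ifP.
split=> //.
- by apply/set0Pn; exists i0; rewrite KE mem_cluster.
- move=> i j iK jK; have := iK; rewrite KE => iK'.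
  have : j \in cluster (refine h) i by rewrite (cluster_eq A_sym iK') -KE.
  move=> ij; split; last by rewrite inE in ij.
  have := cluster_height ij; rewrite /refine (subsetP KU _ iK) (subsetP KU _ jK).
  by case.
- move=> i j iK a hij jU; have := iK; rewrite KE => iK'.
  rewrite -(cluster_eq A_sym iK'); apply: adj_cluster => //.
  by rewrite /refine jU (subsetP KU _ iK) hij.
move=> i j iK a hij; apply: (Kout i j iK a).
by rewrite /refine (subsetP KU _ iK); case: ifP.
Qed.

End Admissible.

Lemma atom_exit h (e : rel V) K :
  K \in atoms h -> (forall i, connect e i ord_max) ->
  exists u v, [/\ u \in K, v \notin K & e u v].
Proof.
move=> Ka con; have [/set0Pn[i0 i0K] KU _ _ _] := atom_facts Ka.
apply/not_existsP => none.
have : ord_max \in K.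
  apply: (connect_preserved (P := fun v => v \in K) _ (con i0)) => // u v uK uv.
  by apply/negPn/negP=> vK; apply: (none u); exists v; split.
by move/(subsetP KU); rewrite (negbTE unburnt_max).
Qed.

(** * Splitting an atom off the sink part *)

Section Split.
Variables (h : V -> nat) (hA : admissible h) (K : {set V}).
Hypotheses (Ka : K \in atoms h) (Ksub : K \subset cluster h ord_max).

(** [K] is raised by half a level above the rest of the sink part; doubling the heights makes room
    for this. *)
Definition split_height (i : V) : nat := (2 * h i + (i \in K))%N.
Local Notation h' := split_height.

Let K_height i : i \in K -> h i = h ord_max.
Proof. by move/(subsetP Ksub); rewrite sink_clusterE // => /eqP. Qed.

Let K_exit i j : i \in K -> adj i j -> j \notin K -> h j = h ord_max -> j \notin unburnt.
Proof.
move=> iK a; have [_ _ _ Kcl _] := atom_facts Ka.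
move=> jK hj; apply: contra jK; apply: (Kcl i j iK a).
by rewrite hj K_height.
Qed.

(** A vertex of the sink part outside [K] that is adjacent to [K] is burnt. So a vertex whose
    descending path is blocked by raising [K] reaches the last vertex through burnt vertices, and
    the edges along which [K] now descends end in burnt vertices, which D allows since [K] is
    unburnt. *)
Lemma split_admissible : admissible h'.
Proof.
have [_ KU _ _ _] := atom_facts Ka; split=> i.
  have /connectP[p ep pE] := hA.1 i.
  elim: p i ep pE => [|j p IH] i /=; first by move=> _ ->; apply: connect0.
  move=> /andP[/andP[a hij] ep] pE; have {IH ep pE}con := IH j ep pE.
  have [hij'|hij'] := leqP (h' j) (h' i).
    by apply: connect_trans con; apply: connect1; rewrite descentE a.
  have [jK iK hE] : [/\ j \in K, i \notin K & h i = h j].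
    move: hij hij'; rewrite /h'; case: (j \in K); case: (i \in K); split=> //; lia.
  have iB : i \notin unburnt.
    have a' : adj j i by rewrite adjC.
    by apply: (K_exit jK a' iK); rewrite hE K_height.
  apply: connect_sub (burnt_connected iB) => u v /= /and3P[uB vB auv].
  apply: connect1; rewrite descentE auv /h' (burnt_height hA uB) (burnt_height hA vB).
  have nK w : w \notin unburnt -> (w \in K) = false.
    by move=> wB; apply: contraNF wB; apply: (subsetP KU).
  by rewrite !nK // leqnn.
have [iK|iK] := boolP (i \in K).
  apply: leq_trans (unburnt_sum (subsetP KU _ iK)); apply: leq_sum_adj => j a.
  rewrite /h' iK => hij; have jK : j \notin K.
    by apply: contraL hij => jK; rewrite jK (K_height iK) (K_height jK) ltnn.
  apply: (K_exit iK a jK); apply/eqP; rewrite eqn_leq sink_min // andbT.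
  by rewrite -(K_height iK); move: hij; rewrite (negbTE jK); lia.
apply: leq_trans (hA.2 i); apply: leq_sum_adj => j a; rewrite /h' (negbTE iK).
lia.
Qed.

Lemma split_sinkE i : (i \in cluster h' ord_max) = (h i == h ord_max) && (i \notin K).
Proof.
rewrite (sink_clusterE split_admissible) /h'.
have [_ KU _ _ _] := atom_facts Ka.
have -> : (ord_max \in K) = false.
  by apply: contraNF unburnt_max; apply: (subsetP KU).
by case: (i \in K); rewrite ?andbT ?andbF; lia.
Qed.

Lemma split_cluster i : i \in K -> cluster h' i = K.
Proof.
move=> iK; have [_ KU Kcon _ _] := atom_facts Ka; apply/setP=> j; apply/idP/idP.
  rewrite inE => ij; apply: (connect_preserved (P := fun v => v \in K) _ ij) => //.
  move=> u v uK; rewrite levelE /h' uK => /andP[_ huv].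
  by apply/negPn/negP => vK; move: huv; rewrite (negbTE vK); lia.
move=> jK; rewrite inE; have [_ ij] := Kcon i j iK jK.
apply: (connect_transfer (P := fun v => v \in K)) _ ij => // u v uK; rewrite levelE => /andP[a huv].
have vU : v \in unburnt.
  by move: huv; rewrite /refine (subsetP KU _ uK); case: ifP.
have hE : h v = h u by move: huv; rewrite /refine vU (subsetP KU _ uK) => /eqP[].
have [_ _ _ Kcl _] := atom_facts Ka; have vK := Kcl u v uK a hE vU.
by rewrite /= vK levelE a /h' hE uK vK eqxx.
Qed.

Lemma split_arc : (K, cluster h' ord_max) \in arcs (cell h').
Proof.
have [u [v [uK vK]]] := atom_exit Ka split_admissible.1.
rewrite descentE => /andP[a huv].
have hv : h v = h ord_max.
  apply/eqP; rewrite eqn_leq sink_min // andbT -(K_height uK).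
  by move: huv; rewrite /h' uK (negbTE vK); lia.
have vcl : v \in cluster h' ord_max by rewrite split_sinkE hv eqxx.
apply/arcs_cellP; exists u, v; split=> //.
- by rewrite /h' uK (negbTE vK) hv K_height //; lia.
- by rewrite split_cluster.
exact/esym/(cluster_eq A_sym).
Qed.

Lemma split_contracts : contracts h' (K, cluster h' ord_max) h.
Proof.
move=> i j a; rewrite /in_edge /= split_sinkE.
have := sink_min hA j; have := sink_min hA i; rewrite /h'.
have [iK|iK] := boolP (i \in K); have [jK|jK] := boolP (j \in K);
  rewrite ?(K_height iK) ?(K_height jK) /= ?andbF ?andbT; lia.
Qed.

(** The only comparisons that change are between [K] and burnt vertices, and atoms do not depend on
    these. *)
Lemma split_atoms : atoms h' = atoms h.
Proof.
apply: atoms_ext => i j iU jU a; rewrite /h'.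
have a' : adj j i by rewrite adjC.
have [iK|iK] := boolP (i \in K); have [jK|jK] := boolP (j \in K); try lia.
  have := K_exit iK a jK; rewrite jU => hj.
  have : h j != h ord_max by apply/eqP => /hj.
  by rewrite (K_height iK); have := sink_min hA j; lia.
Qed.

Lemma split_nsub : ~~ (K \subset cluster h' ord_max).
Proof.
have [/set0Pn[i iK] _ _ _ _] := atom_facts Ka.
by apply/subsetPn; exists i; rewrite // split_sinkE iK andbF.
Qed.

End Split.

(** * Merging an atom into the sink part *)

Section Merge.
Variables (h : V -> nat) (hA : admissible h) (K : {set V}).
Hypotheses (Ka : K \in atoms h) (Knsub : ~~ (K \subset cluster h ord_max)).

Definition merge_height (i : V) : nat := if i \in K then h ord_max else h i.
Local Notation h' := merge_height.

Lemma high_atom i : i \in K -> (h ord_max < h i)%N.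
Proof.
move=> iK; have [_ _ Kcon _ _] := atom_facts Ka.
rewrite ltn_neqAle sink_min // andbT eq_sym; apply: contra Knsub => /eqP hi.
apply/subsetP=> j jK; rewrite sink_clusterE //.
by have [<- _] := Kcon i j iK jK; rewrite hi.
Qed.

Lemma high_atom_cluster i : i \in K -> cluster h i = K.
Proof.
move=> iK; have [_ KU Kcon Kcl _] := atom_facts Ka; apply/setP=> j; apply/idP/idP.
  rewrite inE => ij; apply: (connect_preserved (P := fun v => v \in K) _ ij) => //.
  move=> u v uK; rewrite levelE => /andP[a /eqP huv].
  apply: (Kcl u v uK a (esym huv)).
  apply/negPn/negP => /(burnt_height hA) hv.
  by have := high_atom uK; rewrite huv hv ltnn.
move=> jK; rewrite inE; have [_ ij] := Kcon i j iK jK.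
apply: (connect_transfer (P := fun v => v \in K)) _ ij => // u v uK; rewrite levelE => /andP[a huv].
have vU : v \in unburnt.
  by move: huv; rewrite /refine (subsetP KU _ uK); case: ifP.
have hE : h v = h u by move: huv; rewrite /refine vU (subsetP KU _ uK) => /eqP[].
by rewrite /= (Kcl u v uK a hE vU) levelE a hE eqxx.
Qed.

Let K_lower i j : i \in K -> adj i j -> j \notin K -> (h j <= h i)%N ->
  j \notin unburnt /\ h j = h ord_max.
Proof.
move=> iK a jK; have [_ _ _ _ Kout] := atom_facts Ka.
rewrite leq_eqVlt => /orP[/eqP hij|hij].
  by move: jK; rewrite -(high_atom_cluster iK) (adj_cluster a).
have jB := Kout i j iK a hij; split=> //; exact: burnt_height jB.
Qed.

Lemma merge_arc : (K, cluster h ord_max) \in arcs (cell h).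
Proof.
have [u [v [uK vK]]] := atom_exit Ka hA.1.
rewrite descentE => /andP[a huv]; have [vB hv] := K_lower uK a vK huv.
apply/arcs_cellP; exists u, v; split=> //.
- by rewrite hv high_atom.
- by rewrite high_atom_cluster.
by apply/esym/(cluster_eq A_sym); rewrite sink_clusterE // hv.
Qed.

(** The lower neighbours of an atom above the sink are burnt, hence at sink level, and its
    neighbours at equal height belong to it. So lowering [K] to the sink level deletes the descents
    along this one arc and alters no other comparison. *)
Lemma merge_contracts : contracts h (K, cluster h ord_max) h'.
Proof.
move=> i j a; rewrite /in_edge /= sink_clusterE // /h'.
have a' : adj j i by rewrite adjC.
have := sink_min hA j; have := sink_min hA i.
have [iK|iK] := boolP (i \in K); have [jK|jK] := boolP (j \in K); rewrite ?andbT //=.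
- have [_ _ Kcon _ _] := atom_facts Ka.
  by have [-> _] := Kcon i j iK jK; rewrite !ltnn.
- by have := K_lower iK a jK; have := high_atom iK; lia.
by have := K_lower jK a' iK; have := high_atom jK; lia.
Qed.

Lemma merge_atoms : atoms h' = atoms h.
Proof.
apply: atoms_ext => i j iU jU a; rewrite /h'.
have a' : adj j i by rewrite adjC.
have := sink_min hA j; have := sink_min hA i.
have [iK|iK] := boolP (i \in K); have [jK|jK] := boolP (j \in K) => //.
- have [_ _ Kcon _ _] := atom_facts Ka.
  by have [-> _] := Kcon i j iK jK; rewrite !ltnn.
- by have := K_lower iK a jK; have := high_atom iK; rewrite jU; lia.
by have := K_lower jK a' iK; have := high_atom jK; rewrite iU; lia.
Qed.

End Merge.

Lemma merge_first_atom h : admissible h -> atoms h != set0 ->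
  ~~ (first_atom h \subset cluster h ord_max) ->
  first_atom (merge_height h (first_atom h)) = first_atom h.
Proof.
by move=> hA /first_atomP[Ka _] Kn; apply/first_atom_ext/merge_atoms.
Qed.

(** * Faces of admissible cells *)

Lemma contract_admissible h f h' :
  admissible h -> contracts h f h' -> admissible h'.
Proof.
move=> hA hh'; split=> i.
  apply: connect_sub (hA.1 i) => u v; rewrite descentE => /andP[a huv].
  apply: connect1; rewrite descentE a leqNgt hh' 1?adjC //.
  by rewrite ltnNge huv.
apply: leq_trans (hA.2 i); apply: leq_sum_adj => j a.
by rewrite hh' // => /andP[].
Qed.

(* A face of an admissible cell in which the first atom K is a part: if the
   sink part absorbs another part, then K remains the first atom and remains
   a part. *)
Lemma facet_sink h f h' : admissible h -> atoms h != set0 ->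
  ~~ (first_atom h \subset cluster h ord_max) ->
  f \in arcs (cell h) -> contracts h f h' ->
  f != (first_atom h, cluster h ord_max) ->
  first_atom h' \subset cluster h' ord_max ->
  cluster h' ord_max = cluster h ord_max.
Proof.
move=> hA ne Kn fA hh' nf; have hA' := contract_admissible hA hh'.
have [Ka Kmin] := first_atomP ne; move: (first_atom h) Ka Kmin Kn nf => K Ka Kmin Kn nf.
have clE i := contracts_cluster A_sym i fA hh'; rewrite clE.
have [/set0Pn[i0 i0K] KU Kcon _ Kout] := atom_facts Ka.
have KE : cluster h i0 = K := high_atom_cluster hA Ka Kn i0K.
case: f fA hh' nf clE => P Q fA hh' nf clE.
have /arcs_cellP[p [q [apq hpq PE QE]]] := fA.
have PS : cluster h ord_max != P.
  apply/eqP => sP; have : p \in cluster h ord_max by rewrite sP PE mem_cluster.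
  by rewrite sink_clusterE // => /eqP hp; have := sink_min hA q; rewrite -hp leqNgt hpq.
have [QS|QS _] := eqVneq (cluster h ord_max) Q; last by rewrite merge_out.
have PK : K != P by apply: contraNneq nf => ->; rewrite QS.
have QK : K != Q by apply: contraNneq Kn => ->; rewrite QS.
suff Fh' : first_atom h' = K.
  rewrite Fh' QS merge_r => /subsetP/(_ _ i0K); rewrite in_setU PE QE.
  by case/orP=> /(cluster_eq A_sym); rewrite KE -?PE -?QE => /eqP;
    rewrite ?(negbTE PK) ?(negbTE QK).
have tie u v : adj u v -> h u = h v -> h' u = h' v.
  by move=> a /eqP uv; apply/eqP; rewrite (contracts_tie A_sym fA hh') ?uv.
have refine_tie u v : u \in unburnt -> refine h u = refine h v ->
    v \in unburnt /\ h u = h v.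
  by move=> uU; rewrite /refine uU; case: ifP => // _ [].
have K'E : cluster (refine h') i0 = K.
  apply/setP=> j; apply/idP/idP.
    have hK : cluster h' i0 = K by rewrite clE KE merge_out.
    rewrite -hK !inE => ij.
    apply: (connect_transfer (P := fun v => v \in unburnt)) _ ij; last first.
      exact: (subsetP KU).
    move=> u v uU; rewrite !levelE => /andP[a].
    by rewrite /refine uU; case: ifP => //= _ /eqP[->]; rewrite a eqxx.
  move=> jK; rewrite inE; have [_ ij] := Kcon i0 j i0K jK.
  apply: (connect_transfer (P := fun v => v \in unburnt)) _ ij; last first.
    exact: (subsetP KU).
  move=> u v uU; rewrite !levelE => /andP[a /eqP /(refine_tie _ _ uU)[vU uv]].
  by rewrite vU a /refine uU vU (tie _ _ a uv) eqxx.
apply: first_atom_eq => [|L La].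
  apply/atomsP; split; first by exists i0; rewrite ?K'E // (subsetP KU).
  move=> i j iK a rij; apply/negP=> jU; move: rij.
  rewrite /refine (subsetP KU _ iK) jU ltnS hh' // => /andP[hij _].
  by have := Kout i j iK a hij; rewrite jU.
have [[i1 i1U LE] Lout] := atomsP _ _ La.
have i1L : i1 \in L by rewrite LE mem_cluster.
(* The piece of [L] that is lowest for [h] is an atom of [h]: a lower unburnt neighbour would either
   lie in [L], against minimality, or stay lower for [h'], against [L] being an atom. Hence [K]
   ranks before this piece, and by monotonicity before [L]. *)
have [i iL imin] := @arg_minnP _ i1 (mem L) (refine h) i1L.
have [_ LU _ _ _] := atom_facts La.
have iU := subsetP LU _ iL.
have K1L : cluster (refine h) i \subset L.
  have <- : cluster (refine h') i = L by rewrite LE; apply: (cluster_eq A_sym); rewrite -LE.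
  apply/subsetP=> j; rewrite !inE => ij.
  apply: (connect_transfer (P := fun v => v \in unburnt)) _ ij => //.
  move=> u v uU; rewrite !levelE => /andP[a /eqP /(refine_tie _ _ uU)[vU uv]].
  by rewrite vU a /refine uU vU (tie _ _ a uv) eqxx.
apply: leq_trans (set_rank_mono K1L); apply: Kmin; apply/atomsP; split; first by exists i.
move=> u j uK1 a ruj; have uL := subsetP K1L _ uK1; have uU := subsetP LU _ uL.
apply/negP=> jU; have huj : (h j < h u)%N by move: ruj; rewrite /refine jU uU.
have h'uj : (h' j <= h' u)%N.
  have := hh' j u; rewrite adjC // a => /(_ isT); rewrite (ltnNge (h u)) (ltnW huj) /=.
  by case: ltnP.
move: h'uj; rewrite leq_eqVlt => /orP[/eqP huE|hlt].
  have jL : j \in L.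
    have <- : cluster (refine h') u = L by rewrite LE; apply: (cluster_eq A_sym); rewrite -LE.
    by apply: adj_cluster a _; rewrite /refine uU jU huE.
  have := imin j jL; rewrite -(cluster_height uK1) leqNgt.
  by rewrite ruj.
have := Lout u j uL a; rewrite /refine uU jU ltnS hlt => /(_ isT).
by [].
Qed.

(** This is the triangularity of the matching: an unmatched face that is itself to be split keeps
    the sink part of the cell, whereas the matched face adds the first atom to it. *)
Lemma facet_sink_card h f h' : admissible h -> atoms h != set0 ->
  ~~ (first_atom h \subset cluster h ord_max) ->
  f \in arcs (cell h) -> contracts h f h' ->
  f != (first_atom h, cluster h ord_max) ->
  first_atom h' \subset cluster h' ord_max ->
  (#|cluster h' ord_max| < #|cluster (merge_height h (first_atom h)) ord_max|)%N.
Proof.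
move=> hA ne Kn fA hh' nf sub; rewrite (facet_sink hA ne Kn fA hh' nf sub).
have [Ka _] := first_atomP ne.
have [/set0Pn[i0 i0K] _ _ _ _] := atom_facts Ka.
have KE := high_atom_cluster hA Ka Kn i0K.
rewrite (contracts_cluster A_sym _ (merge_arc hA Ka Kn) (merge_contracts hA Ka Kn)) merge_r.
apply: proper_card; apply/properP; split; first exact: subsetUr.
exists i0; first by rewrite in_setU i0K.
by rewrite sink_clusterE // gtn_eqF // (high_atom hA Ka Kn i0K).
Qed.

(** * The matching on acyclic partitions *)

Definition cut_atom C : {set V} := first_atom (height C).
Definition sink_block C : part m := pblock (parts C) ord_max.
Definition admissible_partition C : Prop :=
  n_acyclic C /\ forall i, (outdiv A C i <= D i)%N.

Lemma cut_atom_cell h : cut_atom (cell h) = first_atom h.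
Proof.
have /cell_height/(cell_same_dir A_sym) hh := cell_acyclic A_sym h.
by apply/first_atom_ext/atoms_ext => i j _ _ a; rewrite hh.
Qed.

Lemma sink_block_cell h : sink_block (cell h) = cluster h ord_max.
Proof. exact: pblock_cell. Qed.

Lemma admissible_cell h : admissible_partition (cell h) <-> admissible h.
Proof.
split=> [[/(n_acyclicP A_sym) con out]|[con out]]; split=> //.
- by move=> i; rewrite -outdiv_cell.
- exact/(n_acyclicP A_sym).
by move=> i; rewrite outdiv_cell.
Qed.

(** When every vertex burns, [burnt_height] puts all of them into the sink part. So the matching
    leaves nothing unmatched in positive homological degree. *)
Lemma superstable_trivial k C : acyclic k C -> admissible_partition C ->
  unburnt = set0 -> k = 1%N.
Proof.
move=> /acyclic_partition_cell[h -> <-] /admissible_cell hA U0.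
have clE i : cluster h i = cluster h ord_max.
  by apply: (cluster_eq A_sym); rewrite sink_clusterE // burnt_height // U0 inE.
rewrite /cell /= -(cards1 (cluster h ord_max)); congr #|pred_of_set _|.
apply/setP=> X; rewrite in_set1; apply/imsetP/eqP => [[i _ ->]|->]; first exact: clE.
by exists ord_max.
Qed.

Lemma split_partition k C : acyclic k C -> admissible_partition C ->
  unburnt != set0 -> cut_atom C \subset sink_block C ->
  exists C', [/\ acyclic k.+1 C', admissible_partition C',
    ~~ (cut_atom C' \subset sink_block C'),
    contractible C' (cut_atom C', sink_block C')
    & contract C' (cut_atom C', sink_block C') = C].
Proof.
move=> /acyclic_partition_cell[h -> kE] /admissible_cell hA U0.
rewrite cut_atom_cell sink_block_cell => Ks.
have [Ka Kmin] := first_atomP (atoms_neq0 h U0).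
have Fh := first_atom_ext (split_atoms hA Ka Ks).
have fA := split_arc hA Ka Ks; have hh := split_contracts hA Ka Ks.
have CE := contracts_contract A_sym fA hh.
exists (cell (split_height h (first_atom h))); rewrite cut_atom_cell sink_block_cell Fh.
split.
- by apply: (acyclic_cell A_sym); rewrite (card_merge A_sym fA) -kE -CE.
- exact/admissible_cell/split_admissible.
- exact: split_nsub.
- exact: contracts_contractible hh.
exact: CE.
Qed.

Lemma merge_partition k C : acyclic k C -> admissible_partition C ->
  unburnt != set0 -> ~~ (cut_atom C \subset sink_block C) ->
  [/\ contractible C (cut_atom C, sink_block C),
    cut_atom (contract C (cut_atom C, sink_block C)) = cut_atom C,
    sink_block (contract C (cut_atom C, sink_block C)) = cut_atom C :|: sink_block C
    & [disjoint cut_atom C & sink_block C]].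
Proof.
move=> /acyclic_partition_cell[h -> kE] /admissible_cell hA U0.
rewrite cut_atom_cell sink_block_cell => Kn.
have ne := atoms_neq0 h U0; have [Ka Kmin] := first_atomP ne.
have fA := merge_arc hA Ka Kn; have hh := merge_contracts hA Ka Kn.
rewrite (contracts_contract A_sym fA hh) cut_atom_cell sink_block_cell; split.
- exact: contracts_contractible hh.
- exact: merge_first_atom.
- by rewrite (contracts_cluster A_sym _ fA hh) merge_r.
rewrite -setI_eq0; apply/eqP/setP=> i; rewrite in_setI in_set0 sink_clusterE //.
by apply/negP=> /andP[/(high_atom hA Ka Kn)]; rewrite ltn_neqAle eq_sym => /andP[/negbTE ->].
Qed.

Lemma facet_partition k C f : acyclic k C -> admissible_partition C ->
  unburnt != set0 -> ~~ (cut_atom C \subset sink_block C) ->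
  contractible C f -> f != (cut_atom C, sink_block C) ->
  cut_atom (contract C f) \subset sink_block (contract C f) ->
  (#|sink_block (contract C f)|
     < #|sink_block (contract C (cut_atom C, sink_block C))|)%N.
Proof.
move=> /acyclic_partition_cell[h -> kE] /admissible_cell hA U0.
rewrite cut_atom_cell sink_block_cell => Kn /(contractible_cell A_sym)[fA [h' hh']] nf.
have ne := atoms_neq0 h U0; have [Ka Kmin] := first_atomP ne.
rewrite (contracts_contract A_sym (merge_arc hA Ka Kn) (merge_contracts hA Ka Kn)).
rewrite (contracts_contract A_sym fA hh') !sink_block_cell cut_atom_cell.
exact: (facet_sink_card hA ne Kn fA hh' nf).
Qed.

Lemma contract_inj k C1 C2 f1 f2 : acyclic k C1 -> acyclic k C2 ->
  contractible C1 f1 -> contractible C2 f2 -> f1 = f2 ->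
  contract C1 f1 = contract C2 f2 -> C1 = C2.
Proof.
move=> aC1 aC2 f1C + ff; rewrite -{}ff => {f2}; move: f1 f1C => f f1 f2 CC.
apply: (dir_inj A_sym aC1 aC2) => i j; have [a|a] := boolP (adj i j); last first.
  have dF C : dir C i j = false by apply: contraNF a => /dir_adj.
  by rewrite !dF.
have [inf|ninf] := boolP (in_edge f i j).
  exact: etrans (contractible_dir A_sym aC1 f1 a inf)
    (esym (contractible_dir A_sym aC2 f2 a inf)).
have e1 := dir_contract A_sym aC1 f1 a; have e2 := dir_contract A_sym aC2 f2 a.
rewrite ninf andbT in e1; rewrite ninf andbT in e2.
exact: etrans (esym e1) (etrans (congr1 (fun C => dir C i j) CC) e2).
Qed.

(** The merged cell remembers everything: its first atom is the set that was merged, the remainder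
    of its sink part is the old sink part, and a contracted arc with known ends can be undone
    because all its descents are known. *)
Lemma merge_partition_inj k C1 C2 : acyclic k C1 -> acyclic k C2 ->
  admissible_partition C1 -> admissible_partition C2 -> unburnt != set0 ->
  ~~ (cut_atom C1 \subset sink_block C1) -> ~~ (cut_atom C2 \subset sink_block C2) ->
  contract C1 (cut_atom C1, sink_block C1) = contract C2 (cut_atom C2, sink_block C2) ->
  C1 = C2.
Proof.
move=> aC1 aC2 A1 A2 U0 n1 n2 CC.
have [f1 k1 s1 d1] := merge_partition aC1 A1 U0 n1.
have [f2 k2 s2 d2] := merge_partition aC2 A2 U0 n2.
have KK : cut_atom C1 = cut_atom C2 by rewrite -k1 CC.
have SS : sink_block C1 = sink_block C2.
  have ss : cut_atom C1 :|: sink_block C1 = cut_atom C2 :|: sink_block C2.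
    exact: etrans (esym s1) (etrans (congr1 sink_block CC) s2).
  rewrite KK in d1 ss; apply/setP=> i.
  have [iK|/negbTE iK] := boolP (i \in cut_atom C2).
    exact: etrans (disjointFr d1 iK) (esym (disjointFr d2 iK)).
  by move/setP: ss => /(_ i); rewrite !in_setU iK !orFb.
exact: (contract_inj aC1 aC2 f1 f2 (f_equal2 pair KK SS) CC).
Qed.

End Matching.

(** * The differential *)

Section Span.
Variables (S : comPzRingType) (M : lmodType S) (X : M -> Prop).

Lemma span0 : span X 0.
Proof.
by exists 0%N, (fun=> 0), (fun=> 0); rewrite big_ord0; split=> // -[].
Qed.

Lemma span_mem v : X v -> span X v.
Proof.
move=> Xv; exists 1%N, (fun=> 1), (fun=> v); split=> //.
by rewrite big_ord1 scale1r.
Qed.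

Lemma spanD u v : span X u -> span X v -> span X (u + v).
Proof.
move=> [N [a [g [Xg ->]]]] [N' [a' [g' [Xg' ->]]]].
exists (N + N')%N, (fun i => match split i with inl j => a j | inr j => a' j end),
  (fun i => match split i with inl j => g j | inr j => g' j end); split.
  by move=> i; case: split.
rewrite big_split_ord /=; congr (_ + _); apply: eq_bigr => i _.
  by rewrite (unsplitK (inl i)).
by rewrite (unsplitK (inr i)).
Qed.

Lemma spanZ b v : span X v -> span X (b *: v).
Proof.
move=> [N [a [g [Xg ->]]]]; exists N, (fun i => b * a i), g; split=> //.
by rewrite scaler_sumr; apply: eq_bigr => i _; rewrite scalerA.
Qed.

Lemma span_sum (I : Type) (r : seq I) (P : pred I) (F : I -> M) :
  (forall i, P i -> span X (F i)) -> span X (\sum_(i <- r | P i) F i).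
Proof. by move=> XF; apply: big_ind => //; [apply: span0 | apply: spanD]. Qed.

End Span.

(** The terms are cancelled in pairs ordered by [enum_rank], rather than by halving the sum, since 2
    may vanish in the coefficients. *)
Lemma sum_antisym (T : finType) (M : zmodType) (P : rel T) (F : T -> T -> M) :
  (forall e f, P e f -> [/\ P f e, e != f & F f e = - F e f]) ->
  \sum_f \sum_(e | P e f) F e f = 0.
Proof.
move=> PF; pose lt (e f : T) := (enum_rank e < enum_rank f)%N.
transitivity (\sum_f \sum_(e | P e f && lt e f) F e f
              + \sum_f \sum_(e | P e f && lt f e) F e f).
  rewrite -big_split; apply: eq_bigr => f _ /=.
  rewrite (bigID (lt^~ f)) /=; congr (_ + _); apply: eq_bigl => e.
  case Pef : (P e f) => //=; have [_ nef _] := PF _ _ Pef.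
  rewrite /lt -leqNgt leq_eqVlt; case: eqP => // /ord_inj/enum_rank_inj fe.
  by rewrite fe eqxx in nef.
rewrite [X in _ + X](exchange_big_dep predT) //= [X in X + _](_ : _ =
   - \sum_e \sum_(f | P e f && lt f e) F e f) ?addNr //.
rewrite -sumrN; apply: eq_bigr => e _; rewrite -sumrN.
rewrite [LHS](eq_bigl (fun f => P e f && lt f e)) => [|f].
  by apply: eq_bigr => f /andP[/PF[_ _]].
by case: (lt f e); rewrite ?andbF // !andbT; apply/idP/idP => /PF[].
Qed.

(** The powers of t picked up in two successive contractions telescope: [w], [w1], [w3] and [w2] are
    the weights of c, of the two intermediate classes and of the common final class, and the [x] are
    the weights of the monomials. *)
Lemma absz_telescope (t1 t2 t3 t4 w w1 w2 w3 x1 x2 x3 x4 : int) :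
  0 <= t1 -> 0 <= t2 -> 0 <= t3 -> 0 <= t4 ->
  t1 = w - (x1 + w1) -> t2 = w1 - (x2 + w2) ->
  t3 = w - (x3 + w3) -> t4 = w3 - (x4 + w2) -> x3 + x4 = x1 + x2 ->
  (`|t1| + `|t2| = `|t3| + `|t4|)%N.
Proof. by lia. Qed.

(** * Square zero, minimality and length *)

Section Complex.
Variables (K : fieldType) (m : nat) (A : 'M[nat]_m.+1).
Hypothesis A_sym : forall i j, A i j = A j i.
Variable sign : {set opart m} -> edge m -> int.
Hypothesis sign_sys : is_sign_system A sign.
Variables (y lambda : 'cV[int]_m.+1).
Hypothesis y_pos : forall i, i != ord_max -> 0 < y i 0.
Hypothesis lambda_y : laplacian_mx A *m lambda = y.
Local Notation S := {poly {mpoly K[m.+1]}}.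
Local Notation classes := (chip_classes A).
Local Notation delta := (@delta m A K lambda sign).
Local Notation delta_basis := (delta_basis A K lambda sign).
Local Notation basis := (Ft_basis A K).
Local Notation t_exp := (t_exponent A lambda).
Implicit Types (e f g : edge m) (c : {set opart m}).

Lemma t_exponentE c f : t_exp c f
  = class_weight A lambda c - wterm A lambda (class_monom A c f) (class_contract A c f).
Proof. by []. Qed.

Local Opaque class_contract class_contractible t_exponent class_monom class_weight
  edge_monom sink_rep edge_contract diamond chip_classes.

Definition delta_coef c f : S :=
  (sign c f)%:~R * 'X^(`|t_exp c f|%N) * ('X_[class_monom A c f])%:P.

Lemma delta_coefE c f : delta_coef c f
  = (sign c f)%:~R * 'X^(`|t_exp c f|%N) * ('X_[class_monom A c f])%:P.
Proof. by []. Qed.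

Lemma delta_basisE k c :
  delta_basis k c
  = \sum_(f | class_contractible c f) delta_coef c f *: basis k (class_contract A c f).
Proof. by []. Qed.

Lemma delta_linear k : linear (@delta k).
Proof.
move=> a u v; rewrite /Defs.delta scaler_sumr -big_split; apply: eq_bigr => c _ /=.
by rewrite !ffunE scalerDl scalerA.
Qed.

Lemma augmentation_linear : linear (@augmentation m A K).
Proof.
move=> a u v; rewrite /augmentation scaler_sumr -big_split; apply: eq_bigr => c _ /=.
by rewrite !ffunE.
Qed.

Lemma Ft_expand k (v : Ft A K k) : v = \sum_c v c *: basis k (val c).
Proof.
apply/ffunP=> c; rewrite sum_ffunE (bigD1 c) //= !ffunE eqxx /= [_ *: _]mulr1.
rewrite big1 ?addr0 // => c' nc; rewrite !ffunE (inj_eq val_inj) eq_sym.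
by rewrite (negbTE nc) [_ *: _]mulr0.
Qed.

Lemma deltaD k : {morph @delta k : u v / u + v}.
Proof. by move=> u v; have := delta_linear 1 u v; rewrite !scale1r. Qed.

Lemma delta0 k : @delta k 0 = 0.
Proof. by rewrite /Defs.delta big1 // => c _; rewrite ffunE scale0r. Qed.

Lemma deltaZ k a v : @delta k (a *: v) = a *: delta v.
Proof. by have := delta_linear a v 0; rewrite addr0 delta0 addr0. Qed.

Lemma deltaN k v : @delta k (- v) = - delta v.
Proof. by rewrite -scaleN1r deltaZ scaleN1r. Qed.

Lemma delta_sum k (I : Type) (r : seq I) (P : pred I) (F : I -> Ft A K k.+1) :
  delta (\sum_(i <- r | P i) F i) = \sum_(i <- r | P i) delta (F i).
Proof. exact: (big_morph _ (@deltaD k) (@delta0 k)). Qed.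

Lemma delta_Ft_basis k c : c \in classes k.+2 ->
  delta (basis k.+1 c) = delta_basis k c.
Proof.
move=> cl; rewrite /Defs.delta (bigD1 (Sub c cl)) //= ffunE eqxx scale1r.
rewrite big1 ?addr0 // => c' nc; rewrite ffunE.
by rewrite -[c]/(val (Sub c cl : Ft_index A k.+1)) (inj_eq val_inj) (negbTE nc) scale0r.
Qed.

Lemma class_contract_class k c f : c \in classes k.+1 -> class_contractible c f ->
  class_contract A c f \in classes k.
Proof. exact: class_contract_in. Qed.

Lemma term_mul (s s' : int) n n' (u u' : 'X_{1..m.+1}) :
  (s%:~R * 'X^n * ('X_[u])%:P) * (s'%:~R * 'X^n' * ('X_[u'])%:P)
  = (s * s')%:~R * 'X^(n + n') * ('X_[(u + u')%MM])%:P :> S.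
Proof. by rewrite intrM exprD mpolyXD polyCM; ring. Qed.

Lemma term_opp (s s' : int) n n' (u u' : 'X_{1..m.+1}) :
  - s = s' -> n = n' -> u = u' ->
  s%:~R * 'X^n * ('X_[u])%:P = - (s'%:~R * 'X^n' * ('X_[u'])%:P) :> S.
Proof. by move=> <- -> ->; rewrite intrN !mulNr opprK. Qed.

Lemma delta_coef_mul c f c' f' :
  delta_coef c f * delta_coef c' f'
  = (sign c f * sign c' f')%:~R * 'X^(`|t_exp c f| + `|t_exp c' f'|)
      * ('X_[(class_monom A c f + class_monom A c' f')%MM])%:P.
Proof. exact: term_mul. Qed.
Local Opaque delta_coef.

Lemma t_exponent_monom k c f : c \in classes k.+1 -> class_contractible c f ->
  t_exp c f = class_weight A lambda c
    - (wdeg lambda (edge_monom A f) + class_weight A lambda (class_contract A c f)).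
Proof. by move=> cl fc; rewrite t_exponentE /wterm (class_monomE A_sym cl fc). Qed.

(** The partner supplied by [diamond_exists] comes with equal final classes and monomials, and
    [diamond_unique] identifies it with the given [e]. The weights then force equal powers of t, and
    the sign rule does the rest. *)
Lemma delta_coef_diamond k c e f : c \in classes k.+2 -> diamond A c e f ->
  class_contract A (class_contract A c f) (edge_contract e f)
    = class_contract A (class_contract A c e) (edge_contract f e) /\
  delta_coef c f * delta_coef (class_contract A c f) (edge_contract e f)
  = - (delta_coef c e * delta_coef (class_contract A c e) (edge_contract f e)).
Proof.
move=> cl def; have [nef ec fc fec efc] := diamond_facts def.
have [e' [de'f e'f cc mm]] := diamond_exists A_sym cl fc efc.
have e'E := diamond_unique A_sym cl de'f def e'f; rewrite {e' de'f e'f}e'E in cc mm.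
split; first exact: esym cc.
have mm' : (class_monom A c e + class_monom A (class_contract A c e) (edge_contract f e)
    = class_monom A c f + class_monom A (class_contract A c f) (edge_contract e f))%MM.
  have clf := class_contract_class cl fc; have cle := class_contract_class cl ec.
  exact: etrans (f_equal2 mnm_add (class_monomE A_sym cl ec) (class_monomE A_sym cle fec))
    (etrans mm (esym (f_equal2 mnm_add (class_monomE A_sym cl fc)
       (class_monomE A_sym clf efc)))).
have clf := class_contract_class cl fc; have cle := class_contract_class cl ec.
have [_ sgn _] := sign_sys cl; have {}sgn := sgn e f nef ec fc fec efc.
have [te _] := t_exponent_ge0 A_sym y_pos lambda_y cl ec.
have [tf _] := t_exponent_ge0 A_sym y_pos lambda_y cl fc.
have [tfe _] := t_exponent_ge0 A_sym y_pos lambda_y cle fec.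
have [tef _] := t_exponent_ge0 A_sym y_pos lambda_y clf efc.
have tE := absz_telescope tf tef te tfe (t_exponent_monom cl fc)
  (t_exponent_monom clf efc) (t_exponent_monom cl ec)
  (etrans (t_exponent_monom cle fec) (congr1 (fun x => _ - (_ + class_weight A lambda x)) cc))
  (etrans (esym (wdegD _ _ _)) (etrans (congr1 (wdeg lambda) mm) (wdegD _ _ _))).
exact: etrans (delta_coef_mul _ _ _ _)
  (etrans (term_opp (esym sgn) tE (esym mm')) (congr1 -%R (esym (delta_coef_mul _ _ _ _)))).
Qed.

Lemma scale_opp (M : lmodType S) (a b : S) (u v : M) :
  a = - b -> u = v -> b *: v = - (a *: u).
Proof. by move=> -> ->; rewrite scaleNr opprK. Qed.

Lemma delta_delta_basis k c : c \in classes k.+3 ->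
  delta (delta_basis k.+1 c) = 0.
Proof.
move=> cl; rewrite delta_basisE delta_sum.
pose F e f : Ft A K k := (delta_coef c f * delta_coef (class_contract A c f) (edge_contract e f))
    *: basis k (class_contract A (class_contract A c f) (edge_contract e f)).
rewrite -[RHS](sum_antisym (T := edge m) (P := diamond A c) (F := F)); last first.
  move=> e f def; have [nef _ _ _ _] := diamond_facts def; split; [exact: diamondC | exact: nef |].
  have [cc co] := delta_coef_diamond cl def.
  exact: scale_opp co (congr1 (basis k) cc).
rewrite big_mkcond; apply: eq_bigr => f _; case: ifP => [fc|nfc]; last first.
  by rewrite big_pred0 // => e; apply/negP=> /diamond_facts[_ _ fc _ _]; rewrite nfc in fc.
have clf := class_contract_class cl fc.
rewrite deltaZ (delta_Ft_basis clf) delta_basisE scaler_sumr.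
(* Existence and uniqueness of diamonds say that each fibre of [e] -> e/f over a contractible edge
   [g] of c/f is a single edge, so the sum over pairs (f, g) becomes a sum over diamonds. *)
rewrite [RHS](partition_big (fun e : edge m => edge_contract e f)
  (class_contractible (class_contract A c f))) /=; last first.
  by move=> e /diamond_facts[].
apply: eq_bigr => g gc.
have [e [def efg _ _]] := diamond_exists A_sym cl fc gc.
rewrite (big_pred1 e) => [|e']; first by rewrite /F efg scalerA.
apply/andP/eqP => [[de'f /eqP e'f]|->]; last by rewrite efg.
by apply: (diamond_unique A_sym cl de'f def); rewrite e'f efg.
Qed.

Lemma delta_delta k (v : Ft A K k.+2) : delta (delta v) = 0.
Proof.
rewrite [X in delta X]/Defs.delta delta_sum big1 // => c _.
by rewrite deltaZ (delta_delta_basis (valP c)) scaler0.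
Qed.

Lemma edge_monom_pos k c f : c \in classes k.+1 -> class_contractible c f ->
  exists i, (0 < edge_monom A f i)%N.
Proof.
move=> cl /realizerP[rc /andP[fr _]].
case: f fr rc => U W fr rc; have ar := classes_acyclic A_sym cl rc.
have [_ _ _ [i [j [iU jW /dir_adj a]]]] := arcs_partsP A_sym ar fr.
exists i; rewrite mnmE iU mul1n (bigD1 j) //=.
by apply: leq_trans a _; apply: leq_addr.
Qed.

Lemma delta_minimal k (w : Ft A K k.+1) :
  ideal_scale (@is_variable m K) (delta w).
Proof.
apply: span_sum => c _; apply: spanZ; apply: span_sum => f fc.
have [i mi] := edge_monom_pos (valP c) fc.
set b := Ft_basis _ _ _ _; apply: span_mem.
exists (delta_coef (val c) f), b; split=> //.
rewrite delta_coefE (class_monomE A_sym (valP c) fc).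
have -> : edge_monom A f = (edge_monom A f - U_(i) + U_(i))%MM.
  by rewrite submK //; apply/mnm_lepP=> j; rewrite mnm1E; case: eqP => [<-|].
rewrite mpolyXD polyCM mulrA; apply: spanZ; apply: span_mem.
by exists i.
Qed.

Lemma Ft_length k : (m < k)%N -> #|Ft_index A k| = 0%N.
Proof.
move=> mk; apply: eq_card0 => -[c cl]; have [C Cc] := classes_neq0 A_sym cl.
have [h CE kE] := acyclic_partition_cell (classes_acyclic A_sym cl Cc).
have : (#|parts C| <= m.+1)%N.
  rewrite CE /= -[X in (_ <= X)%N]card_ord; apply: leq_imset_card.
by rewrite kE ltnNge mk.
Qed.

End Complex.

(** * Exactness in positive degree *)

Lemma shift_difference (t w0 x w1 u : int) :
  t = w0 - (x + w1) -> u + x + w1 = u + w0 - t.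
Proof. by lia. Qed.

Lemma measure_lt_weight (w w1 t : int) (b s s1 : nat) :
  0 <= w -> 0 <= w1 -> w1 = w - t -> 0 <= t -> t != 0 -> (s1 <= b)%N ->
  (absz w1 * b.+1 + s1 < absz w * b.+1 + s)%N.
Proof.
move=> w0 w10 wE t0 tn s1b; have : (absz w1 < absz w)%N by lia.
by nia.
Qed.

Section Exactness.
Variables (K : fieldType) (m : nat) (A : 'M[nat]_m.+1).
Hypothesis A_sym : forall i j, A i j = A j i.
Variable sign : {set opart m} -> edge m -> int.
Hypothesis sign_sys : is_sign_system A sign.
Variables (y lambda : 'cV[int]_m.+1).
Hypothesis y_pos : forall i, i != ord_max -> 0 < y i 0.
Hypothesis lambda_y : laplacian_mx A *m lambda = y.
Hypothesis lambda_pos : forall i, 0 < lambda i 0.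
Local Notation S := {poly {mpoly K[m.+1]}}.
Local Notation classes := (chip_classes A).
Local Notation delta := (@delta m A K lambda sign).
Local Notation basis := (Ft_basis A K).
Local Notation t_exp := (t_exponent A lambda).
Local Notation delta_coef := (delta_coef K A sign lambda).
Implicit Types (e f g : edge m) (c : {set opart m}) (u : 'X_{1..m.+1}).

Local Opaque class_contract class_contractible t_exponent class_monom class_weight
  edge_monom sink_rep edge_contract diamond chip_classes.

Definition coef3 k (v : Ft A K k) (c : Ft_index A k) (a : nat) u : K := ((v c)`_a)@_u.

Lemma coef3D k (v w : Ft A K k) b a u : coef3 (v + w) b a u = coef3 v b a u + coef3 w b a u.
Proof. by rewrite /coef3 ffunE coefD mcoeffD. Qed.

Lemma coef3_sum k (I : Type) (r : seq I) (P : pred I) (F : I -> Ft A K k) b a u :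
  coef3 (\sum_(i <- r | P i) F i) b a u = \sum_(i <- r | P i) coef3 (F i) b a u.
Proof. by rewrite /coef3 sum_ffunE coef_sum (raddf_sum (mcoeff u)). Qed.

Lemma coef3_eq0 k (v : Ft A K k) : (forall b a u, coef3 v b a u = 0) -> v = 0.
Proof.
move=> v0; apply/ffunP=> b; rewrite ffunE; apply/polyP=> a; rewrite coef0.
by apply/mpolyP=> u; rewrite mcoeff0; apply: v0.
Qed.

Definition monomial k u c : Ft A K k := ('X_[u])%:P *: basis k c.

Lemma mulr_rot (p q r : S) : p * q * r = r * p * q.
Proof. by rewrite mulrC mulrA. Qed.

Lemma Ft_expand_monomials k (v : Ft A K k) :
  v = \sum_c \sum_(a < size (v c)) \sum_(u <- msupp (v c)`_a)
        ('X^a * ((v c)`_a@_u)%:MP%:P) *: monomial k u (val c).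
Proof.
rewrite {1}(Ft_expand v); apply: eq_bigr => c _.
rewrite -{1}[v c]coefK poly_def scaler_suml; apply: eq_bigr => a _.
rewrite -mul_polyC {1}[(v c)`_a]mpolyE rmorph_sum mulr_suml scaler_suml.
apply: eq_bigr => u _; rewrite /monomial scalerA -mul_mpolyC rmorphM.
rewrite /=; exact: (congr1 (fun s : S => s *: _) (mulr_rot _ _ _)).
Qed.

(* The total degree of the monomial x ^ u e_c in the strand of the initial
   complex that contains it. *)
Definition total_degree u c : 'X_{1..m.+1} := (u + outdiv A (sink_rep c))%MM.

(* The merging monomials are matched downwards, by contracting the first atom
   into the sink part; the other ones are matched upwards, by splitting it off. *)
Definition merging u c : bool :=
  ~~ (cut_atom A (total_degree u c) (sink_rep c) \subset sink_block (sink_rep c)).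

Definition merging_support k (v : Ft A K k) : Prop :=
  forall b a u, coef3 v b a u != 0 -> merging u (val b).

(** Half of exactness: modulo boundaries only merging monomials remain. The other half is that the
    differential is injective on their span. *)
Definition reducible k (v : Ft A K k) : Prop :=
  exists w, merging_support (v - delta w).

Lemma merging_supportD k (v w : Ft A K k) :
  merging_support v -> merging_support w -> merging_support (v + w).
Proof.
move=> sv sw c a u; rewrite coef3D; have [->|nv] := eqVneq (coef3 v c a u) 0.
  by rewrite add0r; apply: sw.
by move=> _; apply: sv nv.
Qed.

Lemma coef3Xn k n (v : Ft A K k) b a u :
  coef3 ('X^n *: v) b a u = if (a < n)%N then 0 else coef3 v b (a - n) u.
Proof. by rewrite /coef3 ffunE [_ *: _]mulrC coefMXn; case: ifP; rewrite ?mcoeff0. Qed.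

Lemma coef3C k (x : K) (v : Ft A K k) b a u :
  coef3 ((x%:MP)%:P *: v) b a u = x * coef3 v b a u.
Proof.
have E : ((x%:MP)%:P *: v) b = (x%:MP)%:P * v b :> S by rewrite ffunE.
by rewrite /coef3 E coefCM mcoeffCM.
Qed.

Lemma merging_supportZ k n (x : K) (v : Ft A K k) :
  merging_support v -> merging_support (('X^n * (x%:MP)%:P) *: v).
Proof.
move=> sv c a u; rewrite -scalerA coef3Xn coef3C; case: ifP => [_|_]; first by rewrite eqxx.
by rewrite mulf_eq0 negb_or => /andP[_ /sv].
Qed.

Lemma reducible0 k : reducible (0 : Ft A K k).
Proof. by exists 0 => c a u; rewrite delta0 subrr /coef3 ffunE coef0 mcoeff0 eqxx. Qed.

Lemma reducibleD k (v w : Ft A K k) : reducible v -> reducible w -> reducible (v + w).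
Proof.
move=> [v' sv] [w' sw]; exists (v' + w').
rewrite deltaD opprD addrACA; exact: (merging_supportD sv sw).
Qed.

Lemma reducibleZ k n (x : K) (v : Ft A K k) :
  reducible v -> reducible (('X^n * (x%:MP)%:P) *: v).
Proof.
move=> [w sv]; exists (('X^n * (x%:MP)%:P) *: w).
rewrite deltaZ -scalerBr; exact: merging_supportZ.
Qed.

Lemma reducible_sum k (I : eqType) (r : seq I) (P : pred I) (F : I -> Ft A K k) :
  (forall i, P i -> reducible (F i)) -> reducible (\sum_(i <- r | P i) F i).
Proof. by move=> FP; apply: big_ind => //; [apply: reducible0 | apply: reducibleD]. Qed.

Lemma coef3_monomial k u c (c' : Ft_index A k) a u' :
  coef3 (monomial k u c) c' a u' = ((val c' == c) && (a == 0%N) && (u == u'))%:R.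
Proof.
have E : monomial k u c c' = ('X_[u])%:P *+ (val c' == c) :> S.
  rewrite !ffunE; exact: mulr_natr.
rewrite /coef3 E coefMn mcoeffMn coefC.
by case: (val c' == c); case: (a == 0%N); rewrite ?mcoeff0 ?mcoeffX.
Qed.

Lemma merging_reducible k u c : merging u c -> reducible (monomial k u c).
Proof.
move=> muc; exists 0; rewrite delta0 subr0 => c' a u'; rewrite coef3_monomial.
case: (boolP (_ && _ && _)) => [/andP[/andP[/eqP -> _] /eqP <-] _|_ /eqP nz].
  exact: muc.
by case: nz.
Qed.

Lemma sign_unit k c f : c \in classes k -> class_contractible c f ->
  sign c f = 1 \/ sign c f = -1.
Proof. by move=> cl fc; have [s _ _] := sign_sys cl; apply: s. Qed.

Lemma sink_rep_class k c : c \in classes k -> c = chip_class A (sink_rep c).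
Proof.
move=> cl; have [rc _] := sink_repP A_sym y_pos lambda_y cl.
exact: (classes_eq A_sym cl rc).
Qed.

Lemma n_acyclic_class k C : acyclic_partition A k C -> n_acyclic C ->
  chip_class A C \in classes k /\ sink_rep (chip_class A C) = C.
Proof.
move=> aC nC; have cl := chip_class_in aC; split=> //.
exact: (sink_rep_eq A_sym y_pos lambda_y cl (mem_chip_class A_sym aC) nC).
Qed.

Lemma sink_rep_admissible k u c : c \in classes k ->
  admissible_partition A (total_degree u c) (sink_rep c).
Proof.
move=> cl; have [_ nc] := sink_repP A_sym y_pos lambda_y cl; split=> // i.
by rewrite mnmDE leq_addl.
Qed.

Lemma unburnt_neq0 k u c : c \in classes k.+2 -> unburnt A (total_degree u c) != set0.
Proof.
move=> cl; apply/eqP=> U0; have [rc _] := sink_repP A_sym y_pos lambda_y cl.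
have ac := classes_acyclic A_sym cl rc.
by have := superstable_trivial A_sym ac (sink_rep_admissible u cl) U0.
Qed.

Lemma delta_coef_monom k c f : c \in classes k.+1 -> class_contractible c f ->
  delta_coef c f
  = (sign c f)%:~R * 'X^(`|t_exp c f|%N) * ('X_[edge_monom A f])%:P.
Proof. by move=> cl fc; rewrite delta_coefE (class_monomE A_sym cl fc). Qed.

Lemma mnm_addAC u v w : (u + v + w)%MM = (u + w + v)%MM :> 'X_{1..m.+1}.
Proof. by rewrite -!addmA (addmC v). Qed.

Lemma term_shift (s : int) n u u' :
  ('X_[u])%:P * (s%:~R * 'X^n * ('X_[u'])%:P)
  = s%:~R * 'X^n * ('X_[(u + u')%MM])%:P :> S.
Proof. by rewrite mpolyXD polyCM; ring. Qed.

Lemma delta_monomial k u c : c \in classes k.+2 ->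
  delta (monomial k.+1 u c) = \sum_(f | class_contractible c f)
    ((sign c f)%:~R * 'X^(`|t_exp c f|%N)) *:
      monomial k (u + edge_monom A f)%MM (class_contract A c f).
Proof.
move=> cl; rewrite /monomial deltaZ delta_Ft_basis // delta_basisE scaler_sumr.
apply: eq_bigr => f fc; rewrite !scalerA; congr (_ *: _).
exact: (etrans (congr1 ( *%R _) (delta_coef_monom cl fc)) (term_shift _ _ _ _)).
Qed.

Lemma scale_sign k (s : int) n (v : Ft A K k) :
  (s%:~R * 'X^n) *: v = ('X^n * ((s%:~R : K)%:MP)%:P) *: v.
Proof. by rewrite mulrC !rmorph_int. Qed.

(** The lexicographic order on weight and size of the sink part; the base m + 2 exceeds every such
    size. *)
Definition weight_measure u c : nat :=
  (absz (wdeg lambda u + class_weight A lambda c)%R * m.+2 + #|sink_block (sink_rep c)|)%N.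

Lemma class_weight_ge0 c : 0 <= class_weight A lambda c.
Proof. exact: wdeg_ge0. Qed.

(** A monomial that is not merging is, up to sign, the matched term in the boundary of the monomial
    of equal total degree obtained by splitting, and it carries no t. Every other term of that
    boundary is merging or smaller: a positive power of t lowers the weight, and a term without t
    has the same weight and a smaller sink part by [facet_partition]. *)
Lemma monomial_reducible k u c : c \in classes k.+2 -> reducible (monomial k.+1 u c).
Proof.
have [n] := ubnP (weight_measure u c); elim: n u c => // n IH u c; rewrite ltnS => ltn cl.
have [mu|] := boolP (merging u c); first exact: merging_reducible.
rewrite /merging negbK => sub; have U0 := unburnt_neq0 u cl.
have [rc nr] := sink_repP A_sym y_pos lambda_y cl.
have ar := classes_acyclic A_sym cl rc.
have adm := sink_rep_admissible u cl.
set D := total_degree u c in sub U0 adm.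
have [C [aC admC mC fC CE]] := split_partition A_sym ar adm U0 sub.
set f0 := (cut_atom A D C, sink_block C) in fC CE.
have [cl' rE] := n_acyclic_class aC admC.1.
move: (chip_class A C) cl' rE => c' cl' rE.
have [r'c _] := sink_repP A_sym y_pos lambda_y cl'.
have Cc' : C \in c' by rewrite -rE.
have f0c := class_contractibleI Cc' fC.
have cE : class_contract A c' f0 = c.
  by rewrite (class_contract_eq A_sym cl' Cc' fC) CE -(sink_rep_class cl).
have le1 : (outdiv A C <= D)%MM by apply/mnm_lepP; exact: admC.2.
set u' := (D - outdiv A C)%MM.
have u'D : (u' + outdiv A C)%MM = D by rewrite submK.
have uE : u = (u' + edge_monom A f0)%MM.
  apply: (@addIm _ (outdiv A (sink_rep c))); rewrite -/(total_degree u c) -/D -u'D.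
  by rewrite (outdiv_contract A_sym aC fC) CE addmA mnm_addAC.
have wE f : class_contractible c' f ->
    wdeg lambda (u' + edge_monom A f)%MM + class_weight A lambda (class_contract A c' f)
    = wdeg lambda u' + class_weight A lambda c' - t_exp c' f.
  move=> fc; rewrite wdegD.
  exact: (shift_difference _ (t_exponent_monom A_sym lambda cl' fc)).
have [_ t0] := t_exponent_ge0 A_sym y_pos lambda_y cl' f0c.
have t00 : t_exp c' f0 = 0 by apply/t0; rewrite rE.
have [w [s [sE wred]]] : exists w s, (s = 1 \/ s = -1 :> int) /\
    s%:~R *: monomial k.+1 u c = delta (monomial k.+2 u' c') - w /\ reducible w.
  exists (\sum_(f | class_contractible c' f && (f != f0))
    ((sign c' f)%:~R * 'X^(`|t_exp c' f|%N)) *: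
      monomial k.+1 (u' + edge_monom A f)%MM (class_contract A c' f)), (sign c' f0).
  split; first exact: sign_unit cl' f0c.
  split.
    rewrite delta_monomial // (bigD1 f0) //= -addrA subrr addr0.
    by rewrite t00 mulr1 cE -uE.
  apply: reducible_sum => f /andP[fc nf]; rewrite scale_sign; apply: reducibleZ.
  have clf := class_contract_in A_sym cl' fc.
  set u1 := (u' + _)%MM; set c1 := class_contract A c' f.
  have [mu1|] := boolP (merging u1 c1); first exact: merging_reducible.
  rewrite /merging negbK => sub1; apply: IH => //.
  apply: leq_trans ltn.
  have [t_ge t_0] := t_exponent_ge0 A_sym y_pos lambda_y cl' fc.
  have w1 := wE f fc; have w0 := wE f0 f0c; rewrite t00 cE -uE in w0.
  rewrite -/u1 -/c1 in w1 sub1 *.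
  have wu := addr_ge0 (wdeg_ge0 lambda_pos u) (class_weight_ge0 c).
  have wu1 := addr_ge0 (wdeg_ge0 lambda_pos u1) (class_weight_ge0 c1).
  have card1 : (#|sink_block (sink_rep c1)| <= m.+1)%N.
    by rewrite -[X in (_ <= X)%N]card_ord max_card.
  have {}w1 : wdeg lambda u1 + class_weight A lambda c1
      = wdeg lambda u + class_weight A lambda c - t_exp c' f.
    by rewrite w1 w0 subr0.
  rewrite /weight_measure; have [te|tn] := eqVneq (t_exp c' f) 0; last first.
    exact: (measure_lt_weight _ wu wu1 w1 t_ge tn card1).
  have fC' : contractible C f by rewrite -rE; apply/t_0.
  have r1E : sink_rep c1 = contract C f.
    exact: (etrans (sink_rep_contract A_sym y_pos lambda_y cl'
      (eq_ind_r (fun X => contractible X f) fC' rE)) (congr1 (fun X => contract X f) rE)).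
  have d1 : total_degree u1 c1 = D.
    by rewrite /total_degree r1E /u1 mnm_addAC -u'D (outdiv_contract A_sym aC fC') addmA.
  rewrite d1 r1E in sub1.
  have := facet_partition A_sym aC admC U0 mC fC' nf sub1.
  rewrite -/f0 CE -r1E => lt1; rewrite te subr0 in w1; rewrite w1 ltn_add2l.
  exact: lt1.
have {wred} [mE [w' sw']] := wred.
have -> : monomial k.+1 u c = ('X^0 * ((s%:~R : K)%:MP)%:P) *: (s%:~R *: monomial k.+1 u c).
  rewrite scalerA mul1r !rmorph_int -intrM.
  by case: sE => ->; rewrite ?mulr1 ?mulrNN ?mulr1 scale1r.
apply: reducibleZ; rewrite mE; apply: reducibleD; last first.
  by rewrite -scaleN1r -[-1]mul1r -polyCN -mpolyCN; apply: (@reducibleZ _ 0); exists w'.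
exists (monomial k.+2 u' c') => c0 a0 u0.
by rewrite subrr /coef3 ffunE coef0 mcoeff0 eqxx.
Qed.

Lemma all_reducible k (v : Ft A K k.+1) : reducible v.
Proof.
rewrite (Ft_expand_monomials v); apply: reducible_sum => c _.
apply: reducible_sum => a _; apply: reducible_sum => u _.
by apply/reducibleZ/monomial_reducible/(valP c).
Qed.

End Exactness.

Lemma absz_subn_eq0 (t : int) (a : nat) :
  0 <= t -> (absz t <= a)%N -> (a <= a - absz t)%N -> t = 0.
Proof. by lia. Qed.

Lemma sum2_unique (I J : finType) (M : nmodType) (P : I -> pred J) (F : I -> J -> M) i0 j0 :
  P i0 j0 -> (forall i j, P i j -> F i j != 0 -> i = i0 /\ j = j0) ->
  \sum_i \sum_(j | P i j) F i j = F i0 j0.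
Proof.
move=> P0 PF; rewrite (bigD1 i0) //= (bigD1 j0) //= big1 => [|j /andP[Pj nj]]; last first.
  by apply: contraNeq nj => /(PF _ _ Pj)[_ ->].
rewrite big1 ?addr0 // => i ni; rewrite big1 // => j Pj.
by apply: contraNeq ni => /(PF _ _ Pj)[->].
Qed.

(** * Injectivity on merging monomials *)

Section Kernel.
Variables (K : fieldType) (m : nat) (A : 'M[nat]_m.+1).
Hypothesis A_sym : forall i j, A i j = A j i.
Variable sign : {set opart m} -> edge m -> int.
Hypothesis sign_sys : is_sign_system A sign.
Variables (y lambda : 'cV[int]_m.+1).
Hypothesis y_pos : forall i, i != ord_max -> 0 < y i 0.
Hypothesis lambda_y : laplacian_mx A *m lambda = y.
Hypothesis lambda_pos : forall i, 0 < lambda i 0.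
Local Notation S := {poly {mpoly K[m.+1]}}.
Local Notation classes := (chip_classes A).
Local Notation delta := (@delta m A K lambda sign).
Local Notation t_exp := (t_exponent A lambda).
Local Notation delta_coef := (delta_coef K A sign lambda).
Implicit Types (e f g : edge m) (c : {set opart m}) (u : 'X_{1..m.+1}).

Local Opaque class_contract class_contractible t_exponent class_monom class_weight
  edge_monom sink_rep edge_contract diamond chip_classes.

Local Notation total_degree := (total_degree A).
Local Notation merging := (merging A).

Definition merge_edge u c : edge m :=
  (cut_atom A (total_degree u c) (sink_rep c), sink_block (sink_rep c)).

Definition merge_rank u c : nat :=
  #|sink_block (contract (sink_rep c) (merge_edge u c))|.

Lemma merging_facts k u c : c \in classes k.+2 -> merging u c ->
  [/\ contractible (sink_rep c) (merge_edge u c),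
    cut_atom A (total_degree u c) (contract (sink_rep c) (merge_edge u c))
      = cut_atom A (total_degree u c) (sink_rep c)
    & cut_atom A (total_degree u c) (sink_rep c)
        \subset sink_block (contract (sink_rep c) (merge_edge u c))].
Proof.
move=> cl mu; have [rc _] := sink_repP A_sym y_pos lambda_y cl.
have ar := classes_acyclic A_sym cl rc.
have [fC cE sE _] := merge_partition A_sym ar
  (sink_rep_admissible A_sym y_pos lambda_y u cl)
  (unburnt_neq0 A_sym y_pos lambda_y u cl) mu.
split; [exact: fC | exact: cE | rewrite sE; exact: subsetUl].
Qed.

Lemma total_degree_contract k u c f : c \in classes k.+1 ->
  contractible (sink_rep c) f ->
  total_degree u c = (u + edge_monom A f + outdiv A (contract (sink_rep c) f))%MM.
Proof.
move=> cl fC; have [rc _] := sink_repP A_sym y_pos lambda_y cl.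
have ar := classes_acyclic A_sym cl rc.
rewrite -[LHS]/(u + outdiv A (sink_rep c))%MM (outdiv_contract A_sym ar fC).
by rewrite -!addmA (addmC (outdiv _ _)).
Qed.

(** The two monomials share a face and hence the total degree. If [f] were not the matched edge of
    the first one, [facet_partition] would make the sink part of the common face smaller than
    [merge_rank u c], against the assumed inequality. Otherwise both are matched to the same face,
    and the matching is injective. *)
Lemma facet_unique k c c0 u u0 f : c \in classes k.+2 -> c0 \in classes k.+2 ->
  merging u c -> merging u0 c0 -> contractible (sink_rep c) f ->
  class_contract A c f = class_contract A c0 (merge_edge u0 c0) ->
  (u + edge_monom A f = u0 + edge_monom A (merge_edge u0 c0))%MM ->
  (merge_rank u c <= merge_rank u0 c0)%N ->
  c = c0 /\ f = merge_edge u0 c0.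
Proof.
move=> cl cl0 mu mu0 fC cc uu rk.
have [fM kM sM] := merging_facts cl mu; have [fM0 kM0 sM0] := merging_facts cl0 mu0.
have [rc nc] := sink_repP A_sym y_pos lambda_y cl.
have [rc0 nc0] := sink_repP A_sym y_pos lambda_y cl0.
have ar := classes_acyclic A_sym cl rc; have ar0 := classes_acyclic A_sym cl0 rc0.
have CC : contract (sink_rep c) f = contract (sink_rep c0) (merge_edge u0 c0).
  exact: (etrans (esym (sink_rep_contract A_sym y_pos lambda_y cl fC))
    (etrans (congr1 (@sink_rep m) cc) (sink_rep_contract A_sym y_pos lambda_y cl0 fM0))).
have DD : total_degree u c = total_degree u0 c0.
  exact: (etrans (total_degree_contract u cl fC)
    (etrans (f_equal2 mnm_add uu (congr1 (outdiv A) CC))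
      (esym (total_degree_contract u0 cl0 fM0)))).
have adm := sink_rep_admissible A_sym y_pos lambda_y u cl.
have adm0 := sink_rep_admissible A_sym y_pos lambda_y u0 cl0.
have U0 := unburnt_neq0 A_sym y_pos lambda_y u cl.
have [fE|nf] := boolP (f == merge_edge u c); last first.
  have sub : cut_atom A (total_degree u c) (contract (sink_rep c) f)
      \subset sink_block (contract (sink_rep c) f).
    by rewrite DD CC kM0.
  have := facet_partition A_sym ar adm U0 mu fC nf sub.
  by rewrite CC ltnNge rk.
have {}fE := eqP fE; rewrite fE in CC *; rewrite -DD in adm0.
have mu0' : ~~ (cut_atom A (total_degree u c) (sink_rep c0) \subset sink_block (sink_rep c0)).
  by rewrite DD.
have CC' : contract (sink_rep c) (cut_atom A (total_degree u c) (sink_rep c), sink_block (sink_rep c))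
    = contract (sink_rep c0) (cut_atom A (total_degree u c) (sink_rep c0), sink_block (sink_rep c0)).
  by rewrite [in RHS]DD.
have SS := merge_partition_inj A_sym ar ar0 adm adm0 U0 mu mu0' CC'.
split; last by rewrite /merge_edge DD SS.
exact: (etrans (sink_rep_class A_sym y_pos lambda_y cl)
  (etrans (congr1 (chip_class A) SS) (esym (sink_rep_class A_sym y_pos lambda_y cl0)))).
Qed.

Lemma coef_term (p : S) (s : int) t (e : 'X_{1..m.+1}) a u :
  ((p * (s%:~R * 'X^t * ('X_[e])%:P))`_a)@_u
  = if (a < t)%N then 0 else s%:~R * (p`_(a - t) * 'X_[e])@_u.
Proof.
have -> : p * (s%:~R * 'X^t * ('X_[e])%:P)
    = ((s%:~R : K)%:MP)%:P * (p * ('X_[e])%:P) * 'X^t.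
  by rewrite !rmorph_int; ring.
rewrite coefMXn; case: ifP => _; first by rewrite mcoeff0.
by rewrite coefCM mcoeffCM coefMC.
Qed.

Lemma mcoeffMX_neq0 (p : {mpoly K[m.+1]}) (e u : 'X_{1..m.+1}) : (p * 'X_[e])@_u != 0 ->
  exists2 u1, u = (u1 + e)%MM & p@_u1 != 0.
Proof.
rewrite -mcoeff_msupp (perm_mem (msuppMX _ _)) => /mapP[u1 pu1 ->].
by exists u1; rewrite -?mcoeff_msupp 1?addmC.
Qed.

Lemma coef3_delta k (v : Ft A K k.+1) b a u :
  coef3 (delta v) b a u = \sum_c \sum_(f | class_contractible (val c) f)
    if class_contract A (val c) f == val b
    then ((v c * delta_coef (val c) f)`_a)@_u else 0.
Proof.
rewrite /Defs.delta coef3_sum; apply: eq_bigr => c _.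
rewrite delta_basisE scaler_sumr coef3_sum; apply: eq_bigr => f fc.
rewrite scalerA /coef3 !ffunE eq_sym; case: eqP => _.
  by rewrite [_ *: _]mulr1.
by rewrite [_ *: _]mulr0 coef0 mcoeff0.
Qed.

(** Take a term of [v] with least power of t and, among those, largest [merge_rank]. Its matched
    face receives no other contribution in [delta v], and this one has coefficient 1 or -1. *)
Lemma merging_support_inj k (v : Ft A K k.+1) :
  merging_support v -> delta v = 0 -> v = 0.
Proof.
move=> sv dv; apply: coef3_eq0 => b1 a1 u1; apply/eqP/negPn/negP=> nz1.
have ex_a : exists a, `[< exists b u, coef3 v b a u != 0 >].
  by exists a1; apply/asboolP; exists b1, u1.
have [a /asboolP[b2 [u2 nz2]] amin] := ex_minnP ex_a; clear b1 a1 u1 nz1 ex_a.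
have ex_r : exists r, `[< exists b u, coef3 v b a u != 0 /\ merge_rank u (val b) = r >].
  by exists (merge_rank u2 (val b2)); apply/asboolP; exists b2, u2.
have r_le r : `[< exists b u, coef3 v b a u != 0 /\ merge_rank u (val b) = r >] -> (r <= m.+1)%N.
  by move=> /asboolP[b [u [_ <-]]]; rewrite -[X in (_ <= X)%N]card_ord max_card.
have [r /asboolP[b0 [u0 [nz0 r0E]]] rmax] := ex_maxnP ex_r r_le; clear b2 u2 nz2 ex_r r_le.
subst r; have cl0 := valP b0; have mu0 := sv _ _ _ nz0.
have [fM0 _ _] := merging_facts cl0 mu0.
have [rc0 _] := sink_repP A_sym y_pos lambda_y cl0.
set f0 := merge_edge u0 (val b0) in fM0.
have f0c := class_contractibleI rc0 fM0.
have cl' := class_contract_in A_sym cl0 f0c.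
pose b' : Ft_index A k := Sub (class_contract A (val b0) f0) cl'.
have b'E : val b' = class_contract A (val b0) f0 := SubK _ _.
have key b f : class_contractible (val b) f ->
    class_contract A (val b) f == class_contract A (val b0) f0 ->
    ((v b * delta_coef (val b) f)`_a)@_(u0 + edge_monom A f0) != 0 ->
    b = b0 /\ f = f0.
  move=> fc /eqP cc; have cl := valP b.
  rewrite (delta_coef_monom K A_sym sign lambda cl fc) coef_term.
  case: ltnP => [_|ta]; first by rewrite eqxx.
  rewrite mulf_eq0 negb_or => /andP[_ /mcoeffMX_neq0[u uE nzu]].
  (* The contributing coefficient of [v] stands at the power of t lowered by [t_exp], so minimality
     of [a] leaves only contractions free of t. *)
  have aE : (a <= a - absz (t_exp (val b) f))%N.
    by apply: amin; apply/asboolP; exists b, u; exact: nzu.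
  have [t_ge t_0] := t_exponent_ge0 A_sym y_pos lambda_y cl fc.
  have t0 : t_exp (val b) f = 0 := absz_subn_eq0 t_ge ta aE.
  have fC := t_0.1 t0; rewrite t0 subn0 in nzu.
  have mu : merging u (val b) := sv b a u nzu.
  have rk : (merge_rank u (val b) <= merge_rank u0 (val b0))%N.
    by apply: rmax; apply/asboolP; exists b, u; exact: (conj nzu erefl).
  have [bE fE] := facet_unique cl cl0 mu mu0 fC cc (esym uE) rk.
  split; [exact: val_inj bE | exact: fE].
have E0 : coef3 (delta v) b' a (u0 + edge_monom A f0)%MM = 0.
  by rewrite dv /coef3 ffunE coef0 mcoeff0.
have := etrans (esym E0) (coef3_delta v b' a (u0 + edge_monom A f0)%MM).
rewrite (sum2_unique (i0 := b0) (j0 := f0) f0c) => [|b f fc]; last first.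
  by rewrite b'E; case: ifP => [cc nz|_ /eqP //]; exact: (key _ _ fc cc nz).
rewrite b'E eqxx (delta_coef_monom K A_sym sign lambda cl0 f0c) coef_term.
have [_ t_0] := t_exponent_ge0 A_sym y_pos lambda_y cl0 f0c.
rewrite (t_0.2 fM0) subn0 ltn0 addmC mcoeffMX.
case: (sign_unit sign_sys cl0 f0c) => ->; rewrite ?mulN1r ?mul1r => /esym/eqP; rewrite ?oppr_eq0.
  exact/negP.
exact/negP.
Qed.

Lemma delta_exact k (v : Ft A K k.+1) : delta v = 0 <-> exists w, delta w = v.
Proof.
split=> [dv|[w <-]]; last exact: (delta_delta A_sym sign_sys y_pos lambda_y).
have [w sw] := all_reducible A_sym sign_sys y_pos lambda_y lambda_pos v.
exists w; apply/esym/eqP; rewrite -subr_eq0; apply/eqP.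
apply: merging_support_inj sw _.
by rewrite deltaD deltaN dv (delta_delta A_sym sign_sys y_pos lambda_y) subr0.
Qed.

End Kernel.

(** * Degree zero *)

Section TwoParts.
Variables (K : fieldType) (m : nat) (A : 'M[nat]_m.+1).
Hypothesis A_sym : forall i j, A i j = A j i.
Hypothesis A_conn : induces_connected (fun i j => A i j) [set: 'I_m.+1].
Variable sign : {set opart m} -> edge m -> int.
Hypothesis sign_sys : is_sign_system A sign.
Variables (y lambda : 'cV[int]_m.+1).
Hypothesis y_pos : forall i, i != ord_max -> 0 < y i 0.
Hypothesis lambda_y : laplacian_mx A *m lambda = y.
Hypothesis lambda_pos : forall i, 0 < lambda i 0.
Local Notation V := 'I_m.+1.
Local Notation classes := (chip_classes A).
Local Notation adj := (adj A).
Local Notation cell := (cell A).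
Local Notation cluster := (cluster A).
Local Notation acyclic := (acyclic_partition A).
Local Notation lin_eq u v := (lin_equiv (fun i j => A i j)
  (fun i : V => (u i)%:Z) (fun i : V => (v i)%:Z)).
Implicit Types (e f g : edge m) (c : {set opart m}) (u v w : 'X_{1..m.+1}).

Definition trivial_partition : opart m := cell (fun=> 0%N).

Lemma cluster_const i : cluster (fun=> 0%N) i = [set: V].
Proof.
apply/setP=> j; rewrite !inE.
have /'forall_implyP/(_ i (in_setT i))/'forall_implyP/(_ j (in_setT j)) := A_conn.
by apply: connect_sub => u v /= /and3P[_ _ a]; apply: connect1; rewrite levelE (a : adj u v).
Qed.

Lemma trivial_acyclic : acyclic 1 trivial_partition.
Proof.
apply: (acyclic_cell A_sym); rewrite -(cards1 [set: V]); congr #|pred_of_set _|.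
apply/setP=> X; rewrite in_set1; apply/imsetP/eqP => [[i _ ->]|->].
  exact: cluster_const.
by exists ord_max; rewrite ?cluster_const.
Qed.

Lemma acyclic1 C : acyclic 1 C -> C = trivial_partition.
Proof.
move=> /acyclic_partition_cell[h -> /eqP/cards1P[X PX]].
have cE i : cluster h i = X by apply/set1P; rewrite -PX; apply: cluster_in_parts.
apply: (same_dir_cell A_sym) => i j _; rewrite ltnn.
by rewrite (@cluster_height _ A h i j) ?ltnn // cE -(cE j) mem_cluster.
Qed.

Lemma trivial_n_acyclic : n_acyclic trivial_partition.
Proof.
apply/(n_acyclicP A_sym) => i; apply: level_descent.
by have := in_setT (ord_max : V); rewrite -(cluster_const i) inE.
Qed.

Lemma outdiv_trivial : outdiv A trivial_partition = 0%MM.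
Proof.
by apply/mnmP=> i; rewrite (outdiv_cell A_sym) mnm0E big_pred0.
Qed.

Definition trivial_class : {set opart m} := chip_class A trivial_partition.

Lemma trivial_class_in : trivial_class \in classes 1.
Proof. exact: chip_class_in trivial_acyclic. Qed.

Lemma classes1 c : c \in classes 1 -> c = trivial_class.
Proof.
move=> cl; have [C Cc] := classes_neq0 A_sym cl.
by rewrite (classes_eq A_sym cl Cc) (acyclic1 (classes_acyclic A_sym cl Cc)).
Qed.

Lemma sink_rep_trivial : sink_rep trivial_class = trivial_partition.
Proof.
exact: (n_acyclic_class A_sym y_pos lambda_y trivial_acyclic trivial_n_acyclic).2.
Qed.

Lemma class_weight_trivial : class_weight A lambda trivial_class = 0.
Proof.
rewrite /class_weight -/(sink_rep trivial_class) sink_rep_trivial outdiv_trivial.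
by rewrite /wdeg big1 // => i _; rewrite mnm0E mulr0.
Qed.

Lemma lin_equivP u v :
  lin_eq u v <-> exists z : V -> int, forall i,
    (u i)%:Z - (v i)%:Z = \sum_j (z i - z j) * (A i j)%:Z.
Proof.
have lapE (z : V -> int) i : \sum_j z j * laplacian (fun i j => A i j) j i
    = \sum_j (z i - z j) * (A i j)%:Z.
  under [LHS]eq_bigr => j _ do rewrite /laplacian mulrBr.
  under [RHS]eq_bigr => j _ do rewrite mulrBl.
  rewrite !sumrB -mulr_sumr -Posz_sum; congr (_ - _).
    rewrite (bigD1 i) //= eqxx [X in _ + X]big1 ?addr0 // => j /negbTE ->.
    by rewrite mulr0.
  by apply: eq_bigr => j _; rewrite A_sym.
by split=> -[z zE]; exists z => i; rewrite zE lapE.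
Qed.

Lemma lin_eq_sym u v : lin_eq u v -> lin_eq v u.
Proof.
move=> /(proj1 (lin_equivP _ _))[z zE]; apply: (proj2 (lin_equivP _ _)); exists (fun i => - z i) => i.
rewrite -[LHS]opprB zE -sumrN; apply: eq_bigr => j _; ring.
Qed.

Lemma lin_eq_trans u v w : lin_eq u v -> lin_eq v w -> lin_eq u w.
Proof.
move=> /(proj1 (lin_equivP _ _))[z zE] /(proj1 (lin_equivP _ _))[z' zE'].
apply: (proj2 (lin_equivP _ _)).
exists (fun i => z i + z' i) => i.
rewrite -(subrK (v i)%:Z (u i)%:Z) -addrA zE zE' -big_split; apply: eq_bigr => j _ /=; ring.
Qed.

Lemma lin_eq_refl u : lin_eq u u.
Proof.
apply: (proj2 (lin_equivP _ _)); exists (fun=> 0) => i; by rewrite subrr big1.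
Qed.

Lemma lin_eq_add u v w : lin_eq u v -> lin_eq (w + u)%MM (w + v)%MM.
Proof.
move=> /(proj1 (lin_equivP _ _))[z zE]; apply: (proj2 (lin_equivP _ _)); exists z => i.
by rewrite -zE !mnmDE !PoszD; ring.
Qed.

(** Two parts are joined by a single edge of G_Pi, and firing the upper part reverses it, so both
    orientations lie in the same class. Each contracts to the one-part partition, whose D is 0, so
    the two edge monomials are the two divisors and thus linearly equivalent. *)
Lemma two_part_edges c : c \in classes 2 -> exists f1 f2 : edge m,
  [/\ f1 != f2, class_contractible c f1, class_contractible c f2,
      forall f, class_contractible c f -> f = f1 \/ f = f2
    & [/\ contractible (sink_rep c) f1, ~~ contractible (sink_rep c) f2,
          f2 = (f1.2, f1.1)
        & lin_eq (edge_monom A f1) (edge_monom A f2)]].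
Proof.
move=> cl; have [rc nr] := sink_repP A_sym y_pos lambda_y cl.
have ar := classes_acyclic A_sym cl rc.
have [h hE kE] := acyclic_partition_cell ar.
rewrite hE in nr; have con := n_acyclicP A_sym h nr; clear nr; rewrite hE in kE.
have [i0 hi0] : exists i, h i != h ord_max.
  apply/not_existsP => hc; have hconst i : h i = h ord_max.
    by apply/eqP/negPn/negP => /hc.
  have c1 : cell h = trivial_partition.
    by apply: (same_dir_cell A_sym) => i j _; rewrite (hconst i) (hconst j) !ltnn.
  have /and3P[/and3P[_ /eqP k1 _] _ _] := trivial_acyclic.
  by rewrite c1 k1 in kE.
have [u [v [a huv]]] : exists u v : V, adj u v /\ (h v < h u)%N.
  apply/not_existsP => none; case/eqP: hi0.
  apply: (connect_preserved (P := fun j => h i0 = h j) _ (con i0)) => // j j' ->.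
  rewrite descentE leq_eqVlt => /andP[a /orP[/eqP -> //|huv]].
  by case: (none j); exists j'.
have nuv : cluster h u != cluster h v.
  apply: contraTneq huv => cuv; rewrite -leqNgt (@cluster_height _ A h v u) //.
  by rewrite -cuv mem_cluster.
have P2 : parts (cell h) = [set cluster h u; cluster h v].
  apply/esym/eqP; rewrite eqEcard kE cards2 nuv subUset !sub1set.
  by rewrite !cluster_in_parts.
have cE i : cluster h i = cluster h u \/ cluster h i = cluster h v.
  by apply/set2P; rewrite -P2 cluster_in_parts.
pose f1 := (cluster h u, cluster h v); pose f2 := (cluster h v, cluster h u).
have f1A : f1 \in arcs (cell h) by apply/arcs_cellP; exists u, v.
have hcE i : h i = (if cluster h i == cluster h u then h u else h v).
  case: eqP => [/(cluster_eqP A_sym)/cluster_height //|ne].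
  by case: (cE i) => // /(cluster_eqP A_sym)/cluster_height.
(* The reversed orientation: the part of [v], which was the lower one, is now on top. *)
pose h2 i : nat := (i \in cluster h v).
have memE i j : (i \in cluster h j) = (cluster h i == cluster h j).
  apply/idP/eqP => [/(cluster_eq A_sym) //|<-]; exact: mem_cluster.
have zC : gradient A (cell h) (cell h2) (fun i => (i \in cluster h u)%:Z).
  move=> i j aij; rewrite !(dir_cell A_sym) aij /= /h2 (hcE i) (hcE j) !memE.
  have vu : (cluster h v == cluster h u) = false by rewrite eq_sym (negbTE nuv).
  by case: (cE i) => ->; case: (cE j) => ->;
    rewrite ?eqxx ?(negbTE nuv) ?vu ?ltnn ?huv // ltnNge (ltnW huv).
have ac : acyclic 2 (cell h) by rewrite -hE.
have pp := gradient_parts A_sym ac (cell_acyclic A_sym h2) zC.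
have ac2 : acyclic 2 (cell h2) by apply: (acyclic_cell A_sym); rewrite -pp kE.
have cE2 i : cluster h2 i = cluster h i by rewrite -!(pblock_cell A_sym) pp.
have hc : cell h \in c by rewrite -hE.
have h2c : cell h2 \in c.
  rewrite (classes_eq A_sym cl hc); apply/(chip_classP A_sym _ ac).
  by split=> //; exists (fun i => (i \in cluster h u)%:Z).
have f1C : contractible (cell h) f1.
  apply: (contracts_contractible A_sym (h' := fun=> 0%N) f1A) => i j aij.
  rewrite ltnn /in_edge /f1 /= !memE (hcE i) (hcE j).
  by case: (cE i) => ->; case: (cE j) => ->;
    rewrite ?eqxx ?(negbTE nuv) ?ltnn ?andbF // eq_sym (negbTE nuv) /= ltnNge (ltnW huv).
have f2A : f2 \in arcs (cell h2).
  apply/arcs_cellP; exists v, u; rewrite !cE2 adjC // a; split=> //.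
  by rewrite /h2 mem_cluster memE (negbTE nuv).
have f2C : contractible (cell h2) f2.
  apply: (contracts_contractible A_sym (h' := fun=> 0%N) f2A) => i j aij.
  rewrite ltnn /in_edge /f2 /h2 /= !memE.
  by case: (cE i) => ->; case: (cE j) => ->;
    rewrite ?eqxx ?(negbTE nuv) //= eq_sym (negbTE nuv).
have nf2 : ~~ contractible (cell h) f2.
  apply/negP=> /andP[/(@arc_in_edge _ A h f2 v u) + _]; rewrite /in_edge !mem_cluster.
  by move=> /(_ isT); rewrite ltnNge (ltnW huv).
have edgeM C f : acyclic 2 C -> contractible C f -> outdiv A C = edge_monom A f.
  move=> aC fC; rewrite (outdiv_contract A_sym aC fC).
  by rewrite (acyclic1 (contract_acyclic A_sym aC fC)) outdiv_trivial add0m.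
exists f1, f2; split.
- by apply: contra nuv => /eqP[-> _].
- exact: class_contractibleI hc f1C.
- exact: class_contractibleI h2c f2C.
- case=> X Y /realizerP[rr /andP[fr _]].
  have arr := classes_acyclic A_sym cl rr.
  have [XP YP XY _] := arcs_partsP A_sym arr fr.
  have [z zr] := classes_gradient A_sym cl hc rr.
  move: XP YP; rewrite -(gradient_parts A_sym ac arr zr) P2 => /set2P XP /set2P YP.
  case: XP XY => ->; case: YP => ->; rewrite ?eqxx // => _; first by left.
  by right.
rewrite hE; split=> //.
rewrite -(edgeM _ _ ac f1C) -(edgeM _ _ ac2 f2C); apply: (proj2 (lin_equivP _ _)).
by eexists=> i; exact: (gradient_outdiv A_sym i ac ac2 zC).
Qed.

End TwoParts.

Lemma factor_sign (R : comPzRingType) (s a x b y : R) :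
  s * a * x + - s * b * y = s * (a * x - b * y).
Proof. by ring. Qed.

Lemma factor_shift (R : comPzRingType) (s w a x b y : R) :
  s * s = 1 -> a * (w * x) - b * (w * y) = (s * w) * (s * (a * x - b * y)).
Proof. by move=> ss; rewrite mulrACA ss mul1r; ring. Qed.

(** * Homogenized binomials as boundaries *)

Section Cokernel.
Local Opaque class_contract class_contractible t_exponent class_monom class_weight
  edge_monom sink_rep edge_contract diamond chip_classes trivial_class
  delta_coef.
Variables (K : fieldType) (m : nat) (A : 'M[nat]_m.+1).
Hypothesis A_sym : forall i j, A i j = A j i.
Hypothesis A_conn : induces_connected (fun i j => A i j) [set: 'I_m.+1].
Variable sign : {set opart m} -> edge m -> int.
Hypothesis sign_sys : is_sign_system A sign.
Variables (y lambda : 'cV[int]_m.+1).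
Hypothesis y_pos : forall i, i != ord_max -> 0 < y i 0.
Hypothesis lambda_y : laplacian_mx A *m lambda = y.
Hypothesis lambda_pos : forall i, 0 < lambda i 0.
Local Notation S := {poly {mpoly K[m.+1]}}.
Local Notation V := 'I_m.+1.
Local Notation classes := (chip_classes A).
Local Notation delta := (@delta m A K lambda sign).
Local Notation basis := (Ft_basis A K).
Local Notation t_exp := (t_exponent A lambda).
Local Notation delta_coef := (delta_coef K A sign lambda).
Local Notation wt := (wdeg lambda).
Local Notation lin_eq u v := (lin_equiv (fun i j => A i j)
  (fun i : V => (u i)%:Z) (fun i : V => (v i)%:Z)).
Implicit Types (e f g : edge m) (c : {set opart m}) (u v w : 'X_{1..m.+1}).

Local Notation trivial_class := (trivial_class A).
Local Notation e0 := (basis 0 trivial_class).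

(** Homogenization of x^u - x^v to a prescribed weight [N], which has to be at least both weights.
    Leaving [N] free lets binomials with a common [N] be added along chains of exponents. *)
Definition binomial (N : int) u v : S :=
  'X^(absz (N - wt u)) * ('X_[u])%:P - 'X^(absz (N - wt v)) * ('X_[v])%:P.

Lemma binomialC N u v : binomial N u v = - binomial N v u.
Proof. by rewrite /binomial opprB. Qed.

Lemma binomialvv N u : binomial N u u = 0.
Proof. by rewrite /binomial subrr. Qed.

Definition image (p : S) : Prop := exists w : Ft A K 1, delta w = p *: e0.

Lemma imageD p q : image p -> image q -> image (p + q).
Proof.
move=> [w wE] [w' wE']; exists (w + w').
rewrite deltaD wE wE' scalerDl; exact: erefl.
Qed.

Lemma imageM a p : image p -> image (a * p).
Proof. by move=> [w wE]; exists (a *: w); rewrite deltaZ wE scalerA. Qed.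

Lemma imageN p : image p -> image (- p).
Proof. by rewrite -mulN1r; apply: imageM. Qed.

Lemma image0 : image 0.
Proof. by exists 0; rewrite delta0 scale0r. Qed.

Lemma image_sum (I : Type) (r : seq I) (P : pred I) (F : I -> S) :
  (forall i, P i -> image (F i)) -> image (\sum_(i <- r | P i) F i).
Proof. by move=> FP; apply: big_ind => //; [apply: image0 | apply: imageD]. Qed.

Lemma sum_two (T : finType) (M : nmodType) (P : pred T) (F : T -> M) x1 x2 :
  x1 != x2 -> P x1 -> P x2 -> (forall x, P x -> x = x1 \/ x = x2) ->
  \sum_(x | P x) F x = F x1 + F x2.
Proof.
move=> n12 P1 P2 P12; rewrite (bigD1 x1) //= (bigD1 x2) /=; last by rewrite P2 eq_sym n12.
rewrite big1 ?addr0 // => x /andP[/andP[Px x1n] x2n].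
by case: (P12 x Px) x1n x2n => ->; rewrite eqxx.
Qed.

Lemma edge_monom_sink c f : c \in classes 2 -> contractible (sink_rep c) f ->
  edge_monom A f = outdiv A (sink_rep c).
Proof.
move=> cl fC; have [rc _] := sink_repP A_sym y_pos lambda_y cl.
have ar := classes_acyclic A_sym cl rc; apply/esym.
rewrite (outdiv_contract A_sym ar fC) (acyclic1 A_sym (contract_acyclic A_sym ar fC)).
rewrite (outdiv_trivial A_sym); exact: add0m.
Qed.

Lemma two_terms (s s' t1 t2 N : int) u v w :
  s' = - s -> t1 = N - wt u -> t2 = N - wt v -> w = u ->
  s%:~R * 'X^(absz t1) * ('X_[w])%:P + s'%:~R * 'X^(absz t2) * ('X_[v])%:P
  = s%:~R * binomial N u v :> S.
Proof. by move=> -> -> -> ->; rewrite intrN; exact: factor_sign. Qed.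

Lemma binomial_shift (s : int) u v w : s = 1 \/ s = -1 ->
  binomial (wt (w + u)%MM) (w + u)%MM (w + v)%MM
  = (s%:~R * ('X_[w])%:P) * (s%:~R * binomial (wt u) u v).
Proof.
move=> sE; have ss : s%:~R * s%:~R = 1 :> S by rewrite -intrM; case: sE => ->.
have M u' : ('X_[(w + u')%MM])%:P = ('X_[w])%:P * ('X_[u'])%:P :> S.
  by rewrite mpolyXD polyCM.
have E u' : wt (w + u)%MM - wt (w + u')%MM = wt u - wt u' by rewrite !wdegD; ring.
by rewrite /binomial !E !M; exact: (factor_shift _ _ _ _ _ ss).
Qed.

(** The edge of the n-acyclic representative contributes no t. The reversed edge is not contractible
    in it, so it carries a positive power of t, and this power is the drop in weight. The opposite
    signs of the two edges make the sum a binomial. *)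
Lemma delta_two c : c \in classes 2 -> exists v (s : int),
  [/\ s = 1 \/ s = -1, lin_eq (outdiv A (sink_rep c)) v,
      wt v < wt (outdiv A (sink_rep c))
    & delta (basis 1 c)
      = (s%:~R * binomial (wt (outdiv A (sink_rep c))) (outdiv A (sink_rep c)) v) *: e0].
Proof.
move=> cl; have [f1 [f2 [n12 fc1 fc2 fc12 [fC1 nfC2 f21 le12]]]] :=
  two_part_edges A_sym A_conn y_pos lambda_y cl.
have [_ t0_1] := t_exponent_ge0 A_sym y_pos lambda_y cl fc1.
have [t_ge t0_2] := t_exponent_ge0 A_sym y_pos lambda_y cl fc2.
have t1E := t0_1.2 fC1.
have t2n : t_exp c f2 != 0 by apply: contra nfC2 => /eqP/t0_2.
have cw0 f : class_contractible c f -> class_contract A c f = trivial_class.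
  by move=> fc; apply: (classes1 A_sym (class_contract_in A_sym cl fc)).
have tE f : class_contractible c f ->
    t_exp c f = wt (outdiv A (sink_rep c)) - wt (edge_monom A f).
  move=> fc; rewrite (t_exponent_monom A_sym lambda cl fc) cw0 //.
  by rewrite (class_weight_trivial A_sym A_conn y_pos lambda_y) addr0.
have e1E := edge_monom_sink cl fC1.
have sgn : sign c f2 = - sign c f1.
  have [_ _ s2] := sign_sys cl; have := s2 f1.1 f1.2.
  rewrite -f21 -surjective_pairing => /(_ fc1 fc2) ->; exact: esym (opprK _).
exists (edge_monom A f2), (sign c f1); split.
- exact: (sign_unit sign_sys cl fc1).
- rewrite -e1E; exact: le12.
- by rewrite -subr_gt0 -(tE _ fc2) lt_neqAle eq_sym t2n t_ge.
rewrite (delta_Ft_basis _ _ _ cl) delta_basisE (sum_two _ n12 fc1 fc2 fc12).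
rewrite (cw0 _ fc1) (cw0 _ fc2) -scalerDl; congr (_ *: _).
rewrite (delta_coef_monom K A_sym sign lambda cl fc1) (delta_coef_monom K A_sym sign lambda cl fc2).
exact: (two_terms sgn (etrans (tE _ fc1) (congr1 (fun w => _ - wt w) e1E))
  (tE _ fc2) e1E).
Qed.

(** The one-part partition has D = 0 and is admissible for every [u]. Splitting off its first atom,
    a connected component of the unburnt set, gives a two-part C with D(C) <= u; its boundary times
    the remaining monomial is the binomial of firing that component. *)
Lemma image_fire u : unburnt A u != set0 -> exists u',
  [/\ lin_eq u u', wt u' < wt u & image (binomial (wt u) u u')].
Proof.
move=> U0; have a1 := trivial_acyclic A_sym A_conn.
have adm : admissible_partition A u (trivial_partition A).
  split; first exact: (trivial_n_acyclic A_sym A_conn).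
  by move=> i; rewrite (outdiv_trivial A_sym) mnm0E.
have sub : cut_atom A u (trivial_partition A) \subset sink_block (trivial_partition A).
  by rewrite /trivial_partition sink_block_cell // cluster_const // subsetT.
have [C [aC [nC outC] _ _ _]] := split_partition A_sym a1 adm U0 sub.
have [cl rE] := n_acyclic_class A_sym y_pos lambda_y aC nC.
have [v [s [sE lv wv dE]]] := delta_two cl; rewrite rE in lv wv dE.
have le1 : (outdiv A C <= u)%MM by apply/mnm_lepP.
have [w uE] : exists w, u = (w + outdiv A C)%MM.
  by exists (u - outdiv A C)%MM; rewrite submK.
exists (w + v)%MM; rewrite uE; split.
- exact: (lin_eq_add A_sym _ lv).
- by rewrite !wdegD ltrD2l.
rewrite (binomial_shift _ _ _ sE).
apply: imageM; exists (basis 1 (chip_class A C)); exact: dE.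
Qed.

End Cokernel.

Lemma telescope_terms (R : pzRingType) (a b c d p q r : R) :
  c = a * b -> d = 1 -> a * p - r = a * (d * p - b * q) + (c * q - r).
Proof. by move=> -> ->; rewrite mul1r mulrBr addrA mulrA subrK. Qed.

Lemma factor_power (R : pzRingType) (a b c p q d e : R) :
  d = a * b -> e = a * c -> d * p - e * q = a * (b * p - c * q).
Proof. by move=> -> ->; rewrite mulrBr !mulrA. Qed.

Lemma split_term (R : comPzRingType) (x a b p q : R) :
  x * p * a = x * (a * p - b * q) + x * (b * q).
Proof. by rewrite -mulrDr subrK -mulrA (mulrC p). Qed.

(** * Superstable exponents and the image of the differential *)

Section Augmentation.
Local Opaque class_contract class_contractible t_exponent class_monom class_weight
  edge_monom sink_rep edge_contract diamond chip_classes trivial_class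
  delta_coef.
Variables (K : fieldType) (m : nat) (A : 'M[nat]_m.+1).
Hypothesis A_sym : forall i j, A i j = A j i.
Hypothesis A_conn : induces_connected (fun i j => A i j) [set: 'I_m.+1].
Variable sign : {set opart m} -> edge m -> int.
Hypothesis sign_sys : is_sign_system A sign.
Variables (y lambda : 'cV[int]_m.+1).
Hypothesis y_pos : forall i, i != ord_max -> 0 < y i 0.
Hypothesis lambda_y : laplacian_mx A *m lambda = y.
Hypothesis lambda_pos : forall i, 0 < lambda i 0.
Local Notation S := {poly {mpoly K[m.+1]}}.
Local Notation V := 'I_m.+1.
Local Notation delta := (@delta m A K lambda sign).
Local Notation basis := (Ft_basis A K).
Local Notation delta_coef := (delta_coef K A sign lambda).
Local Notation wt := (wdeg lambda).
Local Notation lin_eq u v := (lin_equiv (fun i j => A i j)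
  (fun i : V => (u i)%:Z) (fun i : V => (v i)%:Z)).
Implicit Types (c : {set opart m}) (u v w : 'X_{1..m.+1}).

Local Notation trivial_class := (trivial_class A).
Local Notation e0 := (basis 0 trivial_class).

Local Notation binomial := (binomial K lambda).
Local Notation image := (image A sign lambda).

(** If [z] were larger elsewhere than at the last vertex, the set where it is maximal would be
    fireable from [u]: passing from [u] to [v] takes at least one chip along each edge leaving this
    set, and [v] is nonnegative. *)
Lemma superstable_le u v (z : V -> int) : unburnt A u = set0 ->
  (forall i, (u i)%:Z - (v i)%:Z = \sum_j (z i - z j) * (A i j)%:Z) ->
  forall i, z i <= z ord_max.
Proof.
move=> U0 zE i0; rewrite leNgt; apply/negP=> lt0.
have [i1 _ i1max] := @arg_maxP _ _ _ i0 predT z isT.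
pose X := [set i | z i == z i1].
have fX : fireable A u X.
  apply/andP; split.
    by rewrite inE lt_eqF //; apply: lt_le_trans lt0 _; exact: (i1max i0 isT).
  apply/'forall_implyP=> i; rewrite inE => /eqP zi; rewrite -lez_nat Posz_sum.
  rewrite -(subrK (v i)%:Z (u i)%:Z) zE; apply: (@le_trans _ _ (\sum_j (z i - z j) * (A i j)%:Z)).
    rewrite big_mkcond; apply: ler_sum => j _; rewrite inE zi.
    have zj : z j <= z i1 := i1max j isT.
    have [->|nj] /= := eqVneq (z j) (z i1); first by rewrite subrr mul0r.
    rewrite -[X in X <= _]mul1r ler_wpM2r //; move: zj nj; lia.
  by rewrite lerDl.
by have := subsetP (fireable_sub fX) i1; rewrite U0 !inE eqxx => /(_ isT).
Qed.

Lemma superstable_unique u v : lin_eq u v ->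
  unburnt A u = set0 -> unburnt A v = set0 -> u = v.
Proof.
move=> /(proj1 (lin_equivP A_sym _ _))[z zE] U0 V0.
have z1 := superstable_le U0 zE.
have z2 i : - z i <= - z ord_max.
  apply: (superstable_le (v := u) (z := fun i => - z i) V0) => i'.
  rewrite -[LHS]opprB zE -sumrN; apply: eq_bigr => j _; ring.
have zc i : z i = z ord_max by apply/eqP; rewrite eq_le z1 -lerN2 z2.
apply/mnmP=> i; have := zE i; rewrite big1 => [|j _]; last first.
  by rewrite (zc i) (zc j) subrr mul0r.
by move/eqP; rewrite subr_eq0 => /eqP[].
Qed.

Lemma exponent_telescope (N a b : int) : b <= a -> a <= N ->
  absz (N - b) = (absz (N - a) + absz (a - b))%N.
Proof. by lia. Qed.

Lemma binomial_trans N u v w : wt v <= wt u -> wt u <= N ->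
  binomial N u w = 'X^(absz (N - wt u)) * binomial (wt u) u v + binomial N v w.
Proof.
move=> vu uN.
have e1 : 'X^(absz (N - wt v)) = 'X^(absz (N - wt u)) * 'X^(absz (wt u - wt v)) :> S.
  by rewrite (exponent_telescope vu uN) exprD.
have e0 : 'X^(absz (wt u - wt u)) = 1 :> S by rewrite subrr.
exact: (telescope_terms _ _ _ e1 e0).
Qed.

(** As long as one exponent is not superstable, [image_fire] replaces it by an equivalent one of
    smaller weight. Two equivalent superstable exponents are equal, and then the binomial is 0. *)
Lemma image_binomial N u v : lin_eq u v -> wt u <= N -> wt v <= N ->
  image (binomial N u v).
Proof.
have [n] := ubnP (absz (wt u + wt v)); elim: n u v => // n IH u v; rewrite ltnS => ltn luv uN vN.
have step u1 v1 : (absz (wt u1 + wt v1)%R <= n)%N -> lin_eq u1 v1 -> wt u1 <= N -> wt v1 <= N ->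
    unburnt A u1 != set0 -> image (binomial N u1 v1).
  move=> le1 luv1 uN1 vN1 U0.
  have [u' [luu' wu' Ju']] := image_fire K A_sym A_conn sign_sys y_pos lambda_y U0.
  rewrite (binomial_trans v1 (ltW wu') uN1); apply: imageD; first exact: imageM.
  apply: IH => //.
  - apply: leq_trans le1; have := wdeg_ge0 lambda_pos u'; have := wdeg_ge0 lambda_pos v1.
    by move: wu'; clear; move: (wt u') (wt u1) (wt v1) => a b c; lia.
  - exact: (lin_eq_trans A_sym (lin_eq_sym A_sym luu') luv1).
  exact: le_trans (ltW wu') uN1.
have [U0|U0] := eqVneq (unburnt A u) set0; last exact: step.
have [V0|V0] := eqVneq (unburnt A v) set0; last first.
  rewrite (binomialC K lambda); apply: imageN; apply: step => //; first by rewrite addrC.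
  exact: (lin_eq_sym A_sym luv).
rewrite (superstable_unique luv U0 V0) binomialvv; exact: image0.
Qed.

Local Notation homog_ideal := (@homog_toppling_ideal m A K lambda).
Local Notation toppling := (@toppling_ideal m A K).

(** For distinct exponents this is a power of t times the homogenization of x^u - x^v, whose own
    weight is the larger of the two. *)
Lemma homog_binomial N u v : lin_eq u v -> wt u <= N -> wt v <= N ->
  homog_ideal (binomial N u v).
Proof.
move=> luv uN vN; have [->|nuv] := eqVneq u v.
  by rewrite binomialvv; apply: span0.
pose f : {mpoly K[m.+1]} := 'X_[u] - 'X_[v].
have fE w : f@_w = (u == w)%:R - (v == w)%:R by rewrite mcoeffB !mcoeffX.
have sE : perm_eq (msupp f) [:: u; v].
  apply: uniq_perm => [||w]; [exact: msupp_uniq | by rewrite /= inE nuv |].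
  rewrite mcoeff_msupp fE !inE (eq_sym w u) (eq_sym w v).
  have [uw|_] := eqVneq u w; have [vw|_] := eqVneq v w.
  - by rewrite uw vw eqxx in nuv.
  - by rewrite subr0 oner_eq0.
  - by rewrite sub0r oppr_eq0 oner_eq0.
  by rewrite subrr eqxx.
pose W := Num.max (wt u) (wt v).
have WE : \big[Num.max/0]_(w <- msupp f) wt w = W.
  rewrite (perm_big _ sE) !big_cons big_nil /= /W; congr Num.max.
  by apply/max_idPl; apply: wdeg_ge0.
have hE : homogenize lambda f = binomial W u v.
  rewrite /homogenize WE (perm_big _ sE) big_cons big_seq1 /=.
  rewrite !fE !eqxx [v == u]eq_sym (negbTE nuv) subr0 sub0r scale1r scaleN1r.
  rewrite polyCN mulNr; exact: (f_equal2 (fun p q => p - q) (mulrC _ _) (mulrC _ _)).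
have uW : wt u <= W by rewrite /W le_max lexx.
have vW : wt v <= W by rewrite /W le_max lexx orbT.
have WN : W <= N by rewrite /W ge_max uN.
have -> : binomial N u v = 'X^(absz (N - W)) * binomial W u v.
  have e w : wt w <= W -> 'X^(absz (N - wt w)) = 'X^(absz (N - W)) * 'X^(absz (W - wt w)) :> S.
    by move=> wW; rewrite (exponent_telescope wW WN) exprD.
  exact: (factor_power _ _ (e u uW) (e v vW)).
rewrite -hE; apply: spanZ; apply: span_mem; exists f; split=> //.
by apply: span_mem; exists u, v.
Qed.

Definition class_sum (P : pred 'X_{1..m.+1}) (p : {mpoly K[m.+1]}) : K :=
  \sum_(u <- msupp p | P u) p@_u.

Lemma class_sum_super P (p : {mpoly K[m.+1]}) (s : seq 'X_{1..m.+1}) :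
  uniq s -> {subset msupp p <= s} -> class_sum P p = \sum_(u <- s | P u) p@_u.
Proof.
move=> us sub; rewrite [RHS](bigID (mem (msupp p))) /=.
rewrite [X in _ + X]big1 => [|u /andP[_]]; last first.
  by rewrite mcoeff_msupp negbK => /eqP.
rewrite addr0 big_andbC -big_filter_cond /class_sum; apply: perm_big.
apply: uniq_perm; [exact: msupp_uniq | exact: filter_uniq |] => u.
by rewrite mem_filter; case: (boolP (u \in msupp p)) => //= /sub ->.
Qed.

Lemma class_sumD P (p q : {mpoly K[m.+1]}) :
  class_sum P (p + q) = class_sum P p + class_sum P q.
Proof.
pose s := undup (msupp p ++ msupp q ++ msupp (p + q)).
have us : uniq s := undup_uniq _.
have sub (r : {mpoly K[m.+1]}) : {subset msupp r <= msupp p ++ msupp q ++ msupp (p + q)} ->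
    class_sum P r = \sum_(u <- s | P u) r@_u.
  by move=> rs; apply: class_sum_super => // u /rs; rewrite mem_undup.
rewrite !sub ?big_split => [|u|u|u]; rewrite ?mem_cat; try by move=> ->; rewrite ?orbT.
by rewrite -big_split; apply: eq_bigr => u _; rewrite mcoeffD.
Qed.

Lemma class_sumX P (x : K) u : class_sum P (x *: 'X_[u]) = x * (P u)%:R.
Proof.
rewrite (@class_sum_super P _ [:: u]) // => [|v /msuppZ_le]; last by rewrite msuppX.
rewrite big_mkcond big_seq1 mcoeffZ mcoeffX eqxx mulr1.
by case: (P u); rewrite ?mulr1 ?mulr0.
Qed.

Lemma class_sum_sum P (I : Type) (r : seq I) (Q : pred I) (F : I -> {mpoly K[m.+1]}) :
  (forall i, Q i -> class_sum P (F i) = 0) -> class_sum P (\sum_(i <- r | Q i) F i) = 0.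
Proof.
move=> F0; apply: (big_ind (fun p => class_sum P p = 0)) => //.
  by rewrite /class_sum msupp0 big_nil.
by move=> p q p0 q0; rewrite class_sumD p0 q0 addr0.
Qed.

(** A generator times a monomial has its two terms in the same class with opposite coefficients, and
    the sum of the coefficients over a class is additive. *)
Lemma toppling_class_sum (p : {mpoly K[m.+1]}) u0 : toppling p ->
  class_sum (fun u => `[< lin_eq u0 u >]) p = 0.
Proof.
move=> [N [a [g [gI ->]]]]; apply: class_sum_sum => i _.
have [u [v [luv ->]]] := gI i; rewrite [a i]mpolyE scaler_suml; apply: class_sum_sum => w _.
have -> : ((a i)@_w *: 'X_[w] : {mpoly K[m.+1]}) *: ('X_[u] - 'X_[v] : {mpoly K[m.+1]}^o)
    = (a i)@_w *: 'X_[(w + u)%MM] + (- (a i)@_w) *: 'X_[(w + v)%MM].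
  by rewrite [LHS]mulrBr -!scalerAl -!mpolyXD scaleNr.
rewrite class_sumD !class_sumX mulNr.
have lw := lin_eq_add A_sym w luv.
suff -> : `[< lin_eq u0 (w + u)%MM >] = `[< lin_eq u0 (w + v)%MM >] by rewrite subrr.
apply/asboolP/asboolP => l0; first exact: (lin_eq_trans A_sym l0 lw).
exact: (lin_eq_trans A_sym l0 (lin_eq_sym A_sym lw)).
Qed.

(** Each exponent of the support is compared with a representative of its class taken from the
    support itself, so that its weight is bounded by the same maximum [W]. The binomials lie in the
    image, and what is left at each representative has as coefficient the sum over its class, which
    is 0. *)
Lemma image_homogenize p : toppling p -> image (homogenize lambda p).
Proof.
move=> pI; pose W : int := \big[Num.max/0]_(u <- msupp p) wt u.
rewrite /homogenize -/W.
have uW u : u \in msupp p -> wt u <= W.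
  rewrite /W; elim: (msupp p) => [//|v s IH]; rewrite inE big_cons le_max.
  by case/predU1P=> [->|/IH ->]; rewrite ?lexx ?orbT.
pose s := msupp p; rewrite -/s.
pose T u : S := 'X^(absz (W - wt u)) * ('X_[u])%:P.
pose x u : S := ((p@_u)%:MP)%:P.
(* The position of the first equivalent exponent in the support, so that equivalent exponents of the
   support get equal indices. The successor in the type leaves room for [find] returning [size s] on
   exponents without equivalent in the support. *)
pose rho u : 'I_(size s).+1 := inord (find (fun v => `[< lin_eq u v >]) s).
pose r u : 'X_{1..m.+1} := nth 0%MM s (rho u).
have find_lt u : u \in s -> (find (fun v => `[< lin_eq u v >]) s < size s)%N.
  move=> us; rewrite -has_find; apply/hasP; exists u => //.
  exact/asboolP/(lin_eq_refl A_sym).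
have rhoE u : rho u = find (fun v => `[< lin_eq u v >]) s :> nat.
  by rewrite inordK // ltnS find_size.
have rs u : u \in s -> r u \in s by move=> us; rewrite /r rhoE mem_nth ?find_lt.
have lr u : u \in s -> lin_eq u (r u).
  move=> us; rewrite /r rhoE; apply/asboolP.
  by apply: (@nth_find _ 0%MM (fun v => `[< lin_eq u v >])); rewrite has_find find_lt.
have rho_eq u v : u \in s -> v \in s -> (rho u == rho v) = `[< lin_eq u v >].
  move=> us vs; apply/eqP/asboolP => [uv|luv].
    have rr : r u = r v by rewrite /r uv.
    apply: (lin_eq_trans A_sym (lr u us)); rewrite rr.
    exact: (lin_eq_sym A_sym (lr v vs)).
  congr inord; apply: eq_find => w; apply/asboolP/asboolP => l.
    exact: (lin_eq_trans A_sym (lin_eq_sym A_sym luv) l).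
  exact: (lin_eq_trans A_sym luv l).
have -> : \sum_(u <- s) (p@_u *: 'X_[u])%:P * 'X^(absz (W - wt u))
    = \sum_(u <- s) x u * binomial W u (r u) + \sum_(u <- s) x u * T (r u).
  rewrite -big_split; apply: eq_bigr => u _ /=.
  have -> : (p@_u *: 'X_[u])%:P = x u * ('X_[u])%:P :> S by rewrite -mul_mpolyC polyCM.
  exact: split_term.
apply: imageD.
  rewrite big_seq; apply: image_sum => u us; apply: imageM.
  apply: image_binomial; [exact: lr | exact: uW | exact/uW/rs].
have -> : \sum_(u <- s) x u * T (r u) = 0; last exact: image0.
rewrite (partition_big rho predT) //= big1 // => j _.
have [/hasP[u0 u0s /eqP u0j]|none] := boolP (has (fun u => rho u == j) s); last first.
  by rewrite big_hasC.
transitivity (\sum_(u <- s | rho u == j) x u * T (r u0)).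
  by apply: eq_bigr => u /eqP uj; rewrite /r uj u0j.
rewrite -mulr_suml -!rmorph_sum /=.
have -> : \sum_(u <- s | rho u == j) p@_u = 0; last by rewrite !rmorph0 mul0r.
apply: etrans (toppling_class_sum u0 pI); rewrite /class_sum -/s.
rewrite big_seq_cond [RHS]big_seq_cond; apply: eq_bigl => u.
by case us: (u \in s) => //=; rewrite -rho_eq // u0j eq_sym.
Qed.

Lemma homog_image (p : S) : homog_ideal p -> image p.
Proof.
move=> [N [a [g [gI ->]]]]; apply: image_sum => i _.
by have [f [fI ->]] := gI i; apply: imageM; apply: image_homogenize.
Qed.

Lemma Ft0E (v : Ft A K 0) : v = augmentation v *: e0.
Proof.
rewrite {1}(Ft_expand v) /augmentation scaler_suml; apply: eq_bigr => c _.
by rewrite (classes1 A_sym (valP c)).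
Qed.

Lemma augmentation_basis : augmentation (e0 : Ft A K 0) = 1.
Proof.
rewrite /augmentation (bigD1 (Sub trivial_class (trivial_class_in A_sym A_conn))) //=.
rewrite ffunE eqxx big1 ?addr0 // => c nc; rewrite ffunE.
by rewrite -val_eqE /= (classes1 A_sym (valP c)) eqxx in nc.
Qed.

Lemma augmentationZ (a : S) (v : Ft A K 0) : augmentation (a *: v) = a * augmentation v.
Proof.
by rewrite /augmentation mulr_sumr; apply: eq_bigr => c _; rewrite ffunE.
Qed.

Lemma augmentation_sum (I : Type) (r : seq I) (P : pred I) (F : I -> Ft A K 0) :
  augmentation (\sum_(i <- r | P i) F i) = \sum_(i <- r | P i) augmentation (F i).
Proof.
apply: (big_morph (@augmentation m A K)) => [u v|].
  by have := augmentation_linear 1 u v; rewrite !scale1r.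
by rewrite /augmentation big1 // => c _; rewrite ffunE.
Qed.

Lemma augmentation_delta (w : Ft A K 1) : homog_ideal (augmentation (delta w)).
Proof.
rewrite /Defs.delta augmentation_sum; apply: span_sum => c _.
rewrite augmentationZ; apply: spanZ.
rewrite -(delta_Ft_basis K sign lambda (valP c)).
have [v [s [_ lv wv ->]]] := delta_two K A_sym A_conn sign_sys y_pos lambda_y (valP c).
rewrite augmentationZ augmentation_basis mulr1; apply: spanZ.
exact: (homog_binomial lv (lexx _) (ltW wv)).
Qed.

Lemma delta_exact0 (v : Ft A K 0) :
  homog_ideal (augmentation v) <-> exists w : Ft A K 1, delta w = v.
Proof.
split=> [/homog_image[w wE]|[w <-]]; last exact: augmentation_delta.
by exists w; rewrite wE -Ft0E.
Qed.

Lemma augmentation_surj (p : S) : exists v : Ft A K 0, homog_ideal (p - augmentation v).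
Proof.
exists (p *: e0); rewrite augmentationZ augmentation_basis mulr1 subrr.
exact: span0.
Qed.

End Augmentation.

Theorem theorem6p2 (K : fieldType) (m : nat) (A : 'M[nat]_m.+1)
    (A_sym : forall i j, A i j = A j i)
    (A_conn : induces_connected (fun i j => A i j) [set: 'I_m.+1])
    (sign : {set opart m} -> edge m -> int)
    (sign_sys : is_sign_system A sign)
    (y lambda : 'cV[int]_m.+1)
    (y_pos : forall i, i != ord_max -> 0 < y i 0)
    (lambda_y : laplacian_mx A *m lambda = y)
    (lambda_pos : forall i, 0 < lambda i 0) :
  minimal_free_resolution
    (@is_variable m K)
    (@homog_toppling_ideal m A K lambda)
    m
    (@delta m A K lambda sign)
    (@augmentation m A K).
Proof.
split.
- exact: (Ft_length A_sym).
- exact: delta_linear.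
- exact: augmentation_linear.
- exact: (delta_exact A_sym sign_sys y_pos lambda_y lambda_pos).
- exact: (delta_exact0 A_sym A_conn sign_sys y_pos lambda_y lambda_pos).
- exact: (augmentation_surj A_sym A_conn).
exact: (delta_minimal A_sym).
Qed.
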